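(* Let $\mathcal X$ be a separable real Hilbert space and let $\mathcal A:D(\mathcal A)\subset\mathcal X\to\mathcal X$ be the generator of a $C_0$-semigroup such that, for some positive constants $k,\nu$, $\|e^{\mathcal A t}\varphi_0\|_{\mathcal X}\le k e^{-\nu t}\|\varphi_0\|_{\mathcal X}$ for all $\varphi_0\in\mathcal X$, $t\ge0$. Let $\mathcal B:\mathbb R^m\to\mathcal X$ be a bounded linear operator and let $\mathcal C:D(\mathcal C)\subseteq\mathcal X\to\mathbb R^m$ be a linear operator with $D(\mathcal A)\subseteq D(\mathcal C)$ which is $\mathcal A$-admissible. Assume that $\operatorname{rank}\{\mathcal C\mathcal A^{-1}\mathcal B\}=m$. Set $$K_i=(\mathcal C\mathcal A^{-1}\mathcal B)^{-1},\qquad k_i^*=\frac{\nu}{\|\mathcal C\mathcal A^{-1}\|\,k^2\,\|\mathcal B(\mathcal C\mathcal A^{-1}\mathcal B)^{-1}\|}.$$ Then for every $0<k_i<k_i^*$ and every $(w,y_{ref})\in\mathcal X\times\mathbb R^m$, the closed-loop system $$\varphi_t=\mathcal A\varphi+k_i\mathcal B K_i z+w,\qquad z_t=\mathcal C\varphi-y_{ref}$$ on $\mathcal X_e=\mathcal X\times\mathbb R^m$ has the following properties. 1. For every $\varphi_{e0}=(\varphi_0,z_0)\in\mathcal X_e$ there exists a unique weak solution $\varphi_e=(\varphi,z)\in C^0([0,\infty),\mathcal X_e)$ defined for all $t\ge0$ with $\varphi_e(0)=\varphi_{e0}$. 2. There exists an equilibrium point $\varphi_{e\infty}=(\varphi_\infty,z_\infty)\in\mathcal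 X_e$ (depending on $w$ and $y_{ref}$) which is exponentially stable: there exist positive real numbers $\nu_e,k_e$ such that for all $\varphi_{e0}\in\mathcal X_e$ and $t\ge0$, $$\|\varphi_e(t)-\varphi_{e\infty}\|_{\mathcal X_e}\le k_e e^{-\nu_e t}\|\varphi_{e0}-\varphi_{e\infty}\|_{\mathcal X_e}.$$ 3. The output $y=\mathcal C\varphi$ is regulated toward the reference $y_{ref}$: for every $\varphi_{e0}\in\mathcal X_e$, $\lim_{t\to+\infty}|\mathcal C\varphi(t)-y_{ref}|=0$.
   Context: $\mathcal C$ is $\mathcal A$-admissible means: (i) it is $\mathcal A$-bounded, i.e. there is $c>0$ with $|\mathcal C\varphi|\le c(\|\varphi\|_{\mathcal X}+\|\mathcal A\varphi\|_{\mathcal X})$ for all $\varphi\in D(\mathcal A)$; and (ii) there exist $T>0$, $c_T>0$ such that $\int_0^T|\mathcal C e^{\mathcal A t}\varphi|^2dt\le c_T^2\|\varphi\|_{\mathcal X}^2$ for all $\varphi\in D(\mathcal A)$. $\mathcal X_e$ carries the inner product $\langle(\varphi_a,z_a),(\varphi_b,z_b)\rangle_{\mathcal X_e}=\langle\varphi_a,\varphi_b\rangle_{\mathcal X}+z_a^\top z_b$ and its associated norm. Norms of $\mathcal C\mathcal A^{-1}:\mathcal X\to\mathbb R^m$ and $\mathcal B(\mathcal C\mathcal A^{-1}\mathcal B)^{-1}:\mathbb R^m\to\mathcal X$ are operator norms; $|\cdot|$ is the Euclidean norm. The closed loop reads $\dot\varphi_e=\mathcal A_e\varphi_e+(w,-y_{ref})$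 with $\mathcal A_e(\varphi,z)=(\mathcal A\varphi+k_i\mathcal B K_i z,\mathcal C\varphi)$ on $D(\mathcal A_e)=D(\mathcal A)\times\mathbb R^m$. Weak solution is meant in the usual sense: for every $\psi\in D(\mathcal A_e^* )$, $t\mapsto\langle\varphi_e(t),\psi\rangle_{\mathcal X_e}$ is absolutely continuous with derivative $\langle\varphi_e(t),\mathcal A_e^*\psi\rangle_{\mathcal X_e}+\langle(w,-y_{ref}),\psi\rangle_{\mathcal X_e}$ for almost every $t$. An equilibrium is a point $\varphi_{e\infty}\in D(\mathcal A_e)$ with $\mathcal A_e\varphi_{e\infty}+(w,-y_{ref})=0$. In property 3, $\varphi$ is the first component of the solution $\varphi_e$ with initial condition $\varphi_{e0}$.
   Formalization: Property 3 fails for general φ_e0, since Cφ(t) may be undefined or have no limit; here the pointwise limit is proved once φ(t) enters D(A), and for every φ_e0 the L² output y given by z_t = y − y_ref satisfies ∫_t^{t+1}|y−y_ref|² → 0. *)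

(* Defs.v *)
From HB Require Import structures.
From mathcomp Require Import all_boot all_order all_algebra.
From mathcomp Require Import all_classical all_reals all_analysis.

Set Implicit Arguments.
Unset Strict Implicit.
Unset Printing Implicit Defensive.

Import Order.TTheory GRing.Theory Num.Theory.
Import numFieldNormedType.Exports.

Local Open Scope classical_set_scope.
Local Open Scope ring_scope.

(* An operator with domain [dom T]; the values of [app T] outside [dom T] are
   irrelevant. *)
Record operator (U V : Type) := Operator { dom : set U; app :> U -> V }.

Definition linear_operator (R : realType) (U V : lmodType R)
    (T : operator U V) : Prop :=
  dom T 0 /\
  forall (a : R) (x y : U), dom T x -> dom T y ->
    dom T (a *: x + y) /\ T (a *: x + y) = a *: T x + T y.

(* The value at [y] of the inverse of [T]; it is the preimage of [y] as soon as
   [T] is a bijection from [dom T] onto [V], and is [0] when [y] has none. *)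
Definition inv_app (R : realType) (U : lmodType R) (V : Type)
    (T : operator U V) (y : V) : U :=
  xget 0 [set x | dom T x /\ T x = y].

(* A real supremum, hence the operator norm only when [f] is bounded. *)
Definition opnorm (R : realType) (U V : Type) (nU : U -> R) (nV : V -> R)
    (f : U -> V) : R :=
  sup [set nV (f u) | u in [set u | nU u <= 1]].

(* The library norm on matrices is the sup norm, so the Euclidean one is
   spelled out. *)
Definition edot (R : realType) (m : nat) (u v : 'cV[R]_m) : R :=
  (u^T *m v) 0 0.

Definition enorm (R : realType) (m : nat) (u : 'cV[R]_m) : R :=
  Num.sqrt (edot u u).

Definition mx_of (R : realType) (m n : nat) (f : 'cV[R]_n -> 'cV[R]_m) :
    'M[R]_(m, n) :=
  \matrix_(i < m, j < n) f (delta_mx j 0) i 0.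

(* A real Hilbert space is a complete normed module whose norm is the one of a
   symmetric positive definite bilinear form. *)
Definition norm_of_dot (R : realType) (X : completeNormedModType R)
    (dot : {dot X for idfun}) : Prop :=
  forall x : X, `|x| ^+ 2 = dot x x.

Definition separable (T : topologicalType) : Prop :=
  exists2 E : set T, countable E & dense E.

(* [S t] is only constrained for [0 <= t]. *)
Definition C0_semigroup (R : realType) (X : completeNormedModType R)
    (S : R -> X -> X) : Prop :=
  [/\ forall t, 0 <= t -> linear (S t) /\ continuous (S t),
      forall x, S 0 x = x,
      forall s t x, 0 <= s -> 0 <= t -> S (s + t) x = S s (S t x) &
      forall x, S t x @[t --> 0^'+] --> x].

Definition generator (R : realType) (X : completeNormedModType R)
    (S : R -> X -> X) (A : operator X X) : Prop :=
  forall x y, (dom A x /\ A x = y) <->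
    h^-1 *: (S h x - x) @[h --> 0^'+] --> y.

Definition admissible (R : realType) (X : completeNormedModType R) (m : nat)
    (S : R -> X -> X) (A : operator X X) (C : operator X 'cV[R]_m) : Prop :=
  (exists2 c : R, 0 < c &
     forall x, dom A x -> enorm (C x) <= c * (`|x| + `|A x|)) /\
  (exists T cT : R, [/\ 0 < T, 0 < cT &
     forall x, dom A x ->
       (\int[lebesgue_measure]_(t in `[0%R, T]) (enorm (C (S t x)) ^+ 2)%:E
          <= (cT ^+ 2 * `|x| ^+ 2)%:E)%E]).

(* Its canonical norm in the library is the max of the norms of the components;
   it induces the same topology as [normE]. *)
Definition dotE (R : realType) (X : completeNormedModType R) (m : nat)
    (dot : {dot X for idfun}) (p q : X * 'cV[R]_m) : R :=
  dot p.1 q.1 + edot p.2 q.2.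

Definition normE (R : realType) (X : completeNormedModType R) (m : nat)
    (dot : {dot X for idfun}) (p : X * 'cV[R]_m) : R :=
  Num.sqrt (dotE dot p p).

(* [chi] is unique, hence the Hilbert adjoint, when [dom T] is dense. *)
Definition adjointE (R : realType) (X : completeNormedModType R) (m : nat)
    (dot : {dot X for idfun})
    (T : operator (X * 'cV[R]_m) (X * 'cV[R]_m)) :
    operator (X * 'cV[R]_m) (X * 'cV[R]_m) :=
  let rep psi := [set chi |
    forall p, dom T p -> dotE dot (T p) psi = dotE dot p chi] in
  Operator [set psi | rep psi !=set0] (fun psi => xget 0 (rep psi)).

Definition absolutely_continuous (R : realType) (a b : R) (f : R -> R) : Prop :=
  forall e : R, 0 < e -> exists2 d : R, 0 < d &
    forall (n : nat) (u v : nat -> R),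
      (forall i, (i < n)%N -> [/\ a <= u i, u i <= v i & v i <= b]) ->
      (forall i, (i.+1 < n)%N -> v i <= u i.+1) ->
      \sum_(i < n) (v i - u i) < d ->
      \sum_(i < n) `|f (v i) - f (u i)| < e.

(* On [0, +oo); the values of [phi] at negative times are irrelevant. *)
Definition weak_solution (R : realType) (X : completeNormedModType R) (m : nat)
    (dot : {dot X for idfun})
    (T : operator (X * 'cV[R]_m) (X * 'cV[R]_m)) (f : X * 'cV[R]_m)
    (phi : R -> X * 'cV[R]_m) : Prop :=
  {within `[0, +oo[, continuous phi} /\
  forall psi, dom (adjointE dot T) psi ->
    (forall b : R, 0 <= b ->
       absolutely_continuous 0 b (fun t => dotE dot (phi t) psi)) /\
    {ae lebesgue_measure, forall t : R, 0 < t ->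
       is_derive t 1 (fun s => dotE dot (phi s) psi)
         (dotE dot (phi t) (adjointE dot T psi) + dotE dot f psi)}.

Definition equilibrium (R : realType) (X : completeNormedModType R) (m : nat)
    (T : operator (X * 'cV[R]_m) (X * 'cV[R]_m)) (f p : X * 'cV[R]_m) : Prop :=
  dom T p /\ T p + f = 0.

(* [C A^-1 B], identified with its matrix in the canonical basis. *)
Definition dc_gain (R : realType) (X : completeNormedModType R) (m : nat)
    (A : operator X X) (B : 'cV[R]_m -> X) (C : operator X 'cV[R]_m) :
    'M[R]_m :=
  mx_of (fun v => C (inv_app A (B v))).

Definition Ki (R : realType) (X : completeNormedModType R) (m : nat)
    (A : operator X X) (B : 'cV[R]_m -> X) (C : operator X 'cV[R]_m) :
    'M[R]_m :=
  invmx (dc_gain A B C).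

Definition ki_star (R : realType) (X : completeNormedModType R) (m : nat)
    (A : operator X X) (B : 'cV[R]_m -> X) (C : operator X 'cV[R]_m)
    (k nu : R) : R :=
  nu / (opnorm (fun x : X => `|x|) (@enorm R m) (fun x => C (inv_app A x))
        * k ^+ 2
        * opnorm (@enorm R m) (fun x : X => `|x|)
            (fun v => B (invmx (dc_gain A B C) *m v))).

Definition closed_loop (R : realType) (X : completeNormedModType R) (m : nat)
    (A : operator X X) (B : 'cV[R]_m -> X) (C : operator X 'cV[R]_m) (ki : R) :
    operator (X * 'cV[R]_m) (X * 'cV[R]_m) :=
  Operator [set p | dom A p.1]
    (fun p => (A p.1 + ki *: B (Ki A B C *m p.2), C p.1)).

(* The output [y = C phi] of a weak solution [(phi, z)], as a locally
   square-integrable function of time.  A weak solution need not take its values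
   in [dom A], outside of which [C] is not controlled by [A]: there the output
   is determined, up to null sets, by the integrator [z' = y - yref]; it is
   [C (phi t)] whenever [phi t] is in [dom A]. *)
Definition output (R : realType) (X : completeNormedModType R) (m : nat)
    (A : operator X X) (C : operator X 'cV[R]_m) (yref : 'cV[R]_m)
    (phi : R -> X * 'cV[R]_m) (y : R -> 'cV[R]_m) : Prop :=
  [/\ forall i : 'I_m,
        measurable_fun (`[0, +oo[ : set R) (fun t => y t i 0),
      forall b : R, 0 <= b ->
        (\int[lebesgue_measure]_(t in `[0%R, b]) (enorm (y t) ^+ 2)%:E < +oo)%E,
      forall (t : R) i, 0 <= t ->
        (phi t).2 i 0 = (phi 0).2 i 0 +
          \int[lebesgue_measure]_(s in `[0, t]) (y s i 0 - yref i 0) &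
      forall t : R, 0 <= t -> dom A (phi t).1 -> y t = C (phi t).1].

(* [y = C phi] tends to [yref]: in mean square over a sliding window for every
   solution, and pointwise, [C (phi t)] being then defined for all later times,
   as soon as [phi] reaches [dom A] (at time [0] if the initial condition is in
   the domain of the closed loop).  Pointwise convergence fails in general for
   solutions which never reach [dom A]: take for [C] the evaluation at [0] and
   for [A] the damped left translation on L^2(0, +oo). *)
Definition regulated (R : realType) (X : completeNormedModType R) (m : nat)
    (A : operator X X) (C : operator X 'cV[R]_m) (yref : 'cV[R]_m)
    (phi : R -> X * 'cV[R]_m) : Prop :=
  (exists2 y : R -> 'cV[R]_m, output A C yref phi y &
     (\int[lebesgue_measure]_(s in `[t, (t + 1)%R]) (enorm (y s - yref) ^+ 2)%:E)%E
       @[t --> +oo] --> 0%E) /\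
  (forall t0 : R, 0 <= t0 -> dom A (phi t0).1 ->
     (forall t, t0 <= t -> dom A (phi t).1) /\
     enorm (C (phi t).1 - yref) @[t --> +oo] --> 0).

(* Main.v *)
(* Put M = C A^-1, which is bounded, F z = ki B Ki z, and eta = z - M phi.  Since
   M F = ki, the closed loop becomes phi' = A phi + F z, eta' = - ki z, a bounded
   perturbation of A in which C no longer occurs; it is solved in mild form by
   Picard iteration.  In the equivalent norm |x|_* = sup_t exp (nu t) |S(t) x| the
   semigroup contracts like exp (- nu t), and with mu = |M|, beta = |B Ki| the
   function |phi|_*^2 + (k beta / mu) |eta|^2 has a Dini derivative which is negative
   definite exactly when ki k beta mu < nu, hence decays exponentially.

   The operator of the closed loop has an explicit bounded inverse, so a weak
   solution is characterised by the fact that its image under the inverse,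
   after subtraction of the equilibrium, is right differentiable with derivative the
   solution itself; uniqueness then follows from the decay of the Lyapunov function.

   For data in the domain, C phi - yref is the second component of the solution
   starting from the time derivative, hence tends to 0.  In general, z is a limit of
   second components of such classical solutions, whose derivatives converge in
   L^1(0, N) by admissibility of C; the limit is the derivative of z almost
   everywhere, and Fatou's lemma transfers the exponentially decaying bound on
   windows of length 1. *)
Require Import Defs.
From HB Require Import structures.
From mathcomp Require Import all_boot all_order all_algebra.
From mathcomp Require Import all_classical all_reals all_analysis.
From mathcomp Require Import measurable_realfun ring lra.
Import Order.TTheory GRing.Theory Num.Theory.
Import numFieldNormedType.Exports.
Local Open Scope classical_set_scope.
Local Open Scope ring_scope.
Set Implicit Arguments.
Unset Strict Implicit.
Unset Printing Implicit Defensive.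

(** * Calculus on the half-line with right derivatives *)

(** The gain threshold balances two couplings: [z] acts on [phi] with strength [ki * k * bet], the
    factor [k] being the price for measuring the input in the adapted norm, and [phi] acts on [eta]
    with strength [ki * mu]. With the weight [k * bet / mu] the cross terms complete a square. The
    estimate at time 0 on a nonzero vector gives [1 <= k], which turns the [k ^+ 2] of [ki_star]
    into this single factor [k]. Semigroups and generators are one-sided in time and the adapted
    norm need not be differentiable, whence a calculus of right derivatives and Dini bounds.
    Vector-valued integrals are replaced by primitives, built from scalar ones by the Riesz
    representation; that theorem also gives the adjoint of the inverse of the closed loop, and so
    enough test vectors for the weak formulation. The energy of the output has to be bounded by the
    solution itself, not by its derivative. Admissibility gives this for the free semigroup on a
    short window; the feedback adds a term that is absorbed on a possibly shorter one. *)

Section RealAnalysis.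
Context {R : realType}.
Implicit Types (V : normedModType R) (a b c d e h s t : R).

(** Continuity on the closed half-line, insensitive to the values at negative times, where
    semigroups and solutions are unconstrained. *)
Definition cont0 V (f : R -> V) : Prop :=
  forall t, 0 <= t -> forall e, 0 < e -> exists2 d, 0 < d &
    forall s, 0 <= s -> `|s - t| < d -> `|f s - f t| <= e.

Definition rder V (f : R -> V) (t : R) (l : V) : Prop :=
  forall e, 0 < e -> exists2 d, 0 < d &
    forall h, 0 < h -> h < d -> `|f (t + h) - f t - h *: l| <= e * h.

(* The upper right Dini derivative of [g] at [t] is at most [c]. *)
Definition dini (g : R -> R) (t c : R) : Prop :=
  forall e, 0 < e -> exists2 d, 0 < d &
    forall h, 0 < h -> h < d -> g (t + h) <= g t + h * (c + e).

(** Allow a slope [e > 0] and take the supremum [s] of the [t] in [[a, b]] with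
    [g t <= g a + e * (t - a)]: continuity puts [s] in this set, and if [s < b] the Dini bound at
    [s] produces a larger element. *)
Lemma dini_noninc (g : R -> R) a b : 0 <= a -> a <= b ->
  cont0 g -> (forall t, a <= t -> t < b -> dini g t 0) -> g b <= g a.
Proof.
move=> a0 ab cg dg; apply/ler_addgt0Pr => e' e'0.
(* The [+ 1] keeps the denominator positive when [a = b]. *)
pose e := e' / (b - a + 1).
have ba1 : 0 < b - a + 1 by lra.
have e0 : 0 < e by rewrite divr_gt0.
suff: g b <= g a + e * (b - a).
  move=> h; apply: (le_trans h); rewrite lerD2l.
  have : e * (b - a + 1) = e' by rewrite /e mulfVK// gt_eqF.
  nra.
pose E := [set t | a <= t <= b /\ g t <= g a + e * (t - a)].
have Ea : E a by split; [rewrite lexx|rewrite subrr mulr0 addr0].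
have supE : has_sup E.
  by split; [exists a|exists b => t [/andP[_ ?] _]].
pose s := sup E.
have as_ : a <= s by apply: ub_le_sup => //; case: supE.
have sb : s <= b by apply: ge_sup; [exists a|move=> t [/andP[_ ?] _]].
have Es : g s <= g a + e * (s - a).
  apply/ler_addgt0Pr => d' d'0.
  have s0 : 0 <= s by lra.
  have d2 : 0 < d' / 2 by rewrite divr_gt0.
  have [d d0 hd] := cg s s0 _ d2.
  have [r Er rs] := sup_adherent d0 supE.
  have rles : r <= s by apply: ub_le_sup => //; case: supE.
  case: Er => /andP[ar rb] gr.
  have r0 : 0 <= r by lra.
  have := hd r r0; rewrite distrC ger0_norm; last by lra.
  move=> /(_ ltac:(rewrite -/s in rs; lra)); rewrite ler_norml => /andP[h1 _].
  have : e * (r - a) <= e * (s - a) by rewrite ler_pM2l//; lra.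
  lra.
have [sltb|] := ltP s b; last by move=> bs; have -> : b = s by lra.
have [d d0 hd] := dg s as_ sltb _ e0.
pose h := Num.min (d / 2) (b - s).
have h0 : 0 < h by rewrite lt_min; apply/andP; split; lra.
have hd' : h < d by rewrite gt_min; apply/orP; left; lra.
have hb : h <= b - s by rewrite ge_min lexx orbT.
have : E (s + h).
  split; first by apply/andP; split; lra.
  by apply: (le_trans (hd h h0 hd')); lra.
move=> /(ub_le_sup (proj2 supE)); rewrite -/s; lra.
Qed.

(** Apply [dini_noninc] to [|F t - F a| - G t]. Increments of [F] and [G] are compared directly,
    without a derivative of [F], as variation of constants requires. *)
Lemma mvi V (F : R -> V) (G : R -> R) a b : 0 <= a -> a <= b ->
  cont0 F -> cont0 G ->
  (forall t, a <= t -> t < b -> forall e, 0 < e -> exists2 d, 0 < d &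
     forall h, 0 < h -> h < d ->
       `|F (t + h) - F t| <= G (t + h) - G t + e * h) ->
  `|F b - F a| <= G b - G a.
Proof.
move=> a0 ab cF cG H.
suff : `|F b - F a| - G b <= `|F a - F a| - G a.
  by rewrite subrr normr0; lra.
apply: (@dini_noninc (fun t => `|F t - F a| - G t)) => //.
- move=> t t0 e e0; have e2 : 0 < e / 2 by rewrite divr_gt0.
  have [d1 d10 h1] := cF t t0 _ e2; have [d2 d20 h2] := cG t t0 _ e2.
  exists (Num.min d1 d2); first by rewrite lt_min d10.
  move=> s s0; rewrite lt_min => /andP[/(h1 s s0) k1 /(h2 s s0) k2].
  have -> : `|F s - F a| - G s - (`|F t - F a| - G t) =
     (`|F s - F a| - `|F t - F a|) - (G s - G t) by lra.
  apply: (le_trans (ler_normB _ _)).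
  have := ler_dist_dist (F s - F a) (F t - F a).
  have -> : F s - F a - (F t - F a) = F s - F t by rewrite opprB addrA subrK.
  lra.
- move=> t at_ tb e e0; have [d d0 hd] := H t at_ tb e e0.
  exists d => // h h0 /(hd h h0) k.
  have := ler_distD (F t) (F (t + h)) (F a); lra.
Qed.

Lemma mvi_rder V (F f : R -> V) c a b : 0 <= a -> a <= b -> cont0 F ->
  (forall t, a <= t -> t < b -> rder F t (f t)) ->
  (forall t, a <= t -> t < b -> `|f t| <= c) ->
  `|F b - F a| <= c * (b - a).
Proof.
move=> a0 ab cF rF fc.
have -> : c * (b - a) = c * b - c * a by lra.
apply: (@mvi _ _ (fun t => c * t)) => //.
  move=> t t0 e e0; exists (e / (`|c| + 1)); first by rewrite divr_gt0// ltr_wpDl.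
  move=> s s0 h; rewrite -mulrBr normrM.
  have : `|s - t| * (`|c| + 1) <= e by rewrite -ler_pdivlMr ?ltW// ltr_wpDl.
  have := normr_ge0 c; have := normr_ge0 (s - t); nra.
move=> t at_ tb e e0; have [d d0 hd] := rF t at_ tb e e0.
exists d => // h h0 /(hd h h0) k.
have := lerD k (fc t at_ tb) => _.
have := ler_normD (F (t + h) - F t - h *: f t) (h *: f t).
rewrite subrK normrZ (gtr0_norm h0) => k2.
have : h * `|f t| <= h * c by rewrite ler_pM2l// fc.
lra.
Qed.

Lemma cont0D V (f g : R -> V) : cont0 f -> cont0 g -> cont0 (fun t => f t + g t).
Proof.
move=> cf cg t t0 e e0; have e2 : 0 < e / 2 by rewrite divr_gt0.
have [d1 d10 h1] := cf t t0 _ e2; have [d2 d20 h2] := cg t t0 _ e2.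
exists (Num.min d1 d2); first by rewrite lt_min d10.
move=> s s0; rewrite lt_min => /andP[/(h1 s s0) k1 /(h2 s s0) k2].
rewrite opprD addrACA; apply: (le_trans (ler_normD _ _)); lra.
Qed.

Lemma cont0_lip V V' (f : R -> V) (g : R -> V') c : cont0 f ->
  (forall s t, 0 <= s -> 0 <= t -> `|g s - g t| <= c * `|f s - f t|) -> cont0 g.
Proof.
move=> cf gf t t0 e e0.
have [d d0 hd] := cf t t0 (e / (`|c| + 1)) ltac:(by rewrite divr_gt0// ltr_wpDl).
exists d => // s s0 /(hd s s0); rewrite ler_pdivlMr ?ltr_wpDl// => k.
apply: (le_trans (gf _ _ s0 t0)).
have := ler_norm c; have := normr_ge0 c; have := normr_ge0 (f s - f t); nra.
Qed.

Lemma cont0Z V (f : R -> V) c : cont0 f -> cont0 (fun t => c *: f t).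
Proof.
by move=> cf; apply: (cont0_lip (c := `|c|) cf) => s t _ _; rewrite -scalerBr normrZ.
Qed.

Lemma cont0N V (f : R -> V) : cont0 f -> cont0 (fun t => - f t).
Proof.
by move=> cf; apply: (cont0_lip (c := 1) cf) => s t _ _; rewrite -opprD normrN mul1r.
Qed.

Lemma cont0B V (f g : R -> V) : cont0 f -> cont0 g -> cont0 (fun t => f t - g t).
Proof. by move=> cf cg; apply: cont0D => //; exact: cont0N. Qed.

Lemma cont0_cst V (x : V) : cont0 (fun=> x).
Proof. by move=> t _ e e0; exists 1 => // s _ _; rewrite subrr normr0 ltW. Qed.

Lemma cont0_norm V (f : R -> V) : cont0 f -> cont0 (fun t => `|f t|).
Proof.
by move=> cf; apply: (cont0_lip (c := 1) cf) => s t _ _; rewrite mul1r ler_dist_dist.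
Qed.

Lemma rderD V (f g : R -> V) t l1 l2 : rder f t l1 -> rder g t l2 ->
  rder (fun s => f s + g s) t (l1 + l2).
Proof.
move=> rf rg e e0; have e2 : 0 < e / 2 by rewrite divr_gt0.
have [d1 d10 h1] := rf _ e2; have [d2 d20 h2] := rg _ e2.
exists (Num.min d1 d2); first by rewrite lt_min d10.
move=> h h0; rewrite lt_min => /andP[/(h1 h h0) k1 /(h2 h h0) k2].
rewrite scalerDr !opprD (addrACA (f _)) (addrACA (f _ - _)).
by apply: (le_trans (ler_normD _ _)); lra.
Qed.

Section linear_prop.
Variables (V V' : lmodType R) (L : V -> V').
Hypothesis linL : linear L.

Lemma linpD x y : L (x + y) = L x + L y.
Proof. by have := linL 1 x y; rewrite !scale1r. Qed.

Lemma linp0 : L 0 = 0.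
Proof. by apply: (addIr (L 0)); rewrite -linpD !add0r. Qed.

Lemma linpZ a x : L (a *: x) = a *: L x.
Proof. by have := linL a x 0; rewrite !addr0 linp0 addr0. Qed.

Lemma linpN x : L (- x) = - L x.
Proof. by rewrite -scaleN1r linpZ scaleN1r. Qed.

Lemma linpB x y : L (x - y) = L x - L y.
Proof. by rewrite linpD linpN. Qed.

End linear_prop.

Lemma rder_lin V V' (L : V -> V') c (f : R -> V) t l :
  linear L -> (forall x, `|L x| <= c * `|x|) ->
  rder f t l -> rder (fun s => L (f s)) t (L l).
Proof.
move=> linL bL rf e e0.
have c0 : 0 < `|c| + 1 by rewrite ltr_wpDl.
have [d d0 hd] := rf (e / (`|c| + 1)) ltac:(by rewrite divr_gt0).
exists d => // h h0 /(hd h h0) k.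
rewrite -(linpZ linL) -!(linpB linL); apply: (le_trans (bL _)).
move: k; rewrite mulrAC ler_pdivlMr// => k.
have := ler_norm c; have := normr_ge0 (f (t + h) - f t - h *: l); nra.
Qed.

Lemma cont0_lin V V' (L : V -> V') c (f : R -> V) :
  linear L -> (forall x, `|L x| <= c * `|x|) ->
  cont0 f -> cont0 (fun s => L (f s)).
Proof.
move=> linL bL cf; apply: (cont0_lip (c := c) cf) => s t _ _.
by rewrite -(linpB linL).
Qed.

Lemma rderZ V (f : R -> V) t l c : rder f t l -> rder (fun s => c *: f s) t (c *: l).
Proof.
apply: (@rder_lin _ _ _ `|c|) => [a x y|x]; last by rewrite normrZ.
by rewrite scalerDr !scalerA mulrC.
Qed.

Lemma rderN V (f : R -> V) t l : rder f t l -> rder (fun s => - f s) t (- l).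
Proof.
apply: (@rder_lin _ _ _ 1) => [a x y|x]; last by rewrite normrN mul1r.
by rewrite opprD scalerN.
Qed.

Lemma rderB V (f g : R -> V) t l1 l2 : rder f t l1 -> rder g t l2 ->
  rder (fun s => f s - g s) t (l1 - l2).
Proof. by move=> rf rg; apply: rderD => //; exact: rderN. Qed.

Lemma rder_cst V (x : V) t : rder (fun=> x) t 0.
Proof.
move=> e e0; exists 1 => // h h0 _.
by rewrite subrr scaler0 subr0 normr0 mulr_ge0// ltW.
Qed.

Lemma rder_eq0 V (F : R -> V) a b : 0 <= a -> a <= b -> cont0 F ->
  (forall t, a <= t -> t < b -> rder F t 0) -> F b = F a.
Proof.
move=> a0 ab cF rF; apply/eqP; rewrite -subr_eq0 -normr_le0.
have := @mvi_rder _ F (fun=> 0) 0 a b a0 ab cF rF.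
by rewrite mul0r normr0; apply.
Qed.

End RealAnalysis.

Section Interface.
Context {R : realType}.
Implicit Types (V : normedModType R) (a b c d e h s t : R).

(** Even extension to the whole line, through which results on continuous functions of a real
    variable reach [cont0] functions. *)
Lemma cont0_continuous_abs V (f : R -> V) : cont0 f -> continuous (fun x : R => f `|x|).
Proof.
move=> cf x; apply/cvgrPdist_le => e e0.
have [d d0 hd] := cf `|x| (normr_ge0 x) e e0.
near=> y; rewrite distrC; apply: hd => //.
apply: le_lt_trans (ler_dist_dist _ _) _.
by rewrite distrC; near: y; apply: cvgr_dist_lt => //; exact: cvg_id.
Unshelve. all: by end_near. Qed.

Lemma continuous_cont0 V (f : R -> V) :
  {within `[0, +oo[, continuous f} -> cont0 f.
Proof.
move=> cf t t0 e e0.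
have /cvgrPdist_le /(_ e e0) := cf t.
rewrite /nbhs/= -nbhs_subspace_in; last by rewrite /= in_itv/= t0.
move=> /nbhs_ballP[d /= d0 hd]; exists d => // s s0 std.
rewrite distrC; apply: hd; last by rewrite /= in_itv/= s0.
by rewrite /ball/= distrC.
Qed.

Lemma cont0_within V (f : R -> V) :
  cont0 f -> {within `[0, +oo[, continuous f}.
Proof.
move=> cf; apply: (@subspace_eq_continuous _ _ _ (fun x : R => f `|x|) f).
  by move=> x; rewrite inE/= in_itv/= andbT => x0; rewrite ger0_norm.
by apply: continuous_subspaceT; exact: cont0_continuous_abs.
Qed.

Lemma is_deriveP (F : R -> R) (t l : R) : is_derive t 1 F l <->
  forall e : R, 0 < e -> exists2 d, 0 < d &
    forall h, `|h| < d -> `|F (t + h) - F t - h * l| <= e * `|h|.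
Proof.
split=> [[/cvg_ex[l' dl] Dl] e e0|H].
  have ll' : l' = l.
    by rewrite -Dl; apply/esym/cvg_lim.
  move/cvgrPdist_le : dl => /(_ e e0) /nbhs_ballP[d /= d0 hd].
  exists d => // h hd'.
  have [->|h0] := eqVneq h 0; first by rewrite addr0 subrr mul0r subr0 normr0 mulr0.
  have := hd h; rewrite /ball/= sub0r normrN => /(_ hd' h0).
  rewrite ll' -(ler_pM2r (x := `|h|)) ?normr_gt0// -normrM distrC mulrBl.
  rewrite /GRing.scale/= mulrAC mulVf// mul1r mulr1 (mulrC l).
  by rewrite (addrC h).
have dl : (fun h : R => h^-1 *: ((F \o shift t) (h *: 1) - F t)) @ 0^' --> l.
  apply/cvgrPdist_le => e e0; have [d d0 hd] := H e e0.
  suff aux (h : R) : `|h| < d -> h != 0 ->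
      `|l - h^-1 *: ((F \o shift t) (h *: 1) - F t)| <= e.
    by apply/nbhs_ballP; exists d => // h; rewrite /ball/= sub0r normrN; exact: aux.
  move=> hd' h0; rewrite distrC -(ler_pM2r (x := `|h|)) ?normr_gt0// -normrM mulrBl.
  rewrite /GRing.scale/= mulrAC mulVf// mul1r mulr1 (mulrC l).
  by rewrite (addrC h); exact: hd.
split; first by apply/cvg_ex; exists l.
by apply/cvg_lim.
Qed.

Lemma is_derive_rder (F : R -> R) (t l : R) : is_derive t 1 F l -> rder F t l.
Proof.
move=> /is_deriveP H e e0; have [d d0 hd] := H e e0.
by exists d => // h h0 hd'; have := hd h; rewrite gtr0_norm//; exact.
Qed.

Lemma scalar_primitive (f : R -> R) : cont0 f -> exists F : R -> R,
  [/\ F 0 = 0, cont0 F & forall t : R, 0 <= t -> rder F t (f t)].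
Proof.
move=> cf; pose g (x : R) := f `|x|.
have cg : continuous g by exact: cont0_continuous_abs.
(* Starting at [-1] makes every [t >= 0], including 0, an interior point for the fundamental
   theorem; [G 0] is subtracted at the end. *)
pose G (x : R) : R := \int[lebesgue_measure]_(t in `[-1, x]) g t.
have dG (t : R) : 0 <= t -> is_derive t 1 G (f t).
  move=> t0.
  have [] := @continuous_FTC1_closed R g (-1) t (t + 1) _ _ _ (cg t).
  - by rewrite ltrDl.
  - by apply: continuous_compact_integrable; [exact: segment_compact|exact: continuous_subspaceT].
  - by rewrite (lt_le_trans _ t0)// ltrN10.
  move=> d1 d2; split => //; rewrite -derive1E d2 /g ger0_norm//.
have cG : cont0 G.
  move=> t t0 e e0; have /is_deriveP /(_ 1 ltr01)[d d0 hd] := dG t t0.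
  exists (Num.min d (e / (`|f t| + 1))).
    by rewrite lt_min d0 divr_gt0// ltr_wpDl.
  move=> s s0; rewrite lt_min => /andP[/hd].
  rewrite mul1r (addrC t) subrK ltr_pdivlMr ?ltr_wpDl// => h1 h2.
  have := ler_normD (G s - G t - (s - t) * f t) ((s - t) * f t).
  rewrite subrK normrM; lra.
exists (fun t => G t - G 0); split; first by rewrite subrr.
  by apply: cont0B => //; exact: cont0_cst.
move=> t t0; rewrite -[f t]subr0; apply: rderB; last exact: rder_cst.
exact/is_derive_rder/dG.
Qed.

(** All that is used of vector-valued integration. *)
Definition has_primitives V := forall f : R -> V, cont0 f -> exists F : R -> V,
  [/\ F 0 = 0, cont0 F & forall t : R, 0 <= t -> rder F t (f t)].

(** Completeness through the norm alone, so that it passes to columns and products componentwise. *)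
Definition seq_complete V := forall u : nat -> V,
  (forall e : R, 0 < e -> exists N, forall i j, (N <= i)%N -> (N <= j)%N ->
     `|u i - u j| <= e) ->
  exists l, forall e : R, 0 < e -> exists N, forall i, (N <= i)%N -> `|u i - l| <= e.

Lemma complete_seq_complete (X : completeNormedModType R) : seq_complete X.
Proof.
move=> u cu.
have : cvgn u.
  apply/cauchy_cvgP/cauchy_ballP => e e0.
  have [N hN] := cu (e / 2) ltac:(by rewrite divr_gt0).
  exists (u @` [set i | (N <= i)%N], u @` [set i | (N <= i)%N]) => /=.
    by split; exists N => // i Ni; exists i.
  move=> [_ _] [/= [i Ni <-] [j Nj <-]]; rewrite -ball_normE/=.
  by apply: le_lt_trans (hN i j Ni Nj) _; rewrite ltr_pdivrMr// ltr_pMr// ltr1n.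
move=> /cvgrPdist_le H; exists (limn u) => e e0.
have [N _ hN] := H e e0; exists N => i Ni; rewrite distrC.
exact: (hN i Ni).
Qed.

End Interface.

Lemma inv_nat_small {R : realType} (e : R) : 0 < e ->
  exists N, forall i, (N <= i)%N -> (i.+1%:R^-1 : R) <= e.
Proof.
move=> e0; exists (Num.truncn e^-1) => i Ni.
rewrite -[leRHS]invrK lef_pV2 ?posrE ?invr_gt0//.
apply/ltW; apply: lt_le_trans (Num.Theory.truncnS_gt _) _.
by rewrite ler_nat ltnS.
Qed.

Lemma sqr_le_le {R : realType} (a b : R) : 0 <= b -> a ^+ 2 <= b ^+ 2 -> a <= b.
Proof.
move=> b0 ab; have [a0|a0] := leP 0 a; last exact: ltW (lt_le_trans a0 b0).
by rewrite -(ler_pXn2r (n := 2)) ?nnegrE.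
Qed.

Section InnerProduct.
Context {R : realType} (V : lmodType R) (d : V -> V -> R).
Hypothesis dC : forall x y, d x y = d y x.
Hypothesis dlin : forall a x y z, d (a *: x + y) z = a * d x z + d y z.
Hypothesis d_ge0 : forall x, 0 <= d x x.

Lemma ipDl x y z : d (x + y) z = d x z + d y z.
Proof. by have := dlin 1 x y z; rewrite scale1r mul1r. Qed.

Lemma ip0l z : d 0 z = 0.
Proof. by apply: (addIr (d 0 z)); rewrite -ipDl !add0r. Qed.

Lemma ipZl a x z : d (a *: x) z = a * d x z.
Proof. by have := dlin a x 0 z; rewrite !addr0 ip0l addr0. Qed.

Lemma ipNl x z : d (- x) z = - d x z.
Proof. by rewrite -scaleN1r ipZl mulN1r. Qed.

Lemma ipBl x y z : d (x - y) z = d x z - d y z.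
Proof. by rewrite ipDl ipNl. Qed.

Lemma ipDr x y z : d z (x + y) = d z x + d z y.
Proof. by rewrite !(dC z) ipDl. Qed.

Lemma ipZr a x z : d z (a *: x) = a * d z x.
Proof. by rewrite !(dC z) ipZl. Qed.

Lemma ipNr x z : d z (- x) = - d z x.
Proof. by rewrite !(dC z) ipNl. Qed.

Lemma ipBr x y z : d z (x - y) = d z x - d z y.
Proof. by rewrite !(dC z) ipBl. Qed.

Lemma ipDD x y : d (x + y) (x + y) = d x x + 2 * d x y + d y y.
Proof. by rewrite ipDl !ipDr (dC y x); ring. Qed.

(** For [c > 0] evaluate the polynomial at its minimum [- b / c]; for [c = 0] a nonnegative affine
    function is constant, so [b = 0]. *)
Lemma discriminant (b a c : R) :
  (forall t : R, 0 <= a + 2 * t * b + t ^+ 2 * c) -> 0 <= c -> b ^+ 2 <= a * c.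
Proof.
move=> H c0; have a0 : 0 <= a by have := H 0; rewrite expr2; lra.
have [c_eq0|cN0] := eqVneq c 0.
  have [->|b0] := eqVneq b 0; first by rewrite expr0n mulr_ge0.
  have := H (- (a + 1) / (2 * b)); rewrite c_eq0 mulr0 addr0.
  have -> : 2 * (- (a + 1) / (2 * b)) * b = - (a + 1) by field.
  lra.
have cp : 0 < c by rewrite lt_def cN0.
have := H (- b / c); rewrite -(pmulr_lge0 _ cp).
have -> : (a + 2 * (- b / c) * b + (- b / c) ^+ 2 * c) * c = a * c - b ^+ 2.
  by field.
by rewrite subr_ge0.
Qed.

Lemma cauchy_schwarz_sq x y : d x y ^+ 2 <= d x x * d y y.
Proof.
apply: discriminant => // t.
have := d_ge0 (x + t *: y); rewrite ipDD !ipZr ipZl.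
by congr (0 <= _); ring.
Qed.

Lemma cauchy_schwarz x y : `|d x y| <= Num.sqrt (d x x) * Num.sqrt (d y y).
Proof. by rewrite -sqrtrM// -sqrtr_sqr ler_sqrt ?mulr_ge0// cauchy_schwarz_sq. Qed.

Lemma ip_sqrtD x y :
  Num.sqrt (d (x + y) (x + y)) <= Num.sqrt (d x x) + Num.sqrt (d y y).
Proof.
have sx := sqrtr_ge0 (d x x); have sy := sqrtr_ge0 (d y y).
rewrite -(ler_pXn2r (n := 2)) ?nnegrE ?addr_ge0 ?sqrtr_ge0// sqrrD !sqr_sqrtr//.
rewrite ipDD; have := cauchy_schwarz x y; have := ler_norm (d x y).
rewrite -mulr_natl; nra.
Qed.

Lemma ip_sqrtZ a x : Num.sqrt (d (a *: x) (a *: x)) = `|a| * Num.sqrt (d x x).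
Proof. by rewrite ipZl ipZr mulrA -expr2 sqrtrM ?sqr_ge0// sqrtr_sqr. Qed.

End InnerProduct.

Section Riesz.
Context {R : realType} {X : completeNormedModType R} (dot : {dot X for idfun}).
Hypothesis hX : norm_of_dot dot.

Lemma dotC x y : dot x y = dot y x.
Proof. by have := hermC dot x y; rewrite expr0 mul1r. Qed.

Lemma dot_lin a x y z : dot (a *: x + y) z = a * dot x z + dot y z.
Proof. by rewrite linearDl linearZl_LR. Qed.

Lemma dot_ge0 x : 0 <= dot x x.
Proof. by rewrite -hX sqr_ge0. Qed.

Lemma dot_norm x : Num.sqrt (dot x x) = `|x|.
Proof. by rewrite -hX sqrtr_sqr normr_id. Qed.

Lemma dot_le x y : `|dot x y| <= `|x| * `|y|.
Proof.
by rewrite -!dot_norm; apply: cauchy_schwarz; [exact: dotC|exact: dot_lin|exact: dot_ge0].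
Qed.

(** The representing vector minimises [J x = |x|^2 - 2 L x]. Minimising sequences are Cauchy by the
    parallelogram identity, and near-minimality makes the Euler equation [dot x y = L y] hold up to
    a vanishing error. *)
Lemma riesz (L : X -> R) (c : R) :
  (forall a x y, L (a *: x + y) = a * L x + L y) ->
  (forall x, `|L x| <= c * `|x|) -> exists y, forall x, L x = dot y x.
Proof.
move=> linL bL.
have LD x y : L (x + y) = L x + L y by have := linL 1 x y; rewrite scale1r mul1r.
have L0 : L 0 = 0 by apply: (addIr (L 0)); rewrite -LD !add0r.
have LZ a x : L (a *: x) = a * L x by have := linL a x 0; rewrite !addr0 L0 addr0.
have c0' := normr_ge0 c.
pose J x := `|x| ^+ 2 - 2 * L x.
have Jlb x : - `|c| ^+ 2 <= J x.
  have h1 : L x <= `|c| * `|x|.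
    apply: le_trans (ler_norm _) _; apply: le_trans (bL x) _.
    by rewrite ler_wpM2r// ler_norm.
  by rewrite /J; have := sqr_ge0 (`|x| - `|c|); lra.
pose E := range J.
have infE : has_inf E by split; [exists (J 0), 0|exists (- `|c| ^+ 2) => _ [x _ <-]].
pose I := inf E.
have IJ x : I <= J x by apply: ge_inf; [case: infE|exists x].
have ex n : exists x, J x <= I + n.+1%:R^-1.
  have e0 : 0 < (n.+1%:R : R)^-1 by rewrite invr_gt0.
  by have [_ [x _ <-] /ltW] := inf_adherent e0 infE; exists x.
have [x xP] := choice ex.
(* [J (x n + t *: y)] stays above [J (x n) - 1 / (n + 1)] for all [t], so this quadratic polynomial
   in [t] has a nonpositive discriminant. *)
have var n y : (dot (x n) y - L y) ^+ 2 <= n.+1%:R^-1 * `|y| ^+ 2.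
  apply: discriminant => [t|]; last exact: sqr_ge0.
  have := IJ (x n + t *: y); have := xP n; rewrite /J LD LZ !hX.
  rewrite (ipDD dotC dot_lin) !(ipZr dotC dot_lin) !(ipZl dot_lin).
  by move: (_^-1) => w h1 h2; rewrite expr2; lra.
(* Compare [J] at the midpoint with its values at [x i] and [x j]. *)
have par i j : `|x i - x j| ^+ 2 <= 2 * i.+1%:R^-1 + 2 * j.+1%:R^-1.
  have := IJ (2^-1 *: (x i + x j)); have := xP i; have := xP j; rewrite /J LZ LD !hX.
  rewrite !(ipDD dotC dot_lin) !(ipZr dotC dot_lin) !(ipZl dot_lin).
  rewrite !(ipDD dotC dot_lin) !(ipNr dotC dot_lin) !(ipNl dot_lin).
  by move: (i.+1%:R^-1) (j.+1%:R^-1) => v w; lra.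
have [l lP] : exists l, forall e : R, 0 < e ->
    exists N, forall i, (N <= i)%N -> `|x i - l| <= e.
  apply: complete_seq_complete => e e0.
  have [N hN] := inv_nat_small (e := e ^+ 2 / 4) ltac:(by rewrite divr_gt0// exprn_gt0).
  exists N => i j Ni Nj; rewrite -(ler_pXn2r (n := 2)) ?nnegrE ?(ltW e0)//.
  by apply: le_trans (par i j) _; have := hN i Ni; have := hN j Nj;
    move: (i.+1%:R^-1) (j.+1%:R^-1) => v w; lra.
exists l => y; apply/esym/eqP; rewrite -subr_eq0 -normr_le0; apply/ler_addgt0Pr => e e0.
rewrite add0r; have y1 : 0 < `|y| + 1 by rewrite ltr_wpDl.
pose e' := e / (2 * (`|y| + 1)).
have e'0 : 0 < e' by rewrite divr_gt0// mulr_gt0.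
have ee : e = 2 * e' * (`|y| + 1) by rewrite /e'; field; rewrite gt_eqF.
have [N1 h1] := lP e' e'0; have [N2 h2] := inv_nat_small (e := e' ^+ 2) ltac:(by rewrite exprn_gt0).
pose n := maxn N1 N2; have k1 := h1 n (leq_maxl _ _); have k2 := h2 n (leq_maxr _ _).
have k3 : `|dot (x n) y - L y| <= e' * `|y|.
  apply: sqr_le_le; first by rewrite mulr_ge0// ltW.
  rewrite exprMn real_normK ?num_real//.
  by apply: le_trans (var n y) _; rewrite ler_wpM2r ?sqr_ge0.
have k4 : `|dot (x n - l) y| <= e' * `|y|.
  by apply: le_trans (dot_le _ _) _; rewrite ler_wpM2r.
have -> : dot l y - L y = (dot (x n) y - L y) - dot (x n - l) y.
  by rewrite (ipBl dot_lin); ring.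
by apply: (le_trans (ler_normB _ _)); rewrite ee; have := normr_ge0 y; nra.
Qed.

End Riesz.

(** * Primitives of continuous functions in Hilbert spaces, columns and products *)

Section Primitives.
Context {R : realType}.
Implicit Types (V : normedModType R) (a b c d e h s t : R).

Lemma cont0_bounded V (f : R -> V) b : cont0 f ->
  exists2 c, 0 <= c & forall t, 0 <= t -> t <= b -> `|f t| <= c.
Proof.
move=> cf; have [b0|b0] := leP 0 b; last by exists 0 => // t t0 tb; lra.
have := @EVT_max R (fun x : R => `|f `|x| |) 0 b b0.
case.
  apply: continuous_subspaceT => x; apply: cvg_norm.
  exact: cont0_continuous_abs.
move=> c _ H; exists `|f `|c| | => // t t0 tb.
by have := H t; rewrite in_itv/= t0 tb (ger0_norm t0); exact.
Qed.

Lemma rderZt V (x : V) t : rder (fun s => s *: x) t x.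
Proof.
move=> e e0; exists 1 => // h h0 _.
by rewrite scalerDl (addrC (t *: x)) addrK subrr normr0 mulr_ge0// ltW.
Qed.

Lemma cont0Zt V (x : V) : cont0 (fun s => s *: x).
Proof.
move=> t t0 e e0; exists (e / (`|x| + 1)); first by rewrite divr_gt0// ltr_wpDl.
move=> s s0; rewrite ltr_pdivlMr ?ltr_wpDl// -scalerBl normrZ.
by have := normr_ge0 x; have := normr_ge0 (s - t); nra.
Qed.

(** Integrate weakly: [G w] is a primitive of [dot (f s) w], and for fixed [t] the map [w |-> G w t]
    is linear, by uniqueness of primitives, and bounded, since [f] is bounded on segments; Riesz
    represents it by [F t]. *)
Lemma hilbert_primitives (X : completeNormedModType R) (dot : {dot X for idfun}) :
  norm_of_dot dot -> has_primitives X.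
Proof.
move=> hX f cf.
have dlin := dot_lin dot; have dC := dotC dot.
have ldot w : linear_for *%R (fun v => dot v w) by move=> a x y; exact: dlin.
have bdot w x : `|dot x w| <= `|w| * `|x| by rewrite mulrC dot_le.
have cfw w : cont0 (fun s => dot (f s) w) by exact: (cont0_lin (ldot w) (bdot w)).
have [G GP] := choice (fun w => scalar_primitive (cfw w)).
have G0 w : G w 0 = 0 by case: (GP w).
have cG w : cont0 (G w) by case: (GP w).
have rG w t : 0 <= t -> rder (G w) t (dot (f t) w) by case: (GP w) => _ _; apply.
have est w v a b e : 0 <= a -> a <= b ->
    (forall s, a <= s -> s < b -> `|f s - v| <= e) ->
    `|G w b - G w a - (b - a) * dot v w| <= e * `|w| * (b - a).
  move=> a0 ab H.
  have := @mvi_rder R R (fun s => G w s - s * dot v w)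
    (fun s => dot (f s) w - dot v w) (e * `|w|) a b a0 ab.
  have -> : G w b - b * dot v w - (G w a - a * dot v w) =
    G w b - G w a - (b - a) * dot v w by lra.
  apply; first by apply: cont0B => //; exact: cont0Zt.
    move=> t at_ _; apply: rderB; [apply: rG; lra|exact: rderZt].
  move=> t at_ tb; rewrite -(ipBl dlin) mulrC; apply: le_trans (bdot _ _) _.
  by rewrite ler_wpM2l// H.
have Fex t : exists y, 0 <= t -> forall w, G w t = dot y w.
  have [t0|] := leP 0 t; last by exists 0.
  have [c c0 fc] := cont0_bounded t cf.
  have [||y yP] := @riesz R X dot hX (fun w => G w t) (c * t).
  - move=> a x y; apply/eqP; rewrite -subr_eq0.
    have -> : 0 = G (a *: x + y) 0 - (a * G x 0 + G y 0).
      by rewrite !G0 mulr0 addr0 subrr.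
    apply/eqP; apply: (@rder_eq0 R R (fun s => G (a *: x + y) s - (a * G x s + G y s))) => //.
      by apply: cont0B => //; apply: cont0D => //; exact: cont0Z.
    move=> s s0 st.
    have -> : 0 = dot (f s) (a *: x + y) - (a * dot (f s) x + dot (f s) y).
      by rewrite (ipDr dC dlin) (ipZr dC dlin) subrr.
    by apply: rderB; [exact: rG|apply: rderD; [apply: rderZ; exact: rG|exact: rG]].
  - move=> w; have := est w 0 0 t c (lexx _) t0.
    rewrite (ip0l dlin) G0 mulr0 !subr0 mulrAC; apply.
    by move=> s s0 st; rewrite subr0; apply: fc => //; lra.
  by exists y.
have [F FP] := choice Fex.
have est2 v a b e : 0 <= a -> a <= b ->
    (forall s, a <= s -> s < b -> `|f s - v| <= e) ->
    `|F b - F a - (b - a) *: v| <= e * (b - a).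
  (* The scalar estimate is tested against the error vector [w] itself; dividing by [|w|] leaves a
     norm estimate. *)
  move=> a0 ab H; set w := (X in `|X|).
  have b0 : 0 <= b by lra.
  have [w0|wN0] := eqVneq w 0.
    rewrite w0 normr0; have [<-|ab'] := eqVneq a b; first by rewrite subrr mulr0.
    rewrite mulr_ge0//; last lra.
    by apply: le_trans (normr_ge0 _) (H a _ _) => //; rewrite lt_def eq_sym ab'.
  have wp : 0 < `|w| by rewrite normr_gt0.
  rewrite -(ler_pM2r wp) -expr2 hX {1}/w !(ipBl dlin) (ipZl dlin) -!FP//.
  apply: le_trans (ler_norm _) _; rewrite mulrAC; exact: est.
exists F; split.
- by apply/eqP; rewrite -normr_eq0 -sqrf_eq0 hX -FP// G0.
- move=> t t0 e e0; have [c c0 fc] := cont0_bounded (t + 1) cf.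
  have c1 : 0 < c + 1 by lra.
  exists (Num.min 1 (e / (c + 1))); first by rewrite lt_min ltr01 divr_gt0.
  move=> s s0; rewrite lt_min ltr_pdivlMr// => /andP[s1 s2].
  have lip a b : 0 <= a -> a <= b -> b <= t + 1 -> `|F b - F a| <= c * (b - a).
    move=> a0 ab bt; have := est2 0 a b c a0 ab; rewrite scaler0 subr0; apply.
    by move=> r ra rb; rewrite subr0; apply: fc; lra.
  have [st|ts] := leP s t.
    have lst := lip s t s0 st ltac:(lra).
    have ts0 : 0 <= t - s by lra.
    by rewrite distrC (ger0_norm ts0) in s2; rewrite distrC; lra.
  have ts0 : 0 <= s - t by lra.
  rewrite (ger0_norm ts0) in s1 s2.
  by have := lip t s t0 (ltW ts) ltac:(lra); lra.
- move=> t t0 e e0; have [d d0 hd] := cf t t0 e e0.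
  exists d => // h h0 hd'; have := est2 (f t) t (t + h) e t0.
  have -> : t + h - t = h by lra.
  apply; first lra.
  by move=> s ts sth; apply: hd; [lra|rewrite ger0_norm; lra].
Qed.

Lemma mxnorm_le (m : nat) (x : 'cV[R]_m) e : 0 <= e ->
  (forall i, `|x i 0| <= e) -> `|x| <= e.
Proof.
move=> e0 H; rewrite [leLHS]/Num.norm/= mx_normrE.
by apply/bigmax_leP; split => // -[i j] _ /=; rewrite (ord1 j).
Qed.

Lemma le_mxnorm (m : nat) (x : 'cV[R]_m) i : `|x i 0| <= `|x|.
Proof.
rewrite [leRHS]/Num.norm/= mx_normrE.
by apply/bigmax_geP; right => /=; exists (i, 0).
Qed.

Lemma fin_common (m : nat) (P : 'I_m -> R -> Prop) :
  (forall i d d', d' <= d -> P i d -> P i d') ->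
  (forall i, exists2 d : R, 0 < d & P i d) -> exists2 d : R, 0 < d & forall i, P i d.
Proof.
move=> Pmon Pex.
have H i : exists d : R, 0 < d /\ P i d by have [d d0 Pd] := Pex i; exists d.
have [D DP] := choice H.
(* The neutral element 1 keeps this radius positive when [m = 0]. *)
exists (\big[Num.min/1]_i D i).
  by apply/bigmin_gtP; split => // i _; case: (DP i).
move=> i; apply: (Pmon i (D i)); last by case: (DP i).
exact: bigmin_le_cond.
Qed.

Lemma cont0_mx (m : nat) (f : R -> 'cV[R]_m) :
  cont0 f <-> forall i, cont0 (fun t => f t i 0).
Proof.
split=> [cf i|cf].
  apply: (cont0_lip (c := 1) cf) => s t _ _; rewrite mul1r.
  by have := le_mxnorm (f s - f t) i; rewrite !mxE.
move=> t t0 e e0.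
have [||d d0 hd] := @fin_common m (fun i d => forall s, 0 <= s -> `|s - t| < d ->
  `|f s i 0 - f t i 0| <= e).
- by move=> i d d' dd' H s s0 sd; apply: H => //; exact: lt_le_trans sd dd'.
- by move=> i; exact: cf.
exists d => // s s0 sd; apply: mxnorm_le; first exact: ltW.
by move=> i; rewrite !mxE; exact: hd.
Qed.

Lemma rder_mx (m : nat) (f : R -> 'cV[R]_m) t (l : 'cV[R]_m) :
  rder f t l <-> forall i, rder (fun t => f t i 0) t (l i 0).
Proof.
split=> [rf i e e0|rf].
  have [d d0 hd] := rf e e0; exists d => // h h0 /(hd h h0).
  by apply: le_trans; have := le_mxnorm (f (t + h) - f t - h *: l) i; rewrite !mxE.
move=> e e0.
have [||d d0 hd] := @fin_common m (fun i d => forall h, 0 < h -> h < d ->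
  `|f (t + h) i 0 - f t i 0 - h * l i 0| <= e * h).
- by move=> i d d' dd' H s s0 sd; apply: H => //; exact: lt_le_trans sd dd'.
- by move=> i; exact: rf.
exists d => // h h0 hd'; apply: mxnorm_le; first by rewrite mulr_ge0 ?ltW.
by move=> i; rewrite !mxE; exact: hd.
Qed.

Lemma mx_primitives (m : nat) : has_primitives 'cV[R]_m.
Proof.
move=> f /cont0_mx cf.
have [F FP] := choice (fun i => scalar_primitive (cf i)).
exists (fun t => \col_i F i t); split.
- by apply/matrixP => i j; rewrite !mxE; case: (FP i).
- by apply/cont0_mx => i; under eq_fun do rewrite mxE; case: (FP i).
- move=> t t0; apply/rder_mx => i; under eq_fun do rewrite mxE.
  by case: (FP i) => _ _; apply.
Qed.

Lemma mx_seq_complete (m : nat) : seq_complete 'cV[R]_m.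
Proof.
move=> u cu.
have cv i : exists l : R, forall e : R, 0 < e -> exists N, forall k, (N <= k)%N -> `|u k i 0 - l| <= e.
  apply: (@complete_seq_complete R R (fun k => u k i 0)) => e e0.
  have [N hN] := cu e e0; exists N => k l Nk Nl; apply: le_trans (hN k l Nk Nl).
  by have := le_mxnorm (u k - u l) i; rewrite !mxE.
have [l lP] := choice cv; exists (\col_i l i) => e e0.
have [N NP] := choice (fun i => lP i e e0).
exists (\max_i N i)%N => k Nk; apply: mxnorm_le; first exact: ltW.
move=> i; rewrite !mxE; apply: NP; apply: leq_trans Nk; exact: (leq_bigmax i).
Qed.

Section product.
Variables U V : normedModType R.

Lemma prod_norm_le (x : U * V) e : (`|x| <= e) = (`|x.1| <= e) && (`|x.2| <= e).
Proof. by rewrite prod_normE ge_max. Qed.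

Lemma cont0_pair (f : R -> U * V) :
  cont0 (fun t => (f t).1) -> cont0 (fun t => (f t).2) -> cont0 f.
Proof.
move=> c1 c2 t t0 e e0.
have [d1 d10 h1] := c1 t t0 e e0; have [d2 d20 h2] := c2 t t0 e e0.
exists (Num.min d1 d2); first by rewrite lt_min d10.
move=> s s0; rewrite lt_min => /andP[/(h1 s s0) k1 /(h2 s s0) k2].
by rewrite prod_norm_le k1.
Qed.

Lemma rder_pair (f : R -> U * V) t l1 l2 :
  rder (fun t => (f t).1) t l1 -> rder (fun t => (f t).2) t l2 -> rder f t (l1, l2).
Proof.
move=> r1 r2 e e0; have [d1 d10 h1] := r1 e e0; have [d2 d20 h2] := r2 e e0.
exists (Num.min d1 d2); first by rewrite lt_min d10.
move=> h h0; rewrite lt_min => /andP[/(h1 h h0) k1 /(h2 h h0) k2].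
by rewrite prod_norm_le/= k1.
Qed.

Lemma cont0_fst (f : R -> U * V) : cont0 f -> cont0 (fun t => (f t).1).
Proof.
move=> cf; apply: (cont0_lip (c := 1) cf) => s t _ _; rewrite mul1r.
by have := lexx `|f s - f t|; rewrite {1}prod_norm_le => /andP[].
Qed.

Lemma cont0_snd (f : R -> U * V) : cont0 f -> cont0 (fun t => (f t).2).
Proof.
move=> cf; apply: (cont0_lip (c := 1) cf) => s t _ _; rewrite mul1r.
by have := lexx `|f s - f t|; rewrite {1}prod_norm_le => /andP[].
Qed.

Lemma prod_primitives : has_primitives U -> has_primitives V ->
  has_primitives (U * V)%type.
Proof.
move=> pU pV f cf.
have [F [F0 cF rF]] := pU _ (cont0_fst cf); have [G [G0 cG rG]] := pV _ (cont0_snd cf).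
exists (fun t => (F t, G t)); split; first by rewrite F0 G0.
  exact: cont0_pair.
move=> t t0; rewrite [f t]surjective_pairing.
by apply: rder_pair; [exact: rF|exact: rG].
Qed.

Lemma prod_seq_complete : seq_complete U -> seq_complete V ->
  seq_complete (U * V)%type.
Proof.
move=> pU pV u cu.
have [|l1 h1] := pU (fun k => (u k).1).
  move=> e e0; have [N hN] := cu e e0; exists N => i j Ni Nj.
  by have := hN i j Ni Nj; rewrite prod_norm_le => /andP[].
have [|l2 h2] := pV (fun k => (u k).2).
  move=> e e0; have [N hN] := cu e e0; exists N => i j Ni Nj.
  by have := hN i j Ni Nj; rewrite prod_norm_le => /andP[].
exists (l1, l2) => e e0; have [N1 k1] := h1 e e0; have [N2 k2] := h2 e e0.
exists (maxn N1 N2) => i; rewrite geq_max => /andP[/k1 q1 /k2 q2].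
by rewrite prod_norm_le q1.
Qed.

End product.
End Primitives.

Section Exponential.
Context {R : realType}.

Lemma continuous_within_cont0 {V : normedModType R} (f : R -> V) :
  continuous f -> cont0 f.
Proof. by move=> cf; apply/continuous_cont0/continuous_subspaceT. Qed.

Lemma is_derive_expZ (c r t : R) :
  is_derive t 1 (fun s : R => c * expR (r * s)) (c * r * expR (r * t)).
Proof.
have d1 : is_derive t 1 (r \*: (id : R -> R)) (r *: 1) by apply: is_deriveZ.
have d2 : is_derive t 1 (expR \o (r \*: (id : R -> R))) (expR (r * t) * (r *: 1)).
  exact: is_derive1_comp.
have -> : c * r * expR (r * t) = c *: (expR (r * t) * (r *: 1)).
  by rewrite /GRing.scale/=; ring.
exact: is_deriveZ.
Qed.

Lemma exp_cont0 (c r : R) : cont0 (fun s : R => c * expR (r * s)).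
Proof.
apply: continuous_within_cont0 => t; apply: differentiable_continuous.
apply/derivable1_diffP; exact: (@ex_derive _ _ _ _ _ _ _ (is_derive_expZ c r t)).
Qed.

Lemma exp_rder (c r t : R) : rder (fun s : R => c * expR (r * s)) t (c * r * expR (r * t)).
Proof. exact/is_derive_rder/is_derive_expZ. Qed.

End Exponential.

Lemma cont0_continuous_gt0 {R : realType} {V : normedModType R} (f : R -> V) (t : R) :
  cont0 f -> 0 < t -> {for t, continuous f}.
Proof.
move=> cf t0; apply/cvgrPdist_le => e e0; have [d d0 hd] := cf t (ltW t0) e e0.
near=> s; rewrite distrC; apply: hd.
  by apply: ltW; near: s; exact: lt_nbhsr.
by rewrite distrC; near: s; apply: cvgr_dist_lt => //; exact: cvg_id.
Unshelve. all: by end_near. Qed.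

(** A continuous right derivative is two-sided: for [h < 0] the mean value inequality applies on
    [[t + h, t]], where [f0] is close to [f0 t]. *)
Lemma rder_is_derive {R : realType} (F0 f0 : R -> R) (t : R) : cont0 F0 -> cont0 f0 ->
  (forall s : R, 0 <= s -> rder F0 s (f0 s)) -> 0 < t -> is_derive t 1 F0 (f0 t).
Proof.
move=> cF cf rF t0; apply/is_deriveP => e e0.
have [d d0 hd] := cf t (ltW t0) e e0.
have key a b : 0 <= a -> a <= b -> t - d < a -> b < t + d -> a <= t -> t <= b ->
    `|F0 b - F0 a - (b - a) * f0 t| <= e * (b - a).
  move=> a0 ab da db at_ tb.
  have := @mvi_rder R R (fun s => F0 s - s * f0 t) (fun s => f0 s - f0 t) e a b a0 ab.
  have -> : F0 b - b * f0 t - (F0 a - a * f0 t) = F0 b - F0 a - (b - a) * f0 t by ring.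
  apply.
  - by apply: cont0B => //; exact: cont0Zt.
  - by move=> s sa sb; apply: rderB; [apply: rF; lra|exact: rderZt].
  - move=> s sa sb; apply: hd; first lra.
    by rewrite ltr_norml; apply/andP; split; lra.
exists (Num.min d t); first by rewrite lt_min d0.
move=> h; rewrite lt_min !ltr_norml => /andP[/andP[h1 h2] /andP[h3 h4]].
have [h0|h0] := leP 0 h.
  rewrite (ger0_norm h0); have := key t (t + h) (ltW t0) ltac:(lra) ltac:(lra) ltac:(lra) (lexx _) ltac:(lra).
  by have -> : t + h - t = h by ring.
rewrite (ltr0_norm h0); have := key (t + h) t ltac:(lra) ltac:(lra) ltac:(lra) ltac:(lra) ltac:(lra) (lexx _).
have -> : t - (t + h) = - h by ring.
have -> : F0 t - F0 (t + h) - - h * f0 t = - (F0 (t + h) - F0 t - h * f0 t) by ring.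
by rewrite normrN.
Qed.

(** Turns the Lebesgue integrals of the admissibility and output conditions into increments of
    primitives, to which monotonicity arguments apply. *)
Lemma integral_primitive {R : realType} (F f : R -> R) (a b : R) : cont0 F -> cont0 f ->
  (forall t : R, 0 <= t -> rder F t (f t)) -> 0 <= a -> a <= b ->
  (\int[lebesgue_measure]_(t in `[a, b]) (f t)%:E = (F b - F a)%:E)%E.
Proof.
move=> cF cf rF a0; rewrite le_eqVlt => /orP[/eqP->|ab].
  by rewrite set_itv1 integral_set1 subrr.
have dF (t : R) (t0 : 0 < t) := rder_is_derive cF cf rF t0.
have sub : `[a, b] `<=` (`[0, +oo[ : set R).
  by move=> t /=; rewrite !in_itv/= andbT => /andP[at_ _]; exact: le_trans a0 at_.
rewrite (@continuous_FTC2 R f F a b ab) ?EFinB//.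
- exact: continuous_subspaceW sub (cont0_within cf).
- split.
  + move=> t; rewrite in_itv/= => /andP[at_ _].
    by have [] := dF t (le_lt_trans a0 at_).
  + apply/cvgrPdist_le => e e0; have [d d0 hd] := cF a a0 e e0.
    near=> s; rewrite distrC; apply: hd.
      by apply: le_trans a0 _; near: s; exact: nbhs_right_ge.
    have sa : a <= s by near: s; exact: nbhs_right_ge.
    by rewrite ger0_norm ?subr_ge0// ltrBlDl; near: s; apply: nbhs_right_lt; rewrite ltrDl.
  + apply: cvg_at_left_filter; exact: cont0_continuous_gt0 (le_lt_trans a0 ab).
- move=> t; rewrite in_itv/= => /andP[at_ _].
  have [_ <-] := dF t (le_lt_trans a0 at_); by rewrite derive1E.
Unshelve. all: by end_near. Qed.

Lemma primitive_mono {R : realType} (F f : R -> R) (a b : R) : cont0 F ->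
  (forall t : R, 0 <= t -> rder F t (f t)) -> (forall t, 0 <= f t) ->
  0 <= a -> a <= b -> F a <= F b.
Proof.
move=> cF rF f0 a0 ab; rewrite -lerN2.
apply: (@dini_noninc R (fun s => - F s)) => //; first exact: cont0N.
move=> s as_ _ e e0; have [d d0 hd] := rF s (le_trans a0 as_) e e0.
exists d => // h h0 /(hd h h0); rewrite ler_norml => /andP[+ _].
have := mulr_ge0 (ltW h0) (f0 s); rewrite /GRing.scale/=; lra.
Qed.

(** * Limits in L^1 and right derivatives *)

Section L1Limit.
Context {R : realType}.
Let mu := (@lebesgue_measure R).

Lemma continuous_integrable_itv (f : R -> R) (a b : R) : continuous f ->
  mu.-integrable `[a, b] (EFin \o f).
Proof.
move=> cf; apply: continuous_compact_integrable; first exact: segment_compact.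
exact: continuous_subspaceT.
Qed.

Lemma continuous_EFin_measurable (f : R -> R) (D : set R) : continuous f ->
  measurable_fun (D : set (measurableTypeR R)) (EFin \o f).
Proof.
move=> cf; apply/measurable_EFinP; apply: (@measurable_funS _ _ _ _ setT) => //.
exact: continuous_measurable_fun.
Qed.

(* Equal to the right derivative of [z] where it exists; a limit superior, so that
   it is always measurable in [t]. *)
Definition rderivative (z : R -> R) (t : R) : R :=
  fine (limn_esup (fun k => (k.+1%:R * (z (t + k.+1%:R^-1) - z t))%:E)).

Lemma rderivativeE (z : R -> R) (t l : R) : rder z t l -> rderivative z t = l.
Proof.
move=> rz; rewrite /rderivative.
have H : (fun k => (k.+1%:R * (z (t + k.+1%:R^-1) - z t))%:E) @ \oo --> l%:E.
  apply: cvg_EFin; first exact: nearW.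
  apply/cvgrPdist_le => e e0; have [d d0 hd] := rz e e0.
  have d2 : 0 < d / 2 by rewrite divr_gt0.
  have [N hN] := inv_nat_small d2.
  exists N => // n /= /hN hn; have n0 : 0 < n.+1%:R^-1 :> R by rewrite invr_gt0.
  have nd : n.+1%:R^-1 < d.
    by apply: le_lt_trans hn _; rewrite ltr_pdivrMr// ltr_pMr// ltr1n.
  have := hd _ n0 nd.
  rewrite -ler_pdivrMr// invrK distrC; apply: le_trans.
  set a := z _ - _; have -> : l - n.+1%:R * a = (n.+1%:R^-1 *: l - a) * n.+1%:R.
    by rewrite mulrBl /GRing.scale/= [X in _ = X - _]mulrAC mulVf// mul1r [X in _ = _ - X]mulrC.
  by rewrite normrM [X in _ * X]gtr0_norm.
by rewrite (cvg_limn_einf_sup H).2.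
Qed.

Lemma rderivative_measurable (z : R -> R) (D : set R) : continuous z ->
  measurable_fun (D : set (measurableTypeR R)) (rderivative z).
Proof.
move=> cz; apply: (@measurable_funS _ _ _ _ setT) => //.
apply: measurableT_comp; first exact: fine_measurable.
apply: measurable_fun_limn_esup => k.
apply: continuous_EFin_measurable => t.
have ct : {for t, continuous (fun s : R => z (s + k.+1%:R^-1))}.
  apply: (@continuous_comp _ _ _ (fun s : R => s + k.+1%:R^-1) z); last exact: cz.
  by apply: cvgD; [exact: cvg_id|exact: cvg_cst].
by apply: cvgM; [exact: cvg_cst|apply: cvgB; [exact: ct|exact: cz]].
Qed.

(* Riesz-Fischer for a fast Cauchy sequence in [L^1(0, N)], the limit being the
   derivative of the limit [z] of the primitives. *)
Lemma L1_fast_limit (f : nat -> R -> R) (z : R -> R) (N c : R) : 0 < N ->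
  (forall n, continuous (f n)) -> continuous z ->
  (forall n, (\int[mu]_(t in `[0%R, N]) `|f n.+1 t - f n t|%:E <= (c * 2^-1 ^+ n)%:E)%E) ->
  (forall t : R, 0 <= t -> t <= N ->
     (fun n => \int[mu]_(s in `[0%R, t]) (f n s)) @ \oo --> z t - z 0) ->
  {ae mu, forall t, `[0, N]%classic t -> f ^~ t @ \oo --> rderivative z t} /\
  forall t : R, 0 <= t -> t <= N -> z t = z 0 + \int[mu]_(s in `[0, t]) rderivative z s.
Proof.
move=> N0 cf cz hf hz.
pose D := (`[0, N]%classic : set R).
have mD : measurable (D : set (measurableTypeR R)) by exact: measurable_itv.
pose d n t := `|f n.+1 t - f n t|.
have cd n : continuous (d n).
  by move=> t; apply: cvg_norm; apply: cvgB; exact: cf.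
(* [G] sums the increments: its integral is at most [2 * c], so it is finite almost everywhere, and
   [|f 0| + G] dominates the whole sequence. *)
pose G (t : R) : \bar R := (\sum_(0 <= n <oo) (d n t)%:E)%E.
have dge0 n t : (0 <= (d n t)%:E)%E by rewrite lee_fin normr_ge0.
have mG : measurable_fun (D : set (measurableTypeR R)) G.
  apply: ge0_emeasurable_sum => // n _; exact: continuous_EFin_measurable.
have c0 : 0 <= c.
  have := hf 0%N; rewrite expr0 mulr1 => h; rewrite -lee_fin; apply: le_trans h.
  by apply: integral_ge0 => t _; rewrite lee_fin.
have G0 t : (0 <= G t)%E by apply: nneseries_ge0.
have intG : (\int[mu]_(t in D) G t < +oo)%E.
  rewrite /G integral_nneseries//; last by move=> n; exact: continuous_EFin_measurable.
  apply: (@le_lt_trans _ _ (2 * c)%:E); last by rewrite ltry.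
  apply: lime_le; first by apply: is_cvg_nneseries => n _ _; apply: integral_ge0.
  apply: nearW => n; apply: (@le_trans _ _ (\sum_(0 <= j < n) (c * 2^-1 ^+ j)%:E)%E).
    by apply: lee_sum => j _; exact: hf.
  rewrite sumEFin lee_fin.
  have -> : \sum_(0 <= j < n) c * 2^-1 ^+ j = 2 * c * (1 - 2^-1 ^+ n).
    elim: n => [|n IHn]; first by rewrite big_geq// expr0 subrr mulr0.
    by rewrite big_nat_recr//= IHn exprS; field.
  by rewrite ler_piMr ?mulr_ge0// gerBl exprn_ge0// invr_ge0.
have iG : mu.-integrable D G.
  apply/integrableP; split => //.
  by under eq_integral => t _ do rewrite gee0_abs//.
have cvgf t : G t \is a fin_num -> cvgn (f ^~ t).
  move=> Gfin; pose s n := \sum_(0 <= j < n) d j t.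
  have cs : cvgn s.
    apply: nondecreasing_is_cvgn.
      apply/nondecreasing_seqP => n; rewrite /s big_nat_recr//= lerDl; exact: normr_ge0.
    exists (fine (G t)) => _ [n _ <-]; rewrite -lee_fin fineK// /s -sumEFin.
    exact: nneseries_lim_ge.
  have cs' : cvgn (series (fun j => f j.+1 t - f j t)).
    by apply: normed_cvg.
  have -> : f ^~ t = (fun n => f 0%N t + series (fun j => f j.+1 t - f j t) n).
    apply: funext => n; rewrite /series/= telescope_sumr//.
    by rewrite addrC subrK.
  by apply: is_cvgD => //; exact: is_cvg_cst.
(* A limit superior is measurable without any convergence; it is the limit wherever [G] is
   finite. *)
pose l t := fine (limn_esup (fun n => (f n t)%:E)).
have lP t : G t \is a fin_num -> f ^~ t @ \oo --> l t.
  move=> /cvgf /cvg_ex[a fa]; suff -> : l t = a by [].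
  have H : (fun n => (f n t)%:E) @ \oo --> a%:E by apply: cvg_EFin => //; exact: nearW.
  by rewrite /l (cvg_limn_einf_sup H).2.
have ml : measurable_fun (setT : set (measurableTypeR R)) l.
  apply: measurableT_comp; first exact: fine_measurable.
  by apply: measurable_fun_limn_esup => n; exact: continuous_EFin_measurable.
have aeG : {ae mu, forall t, D t -> G t \is a fin_num} by exact: integrable_ae.
have fbd n t : (`|(f n t)%:E| <= (`|f 0%N t|)%:E + G t)%E.
  apply: (@le_trans _ _ (`|f 0%N t| + \sum_(0 <= j < n) d j t)%:E).
    rewrite abse_EFin lee_fin.
    have -> : f n t = f 0%N t + \sum_(0 <= j < n) (f j.+1 t - f j t).
      by rewrite telescope_sumr// addrC subrK.
    apply: le_trans (ler_normD _ _) _; rewrite lerD2l; exact: ler_norm_sum.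
  by rewrite EFinD leeD2l// -sumEFin; exact: nneseries_lim_ge.
have dom (t : R) : 0 <= t -> t <= N -> mu.-integrable `[0, t] (EFin \o l) /\
    (fun n => \int[mu]_(s in `[0%R, t]) (f n s)) @ \oo --> \int[mu]_(s in `[0%R, t]) (l s).
  move=> t0 tN; have sub : (`[0, t]%classic : set R) `<=` D.
    by move=> s; rewrite /D /= !in_itv/= => /andP[-> st]; exact: le_trans st tN.
  have [||||||il _ cvl] := @dominated_convergence _ _ _ mu `[0, t] _
    (fun n => EFin \o f n) (EFin \o l) (fun s => (`|f 0%N s|)%:E + G s)%E.
  - by [].
  - by move=> n; exact: continuous_EFin_measurable.
  - by apply/measurable_EFinP; apply: (@measurable_funS _ _ _ _ setT).
  - apply: negligibleS aeG => s /=; apply: contra_not => H st.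
    by apply: cvg_EFin; [exact: nearW|apply: lP; apply: H; exact: sub].
  - have iGt := integrableS mD (measurable_itv _ : measurable (`[0, t]%classic : set (measurableTypeR R))) sub iG.
    apply: (@integrableD _ _ _ mu _ _ (fun s => (`|f 0%N s|)%:E) G) => //.
    by apply: continuous_integrable_itv => s; apply: cvg_norm; exact: cf.
  - by apply: aeW => s n _; exact: fbd.
  split => //; rewrite /Rintegral.
  have fn : (\int[mu]_(s in `[0%R, t]) (l s)%:E)%E \is a fin_num by exact: integrable_fin_num.
  by apply: fine_cvg; rewrite fineK.
have zl (t : R) : 0 <= t -> t <= N -> z t = z 0 + \int[mu]_(s in `[0, t]) l s.
  move=> t0 tN; have [_ h1] := dom t t0 tN.
  have := cvg_unique (@Rhausdorff R) (hz t t0 tN) h1 => <-.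
  by rewrite addrC subrK.
have il : mu.-integrable D (EFin \o l) by case: (dom N (ltW N0) (lexx N)).
(* At a Lebesgue point of [l], extended by 0 outside [D], the integral of [l], hence [z], is
   differentiable with derivative [l t]. *)
have yl (t : R) : 0 < t -> t < N -> lebesgue_pt (l \_ D) t -> rderivative z t = l t.
  move=> t0 tN lt_; apply/rderivativeE/is_derive_rder.
  have iD : mu.-integrable `[0, N] (EFin \o (l \_ D)).
    apply: eq_integrable il => // s sD /=; by rewrite patchE sD.
  have [|dF F'] := @FTC1_lebesgue_pt R (l \_ D) (BLeft 0) t N tN iD _ lt_.
    by rewrite /= lte_fin.
  have tD : t \in D by rewrite inE /D /= in_itv/= !ltW.
  have lDt : (l \_ D) t = l t by rewrite patchE tD.
  have ID : is_derive t 1 (fun y => \int[mu]_(s in `[0, y]) (l \_ D) s) (l t).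
    by split => //; rewrite -derive1E F' lDt.
  apply/is_deriveP => e e0; have /is_deriveP /(_ e e0)[r r0 hr] := ID.
  have zE (y : R) : 0 <= y -> y <= N -> z y = z 0 + \int[mu]_(s in `[0, y]) (l \_ D) s.
    move=> y0 yN; rewrite zl//; congr (_ + _); apply: eq_Rintegral => s.
    rewrite inE/= in_itv/= => /andP[s0 sy]; rewrite patchE mem_set//.
    by rewrite /D /= in_itv/= s0/=; exact: le_trans sy yN.
  exists (Num.min r (Num.min t (N - t))); first by rewrite !lt_min r0 t0 subr_gt0.
  move=> h; rewrite !lt_min => /andP[hr' /andP[]]; rewrite !ltr_norml => /andP[h1 h2] /andP[h3 h4].
  have a1 : 0 <= t + h by rewrite -lerBlDl sub0r ltW.
  have a2 : t + h <= N by rewrite -lerBrDl ltW.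
  rewrite (zE _ a1 a2) (zE _ (ltW t0) (ltW tN)).
  by rewrite opprD addrACA subrr add0r; exact: hr.
have aeL : {ae mu, forall t, lebesgue_pt (l \_ D) t}.
  by apply: lebesgue_differentiation; exact: integrable_locally.
have ae1 : {ae mu, forall t, `]0, N[%classic t -> rderivative z t = l t}.
  apply: negligibleS aeL => t /=; apply: contra_not => H.
  by rewrite in_itv/= => /andP[t0 tN]; exact: yl.
have aeend : {ae mu, forall t, D t -> `]0, N[%classic t}.
  have ns (a : R) : mu.-negligible [set a].
    by exists [set a]; split; [exact: measurable_set1|exact: lebesgue_measure_set1|].
  apply: negligibleS (negligibleU (ns 0) (ns N)) => t /=.
  rewrite /D /= !in_itv/= => /not_implyP[/andP[t0 tN]].
  have [->|tn0] := eqVneq t 0; first by left.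
  have [->|tnN] := eqVneq t N; first by right.
  by rewrite !lt_def t0 tN tn0 eq_sym tnN.
have ae2 : {ae mu, forall t, D t -> rderivative z t = l t}.
  apply: negligibleS (negligibleU ae1 aeend) => t /=.
  apply: contra_notP => /not_orP[/contrapT h1 /contrapT h2] Dt.
  by apply: h1; exact: h2.
have my (E : set (measurableTypeR R)) : measurable_fun E (rderivative z).
  exact: rderivative_measurable.
split.
- apply: negligibleS (negligibleU ae2 aeG) => t /=.
  apply: contra_notP => /not_orP[/contrapT h1 /contrapT h2] Dt.
  rewrite (h1 Dt); exact/lP/h2.
- move=> t t0 tN; rewrite zl//; congr (_ + _); rewrite /Rintegral; congr fine.
  have sub : (`[0, t]%classic : set R) `<=` D.
    by move=> s; rewrite /D /= !in_itv/= => /andP[-> st]; exact: le_trans st tN.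
  apply: ae_eq_integral => //.
  + by apply/measurable_EFinP; exact: measurable_funS ml.
  + by apply/measurable_EFinP; exact: my.
  + by apply: negligibleS ae2 => s /=; apply: contra_not => H /sub Ds; rewrite (H Ds).
Qed.

(** Fatou's lemma for a limit that exists only almost everywhere: it is applied to the limit
    inferior [h], which equals [g] off a null set. *)
Lemma fatou_bound (f : nat -> R -> R) (g : R -> R) (D : set (measurableTypeR R)) (B : \bar R) :
  measurable D -> (forall n, continuous (f n)) -> (forall n t, 0 <= f n t) ->
  measurable_fun D g -> (forall t, 0 <= g t) ->
  {ae mu, forall t, D t -> f ^~ t @ \oo --> g t} ->
  (forall n, (\int[mu]_(t in D) (f n t)%:E <= B)%E) ->
  (\int[mu]_(t in D) (g t)%:E <= B)%E.
Proof.
move=> mD cf f0 mg g0 aef hB.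
pose h (t : measurableTypeR R) := limn_einf (fun n => (f n t)%:E).
have h0 t : (0 <= h t)%E.
  rewrite /h limn_einf_lim; apply: lime_ge; first exact: is_cvg_einfs.
  by apply: nearW => n; apply: le_ereal_inf_tmp => _ [k _ <-]; rewrite lee_fin.
have mh : measurable_fun D h.
  apply: measurableT_comp => //; apply: measurable_fun_limn_esup => n.
  by apply: measurableT_comp => //; exact: continuous_EFin_measurable.
apply: (@le_trans _ _ (\int[mu]_(t in D) h t)%E).
  apply: ae_ge0_le_integral => //.
  - by move=> t _; rewrite lee_fin.
  - exact/measurable_EFinP.
  - apply: negligibleS aef => t /=; apply: contra_not => H Dt.
    have ft : (fun n => (f n t)%:E) @ \oo --> (g t)%:E.
      by apply: cvg_EFin; [exact: nearW|exact: H].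
    by rewrite /h (cvg_limn_einf_sup ft).1.
apply: le_trans (fatou mu mD _ _) _.
- by move=> n; exact: continuous_EFin_measurable.
- by move=> n t _; rewrite lee_fin.
- rewrite limn_einf_lim; apply: lime_le; first exact: is_cvg_einfs.
  apply: nearW => n; apply: le_trans (hB n); apply: ereal_inf_lbound.
  by exists n => /=.
Qed.

End L1Limit.

(** * Bounded perturbations of semigroups *)

Section Uniform.
Context {R : realType}.
Implicit Types (a b c d e h s t : R).

(** Compactness of [[0, b]] as a supremum argument: the local radius at the supremum of the points
    up to which a uniform [d] exists pushes it to [b]. *)
Lemma uniform_on_segment (P : R -> R -> Prop) b :
  (forall s d d', d' <= d -> P s d -> P s d') ->
  (forall t, 0 <= t -> t <= b -> exists2 d, 0 < d &
    forall s, 0 <= s -> s <= b -> `|s - t| < d -> P s d) ->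
  exists2 d, 0 < d & forall s, 0 <= s -> s <= b -> P s d.
Proof.
move=> Pmon Ploc; have [b0|b0] := leP 0 b; last by exists 1 => // s s0 sb; lra.
pose E := [set x : R | 0 <= x <= b /\
  exists2 d : R, 0 < d & forall s, 0 <= s -> s <= x -> P s d].
have E0 : E 0.
  split; first by rewrite lexx.
  have [d d0 hd] := Ploc 0 (lexx _) b0; exists d => // s s0 sle.
  have -> : s = 0 by lra.
  by apply: hd; rewrite ?subrr ?normr0.
have supE : has_sup E by split; [exists 0|exists b => t [/andP[_ ?] _]].
pose x := sup E.
have x0 : 0 <= x by apply: ub_le_sup => //; case: supE.
have xb : x <= b by apply: ge_sup; [exists 0|move=> t [/andP[_ ?] _]].
have [d d0 hd] := Ploc x x0 xb.
have [y [/andP[y0 yb] [d' d'0 hd']] xy] := sup_adherent d0 supE.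
rewrite -/x in xy.
have all s : 0 <= s -> s <= b -> s < x + d -> P s (Num.min d d').
  move=> s0 sb sd; have [sy|ys] := leP s y.
    by apply: (Pmon _ d'); [rewrite ge_min lexx orbT|exact: hd'].
  apply: (Pmon _ d); first by rewrite ge_min lexx.
  by apply: hd => //; rewrite ltr_norml; apply/andP; split; lra.
have m0 : 0 < Num.min d d' by rewrite lt_min d0.
have [bx|xb'] := leP b x.
  by exists (Num.min d d') => // s s0 sb; apply: all => //; lra.
pose z := Num.min b (x + d / 2).
have : E z.
  split; first by rewrite ge_min lexx/= le_min b0; lra.
  exists (Num.min d d') => // s s0; rewrite le_min => /andP[sb sd].
  by apply: all => //; lra.
move=> /(ub_le_sup (proj2 supE)); rewrite -/x /z ge_min => /orP[]; lra.
Qed.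

Lemma geometric_small (x e : R) : 0 < e -> exists N, forall n, (N <= n)%N ->
  x * 2^-1 ^+ n <= e.
Proof.
move=> e0; have x1 : 0 < `|x| + 1 by rewrite ltr_wpDl.
have [N hN] := inv_nat_small (divr_gt0 e0 x1).
exists N => n /hN; rewrite ler_pdivlMr// => h.
apply: le_trans h; rewrite mulrC.
have h1 : (2^-1 : R) ^+ n <= n.+1%:R^-1.
  rewrite exprVn lef_pV2 ?posrE// -natrX ler_nat; exact: ltn_expl.
have h0 : 0 <= (2^-1 : R) ^+ n by rewrite exprn_ge0// invr_ge0.
apply: (@le_trans _ _ (2^-1 ^+ n * (`|x| + 1))); last by rewrite ler_wpM2r// ltW.
by rewrite ler_wpM2l//; have := ler_norm x; lra.
Qed.

End Uniform.

Section Semigroup.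
Context {R : realType} {V : normedModType R} (T : R -> V -> V) (k : R).
Implicit Types (a b c d e h s t : R) (g q w : R -> V).
Hypothesis k1 : 1 <= k.
Hypothesis Tlin : forall t, 0 <= t -> linear (T t).
Hypothesis T0 : forall x, T 0 x = x.
Hypothesis TD : forall s t x, 0 <= s -> 0 <= t -> T (s + t) x = T s (T t x).
Hypothesis Tbd : forall t x, 0 <= t -> `|T t x| <= k * `|x|.
Hypothesis Tc : forall x e, 0 < e -> exists2 d, 0 < d &
  forall h, 0 <= h -> h < d -> `|T h x - x| <= e.

Let k0 : 0 < k. Proof. exact: lt_le_trans ltr01 k1. Qed.

(** The uniform bound [k] handles the variation of [g]; the variation of time reduces to strong
    continuity at 0 on the single vector [g t]. *)
Lemma semigroup_jointly_cont (r : R -> R) g : (forall s, 0 <= r s) ->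
  cont0 r -> cont0 g -> cont0 (fun s => T (r s) (g s)).
Proof.
move=> r0 cr cg t t0 e e0.
have e2 : 0 < e / 2 / k by rewrite !divr_gt0.
have [d1 d10 h1] := cg t t0 _ e2; have [d2 d20 h2] := Tc (g t) e2.
have d22 : 0 < d2 / 2 by rewrite divr_gt0.
have [d3 d30 h3] := cr t t0 _ d22.
exists (Num.min d1 d3); first by rewrite lt_min d10.
move=> s s0; rewrite lt_min => /andP[/(h1 s s0) k1' /(h3 s s0) k3].
(* For [u <= v] factor out [T u], leaving the increment of the orbit of [g t] from time 0 to
   [v - u]. *)
have orb u v : 0 <= u -> 0 <= v -> `|u - v| <= d2 / 2 -> `|T u (g t) - T v (g t)| <= e / 2.
  wlog uv : u v / u <= v => [H|].
    have [uv|/ltW vu] := leP u v; first exact: H.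
    by move=> u0 v0 uv'; rewrite distrC; apply: H => //; rewrite distrC.
  move=> u0 v0; rewrite distrC ger0_norm ?subr_ge0// => uv'.
  have -> : v = u + (v - u) by lra.
  rewrite (TD _ u0) ?subr_ge0// -(linpB (Tlin u0)).
  apply: le_trans (Tbd _ u0) _; rewrite distrC.
  have := h2 (v - u) ltac:(lra) ltac:(lra).
  by rewrite ler_pdivlMr// mulrC.
have -> : T (r s) (g s) - T (r t) (g t) =
  T (r s) (g s - g t) + (T (r s) (g t) - T (r t) (g t)).
  by rewrite (linpB (Tlin (r0 s))) addrA subrK.
apply: le_trans (ler_normD _ _) _.
have := orb (r s) (r t) (r0 s) (r0 t) k3.
have := Tbd (g s - g t) (r0 s); move: k1'; rewrite ler_pdivlMr//; lra.
Qed.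

Lemma orbit_cont0 x : cont0 (fun t => T t x).
Proof.
move=> t t0 e e0.
have ab : cont0 (fun s : R => `|s|) by apply: cont0_norm => r r0 e' e'0; exists e' => // s _ /ltW.
have := semigroup_jointly_cont (fun s => normr_ge0 s) ab (cont0_cst x).
move=> /(_ t t0 e e0)[d d0 hd]; exists d => // s s0 /(hd s s0).
by rewrite !ger0_norm.
Qed.

(* The mild form of [q' = A q + g], where [A] is the generator of [T]. *)
Definition mild_der g q t := forall e, 0 < e -> exists2 d, 0 < d &
  forall h, 0 < h -> h < d -> `|q (t + h) - T h (q t) - h *: g t| <= e * h.

Lemma mild_der_lin c g1 q1 g2 q2 t : 0 <= t ->
  mild_der g1 q1 t -> mild_der g2 q2 t ->
  mild_der (fun s => c *: g1 s + g2 s) (fun s => c *: q1 s + q2 s) t.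
Proof.
move=> t0 m1 m2 e e0; have c1 : 0 < `|c| + 1 by rewrite ltr_wpDl.
have [d1 d10 h1] := m1 (e / (`|c| + 1) / 2) ltac:(by rewrite !divr_gt0).
have [d2 d20 h2] := m2 (e / 2) ltac:(by rewrite divr_gt0).
exists (Num.min d1 d2); first by rewrite lt_min d10.
move=> h h0; rewrite lt_min => /andP[/(h1 h h0) k1' /(h2 h h0) k2].
have -> : c *: q1 (t + h) + q2 (t + h) - T h (c *: q1 t + q2 t) - h *: (c *: g1 t + g2 t) =
  c *: (q1 (t + h) - T h (q1 t) - h *: g1 t) + (q2 (t + h) - T h (q2 t) - h *: g2 t).
  rewrite (Tlin (ltW h0)) !scalerDr !scalerN !opprD (scalerA c h) (mulrC c h) -scalerA.
  by rewrite (addrACA (c *: q1 (t + h))) (addrACA (c *: q1 (t + h) - _)).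
apply: le_trans (ler_normD _ _) _; rewrite normrZ.
set y := `|q1 _ - _ - _| in k1' *; have y0 : 0 <= y by exact: normr_ge0.
have : `|c| * y <= e / 2 * h.
  apply: (@le_trans _ _ ((`|c| + 1) * y)); first by rewrite ler_wpM2r// lerDl.
  apply: le_trans (ler_wpM2l (ltW c1) k1') _.
  have -> : (`|c| + 1) * (e / (`|c| + 1) / 2 * h) = e / 2 * h by field; rewrite gt_eqF.
  exact: lexx.
lra.
Qed.

Lemma mild_der_orbit x t : 0 <= t -> mild_der (fun=> 0) (fun s => T s x) t.
Proof.
move=> t0 e e0; exists 1 => // h h0 _.
rewrite (addrC t) (TD _ (ltW h0) t0) subrr scaler0 subr0 normr0.
by rewrite mulr_ge0 ?ltW.
Qed.

(* Variation of constants: [s |-> T (b - s) (q s)] has increments bounded by [k |g|]. *)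
Lemma mild_bound g q (gam G : R -> R) b : 0 <= b -> cont0 q -> cont0 G ->
  (forall t, 0 <= t -> t < b -> mild_der g q t) ->
  (forall t, 0 <= t -> t < b -> rder G t (gam t)) ->
  (forall t, 0 <= t -> t < b -> k * `|g t| <= gam t) ->
  `|q b - T b (q 0)| <= G b - G 0.
Proof.
move=> b0 cq cG mq rG gG.
(* The absolute value is inert on [[0, b]]; it keeps the time of [T] nonnegative beyond [b], since
   continuity is stated on the whole half-line. *)
pose F s := T `|b - s| (q s).
have -> : q b - T b (q 0) = F b - F 0.
  by rewrite /F subrr normr0 T0 subr0 ger0_norm.
apply: (mvi (lexx 0) b0) => //.
  apply: semigroup_jointly_cont => //.
  apply: cont0_norm; apply: cont0B; first exact: cont0_cst.
  by move=> r r0 e' e'0; exists e' => // s _ /ltW.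
move=> t t0 tb e e0.
have [d1 d10 h1] := mq t t0 tb (e / 2 / k) ltac:(by rewrite !divr_gt0).
have [d2 d20 h2] := rG t t0 tb (e / 2) ltac:(by rewrite divr_gt0).
exists (Num.min (Num.min d1 d2) (b - t)); first by rewrite !lt_min d10 d20/=; lra.
move=> h h0; rewrite !lt_min => /andP[/andP[/(h1 h h0) k1' /(h2 h h0) k2] hb].
have bth : 0 <= b - (t + h) by lra.
have -> : F (t + h) - F t = T (b - (t + h)) (q (t + h) - T h (q t)).
  rewrite /F (ger0_norm bth) ger0_norm; last lra.
  rewrite (linpB (Tlin bth)) -(TD _ bth (ltW h0)).
  by have -> : b - (t + h) + h = b - t by lra.
apply: le_trans (Tbd _ bth) _.
have := ler_normD (q (t + h) - T h (q t) - h *: g t) (h *: g t).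
rewrite subrK normrZ (gtr0_norm h0).
set y := `|_ - _ - _| in k1' *; set z := `|_ - T h _|.
move: k1'; rewrite mulrAC ler_pdivlMr// => k1' kz.
have := gG t t0 tb; move: k2; rewrite ler_norml => /andP[k2 _] k3.
have : h * (k * `|g t|) <= h * gam t by rewrite ler_wpM2l// ltW.
have : k * z <= k * (y + h * `|g t|) by rewrite ler_pM2l.
rewrite /GRing.scale/= in k2.
lra.
Qed.

Hypothesis primV : has_primitives V.

Lemma unif_strong_cont g b e : cont0 g -> 0 < e -> exists2 d, 0 < d &
  forall s h, 0 <= s -> s <= b -> 0 <= h -> h < d -> `|T h (g s) - g s| <= e.
Proof.
move=> cg e0.
have [||d d0 hd] := @uniform_on_segment R
  (fun s d => forall h, 0 <= h -> h < d -> `|T h (g s) - g s| <= e) b.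
- by move=> s d d' dd' H h h0 hd; apply: H => //; lra.
- move=> t t0 tb; pose e' := e / (k + 2).
  have e'0 : 0 < e' by rewrite divr_gt0// addr_gt0.
  have ee : e = e' * (k + 2) by rewrite /e' mulfVK// gt_eqF// addr_gt0.
  have [d1 d10 h1] := cg t t0 e' e'0; have [d2 d20 h2] := Tc (g t) e'0.
  exists (Num.min d1 d2); first by rewrite lt_min d10.
  move=> s s0 sb; rewrite lt_min => /andP[/(h1 s s0) k1' _] h h0.
  rewrite lt_min => /andP[_ /(h2 h h0) k2].
  have -> : T h (g s) - g s = T h (g s - g t) + (T h (g t) - g t) + (g t - g s).
    by rewrite (linpB (Tlin h0)) !addrA subrK subrK.
  apply: le_trans (ler_normD _ _) _; rewrite (distrC (g t)).
  have := ler_normD (T h (g s - g t)) (T h (g t) - g t).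
  have := Tbd (g s - g t) h0.
  have : k * `|g s - g t| <= k * e' by rewrite ler_pM2l.
  lra.
by exists d => // s h s0 sb; exact: hd.
Qed.

(** [q t] is the integral of [T (t - s) (g s)] over [[0, t]], obtained as the diagonal value [P t t]
    of a primitive [P t] whose integrand depends on [t]. *)
Lemma convolution_exists g : cont0 g -> exists q,
  [/\ q 0 = 0, cont0 q & forall t, 0 <= t -> mild_der g q t].
Proof.
move=> cg.
have cS t : cont0 (fun s => T `|t - s| (g s)).
  apply: semigroup_jointly_cont => //.
  apply: cont0_norm; apply: cont0B; first exact: cont0_cst.
  by move=> r r0 e' e'0; exists e' => // s _ /ltW.
have [P PP] := choice (fun t => primV (cS t)).
have P0 t : P t 0 = 0 by case: (PP t).
have cP t : cont0 (P t) by case: (PP t).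
have rP t s : 0 <= s -> rder (P t) s (T `|t - s| (g s)) by case: (PP t) => _ _; apply.
(* [T h] passes under the integral: both sides are primitives in [s] of [T (t + h - s) (g s)] that
   vanish at 0. *)
have key t h s : 0 <= s -> s <= t -> 0 <= h -> T h (P t s) = P (t + h) s.
  move=> s0 st h0; apply/eqP; rewrite -subr_eq0.
  have -> : 0 = T h (P t 0) - P (t + h) 0.
    by rewrite !P0 (linp0 (Tlin h0)) subrr.
  apply/eqP/(@rder_eq0 R V (fun s => T h (P t s) - P (t + h) s)) => //.
    by apply: cont0B => //; apply: (cont0_lin (Tlin h0) (fun x => Tbd x h0)).
  move=> r r0 rs.
  have -> : 0 = T h (T `|t - r| (g r)) - T `|t + h - r| (g r).
    rewrite -TD// !ger0_norm; [|lra|lra].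
    have -> : h + (t - r) = t + h - r by lra.
    by rewrite subrr.
  apply: rderB; last exact: rP.
  by apply: (rder_lin (Tlin h0) (fun x => Tbd x h0)); exact: rP.
(* The last piece of the integral, over [[t, t + h]], compared with a constant integrand [v]. *)
have step t h e v : 0 <= t -> 0 <= h ->
    (forall s, t <= s -> s < t + h -> `|T (t + h - s) (g s) - v| <= e) ->
    `|P (t + h) (t + h) - P (t + h) t - h *: v| <= e * h.
  move=> t0 h0 H; have th : t <= t + h by lra.
  have := @mvi_rder R V (fun s => P (t + h) s - s *: v)
    (fun s => T `|t + h - s| (g s) - v) e t (t + h) t0 th.
  have -> : P (t + h) (t + h) - (t + h) *: v - (P (t + h) t - t *: v) =
    P (t + h) (t + h) - P (t + h) t - h *: v.
    have -> : h *: v = (t + h) *: v - t *: v by rewrite scalerDl (addrC (t *: v)) addrK.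
    by rewrite !opprB addrACA [RHS]addrACA (addrC (- ((t + h) *: v))).
  have -> : t + h - t = h by lra.
  apply.
  - by apply: cont0B => //; exact: cont0Zt.
  - by move=> s ts _; apply: rderB; [apply: rP; lra|exact: rderZt].
  - by move=> s ts sth; rewrite ger0_norm; [exact: H|lra].
exists (fun t => P t t); split => //.
- move=> t t0 e e0; pose b := t + 1.
  have [c c0 gc] := cont0_bounded b cg.
  have b0 : 0 < b by rewrite /b; lra.
  have [d d0 hd] := unif_strong_cont b cg (e := e / 2 / (k * b)) ltac:(by rewrite !divr_gt0// mulr_gt0).
  (* The new piece of length [h] costs [k * c * h]; the change of kernel on [[0, s]] costs [e / 2],
     by strong continuity uniform along [g]. *)
  have lip s h : 0 <= s -> 0 <= h -> h < d -> s + h <= b ->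
      `|P (s + h) (s + h) - P s s| <= k * c * h + e / 2.
    move=> s0 h0 hd' shb.
    have -> : P (s + h) (s + h) - P s s =
      (P (s + h) (s + h) - P (s + h) s) + (P (s + h) s - P s s).
      by rewrite addrA subrK.
    apply: le_trans (ler_normD _ _) _; apply: lerD.
      have := @step s h (k * c) 0 s0 h0; rewrite scaler0 subr0; apply.
      move=> r sr rsh; rewrite subr0; apply: le_trans (Tbd _ _) _; first lra.
      by rewrite ler_pM2l//; apply: gc; lra.
    have -> : P (s + h) s - P s s = (P (s + h) s - P s s) - (P (s + h) 0 - P s 0).
      by rewrite !P0 subrr subr0.
    apply: (@le_trans _ _ (e / 2 / b * (s - 0))).
      apply: (@mvi_rder R V (fun r => P (s + h) r - P s r)
        (fun r => T `|s + h - r| (g r) - T `|s - r| (g r))) => //.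
      - exact: cont0B.
      - by move=> r r0 _; apply: rderB; exact: rP.
      - move=> r r0 rs; rewrite !ger0_norm; [|lra|lra].
        have -> : s + h - r = (s - r) + h by lra.
        have sr0 : 0 <= s - r by lra.
        rewrite TD// -(linpB (Tlin sr0)); apply: le_trans (Tbd _ sr0) _.
        have := hd r h r0 ltac:(lra) h0 hd'; rewrite invfM mulrA -mulrA mulrCA.
        by rewrite -ler_pdivlMl// mulrC.
    rewrite subr0 mulrAC ler_pdivrMr// ler_wpM2l//; [by rewrite divr_ge0// ltW|lra].
  pose d' := Num.min (Num.min d 1) (e / 2 / (k * c + 1)).
  have kc : 0 <= k * c by rewrite mulr_ge0// ltW.
  exists d'; first by rewrite !lt_min d0 ltr01 !divr_gt0// ltr_wpDl.
  move=> s s0; rewrite !lt_min => /andP[/andP[s1 s2]].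
  rewrite ltr_pdivlMr ?ltr_wpDl// => s3.
  have [st|ts] := leP s t.
    have st0 : 0 <= t - s by lra.
    rewrite distrC (ger0_norm st0) in s1 s2 s3.
    have := lip s (t - s) s0 st0 s1; have -> : s + (t - s) = t by lra.
    by rewrite distrC => /(_ ltac:(rewrite /b; lra)); lra.
  have st0 : 0 <= s - t by lra.
  rewrite (ger0_norm st0) in s1 s2 s3.
  have := lip t (s - t) t0 st0 s1; have -> : t + (s - t) = s by lra.
  by move=> /(_ ltac:(rewrite /b; lra)); lra.
- move=> t t0 e e0; pose e' := e / (k + 1).
  have e'0 : 0 < e' by rewrite divr_gt0// addr_gt0.
  have ee : e = e' * (k + 1) by rewrite /e' mulfVK// gt_eqF// addr_gt0.
  have [d1 d10 h1] := cg t t0 e' e'0; have [d2 d20 h2] := Tc (g t) e'0.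
  exists (Num.min d1 d2); first by rewrite lt_min d10.
  move=> h h0; rewrite lt_min => /andP[hd1 hd2].
  rewrite (key _ _ _ t0 (lexx t) (ltW h0)); apply: step => //; first exact: ltW.
  move=> s ts sth; have r0 : 0 <= t + h - s by lra.
  have -> : T (t + h - s) (g s) - g t =
    T (t + h - s) (g s - g t) + (T (t + h - s) (g t) - g t).
    by rewrite (linpB (Tlin r0)) addrA subrK.
  apply: le_trans (ler_normD _ _) _.
  have := h2 (t + h - s) r0 ltac:(lra).
  have := Tbd (g s - g t) r0.
  have : k * `|g s - g t| <= k * e'.
    by rewrite ler_pM2l//; apply: h1; [lra|rewrite ger0_norm; lra].
  lra.
Qed.

Hypothesis complV : seq_complete V.
Variables (K : V -> V) (kap : R).
Hypothesis kap0 : 0 < kap.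
Hypothesis Klin : linear K.
Hypothesis Kbd : forall x, `|K x| <= kap * `|x|.

(* Picard iteration in the weighted norm [sup |w t| exp (- 2 k kap t)], where the
   integral operator has norm at most 1/2. *)
Lemma perturbed_exists u0 : exists u,
  [/\ u 0 = u0, cont0 u & forall t, 0 <= t -> mild_der (fun s => K (u s)) u t].
Proof.
(* With this rate, [k * kap * (c * expR (lam * s))] is exactly the derivative of
   [c / 2 * expR (lam * s)], whence the contraction factor. *)
pose lam := 2 * (k * kap); have kk : 0 < k * kap by rewrite mulr_gt0.
have lam0 : 0 < lam by rewrite mulr_gt0.
have exp1 t : 0 <= t -> 1 <= expR (lam * t).
  by move=> t0; rewrite -expR0 ler_expR mulr_ge0// ltW.
have Qex g : exists q, cont0 g ->
    [/\ q 0 = 0, cont0 q & forall t, 0 <= t -> mild_der g q t].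
  have [cg|ncg] := pselect (cont0 g); last by exists 0.
  by have [q qP] := convolution_exists cg; exists q.
have [Q QP] := choice Qex.
(* The factor [1] gives the shape of [mild_der_lin]; [Q] is chosen on all functions but meaningful
   on continuous ones. *)
pose Phi w t := 1 *: Q (fun s => K (w s)) t + T t u0.
have cK w : cont0 w -> cont0 (fun s => K (w s)) by move=> cw; exact: (cont0_lin Klin Kbd).
have PhiP w : cont0 w -> [/\ Phi w 0 = u0, cont0 (Phi w) &
    forall t, 0 <= t -> mild_der (fun s => K (w s)) (Phi w) t].
  move=> /cK cw; have [q0 cq mq] := QP _ cw; split.
  - by rewrite /Phi q0 T0 scaler0 add0r.
  - by apply: cont0D; [exact: cont0Z|exact: orbit_cont0].
  - move=> t t0; have := mild_der_lin 1 t0 (mq t t0) (@mild_der_orbit u0 t t0).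
    by congr (mild_der _ _ _); apply: funext => s; rewrite scale1r addr0.
have contr w w' c : cont0 w -> cont0 w' ->
    (forall s, 0 <= s -> `|w s - w' s| <= c * expR (lam * s)) ->
    forall t, 0 <= t -> `|Phi w t - Phi w' t| <= c / 2 * expR (lam * t).
  move=> cw cw' H t t0; have [w0 cPw mw] := PhiP w cw; have [w0' cPw' mw'] := PhiP w' cw'.
  have c0 : 0 <= c.
    by have := le_trans (normr_ge0 _) (H 0 (lexx _)); rewrite mulr0 expR0 mulr1.
  have := @mild_bound (fun s => -1 *: K (w' s) + K (w s)) (fun s => -1 *: Phi w' s + Phi w s)
    (fun s => c / 2 * lam * expR (lam * s)) (fun s => c / 2 * expR (lam * s)) t t0.
  rewrite w0 w0' !scaleN1r addNr (linp0 (Tlin t0)) subr0 addrC => H'.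
  apply: le_trans (H' _ _ _ _ _) _.
  - by apply: cont0D => //; exact: cont0Z.
  - exact: exp_cont0.
  - by move=> s s0 _; apply: mild_der_lin => //; [exact: mw'|exact: mw].
  - by move=> s s0 _; exact: exp_rder.
  - move=> s s0 _; rewrite scaleN1r addrC -(linpB Klin).
    apply: le_trans (ler_wpM2l (ltW k0) (Kbd _)) _.
    have -> : c / 2 * lam * expR (lam * s) = k * kap * (c * expR (lam * s)).
      by rewrite /lam; field.
    by rewrite [leLHS]mulrA ler_pM2l//; exact: H.
  - by rewrite mulr0 expR0 mulr1 gerBl divr_ge0.
pose s n := iter n Phi (fun=> 0).
have cs n : cont0 (s n).
  by elim: n => [|n IHn]; [exact: cont0_cst|case: (PhiP _ IHn)].
have [C CE C0] : exists2 C, k * `|u0| <= C & 0 <= C.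
  by exists (k * `|u0|) => //; rewrite mulr_ge0// ltW.
have ds n t : 0 <= t -> `|s n.+1 t - s n t| <= C * 2^-1 ^+ n * expR (lam * t).
  elim: n t => [|n IHn] t t0.
    rewrite expr0 mulr1 subr0 /s/=.
    have [p0 cp mp] := PhiP (fun=> 0) (cont0_cst _).
    have := @mild_bound (fun=> K 0) (Phi (fun=> 0)) (fun=> 0) (fun=> 0) t t0.
    rewrite (linp0 Klin) subr0 p0 normr0 mulr0 => H.
    have {H} : `|Phi (fun=> 0) t - T t u0| <= 0.
      apply: H => //; first exact: cont0_cst.
        by move=> r r0 _; have := mp r r0; rewrite (linp0 Klin).
      by move=> r r0 _; exact: rder_cst.
    rewrite normr_le0 subr_eq0 => /eqP->; apply: le_trans (Tbd _ t0) _.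
    by apply: le_trans CE _; rewrite ler_peMr// exp1.
  have -> : C * 2^-1 ^+ n.+1 = C * 2^-1 ^+ n / 2 by rewrite exprSr mulrA.
  exact: (contr _ _ _ (cs n.+1) (cs n) IHn t t0).
have ds2 n m t : 0 <= t ->
    `|s (n + m)%N t - s n t| <= (2 * C * 2^-1 ^+ n) * (1 - 2^-1 ^+ m) * expR (lam * t).
  move=> t0; elim: m => [|m IHm].
    by rewrite addn0 subrr normr0 expr0 subrr mulr0 mul0r.
  rewrite addnS; apply: le_trans (ler_distD (s (n + m)%N t) _ _) _.
  apply: le_trans (lerD (ds (n + m)%N t t0) IHm) _.
  by rewrite exprD exprS le_eqVlt; apply/orP; left; apply/eqP; field.
have ds3 n m t : 0 <= t -> (n <= m)%N ->
    `|s m t - s n t| <= (2 * C * expR (lam * t)) * 2^-1 ^+ n.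
  move=> t0 nm; rewrite -(subnKC nm); apply: le_trans (ds2 _ _ _ t0) _.
  rewrite mulrAC [leRHS]mulrAC -[leRHS]mulr1 ler_wpM2l//.
    by rewrite !mulr_ge0 ?exprn_ge0 ?invr_ge0 ?expR_ge0//.
have uex t : exists l, 0 <= t -> forall e, 0 < e ->
    exists N, forall i, (N <= i)%N -> `|s i t - l| <= e.
  have [t0|] := leP 0 t; last by exists 0.
  have [|l lP] := complV (u := fun n => s n t); last by exists l.
  move=> e e0; have [N hN] := geometric_small (2 * C * expR (lam * t)) (divr_gt0 e0 (ltr0Sn _ 1)).
  exists N => i j Ni Nj; apply: le_trans (ler_distD (s N t) _ _) _.
  rewrite (distrC (s N t)).
  have := ds3 N i t t0 Ni; have := ds3 N j t t0 Nj; have := hN N (leqnn _); lra.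
have [u uP] := choice uex.
have us n t : 0 <= t -> `|u t - s n t| <= (2 * C * expR (lam * t)) * 2^-1 ^+ n.
  move=> t0; apply/ler_addgt0Pr => e e0; have [N hN] := uP t t0 e e0.
  apply: le_trans (ler_distD (s (maxn N n) t) _ _) _; rewrite addrC; apply: lerD.
    exact/ds3/leq_maxr.
  by rewrite distrC hN// leq_maxl.
have cu : cont0 u.
  move=> t t0 e e0; have e3 : 0 < e / 3 by rewrite divr_gt0.
  have [N hN] := geometric_small (2 * C * expR (lam * (t + 1))) e3.
  have [d d0 hd] := cs N t t0 _ e3.
  have near_s r : 0 <= r -> r <= t + 1 -> `|u r - s N r| <= e / 3.
    move=> r0 rt; apply: le_trans (us N r r0) _; apply: le_trans (hN N (leqnn _)).
    rewrite ler_wpM2r ?exprn_ge0 ?invr_ge0// ler_wpM2l ?mulr_ge0//.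
    by rewrite ler_expR ler_wpM2l// ltW.
  exists (Num.min d 1); first by rewrite lt_min d0 ltr01.
  move=> r r0; rewrite lt_min => /andP[/(hd r r0) h1]; rewrite ltr_norml => /andP[_ h2].
  have := near_s r r0 ltac:(lra); have := near_s t t0 ltac:(lra).
  have := ler_distD (s N r) (u r) (u t); have := ler_distD (s N t) (s N r) (u t).
  rewrite (distrC (s N t) (u t)); lra.
have [Pu0 cPu mPu] := PhiP u cu.
have fixu t : 0 <= t -> Phi u t = u t.
  move=> t0; apply/eqP; rewrite -subr_eq0 -normr_le0; apply/ler_addgt0Pr => e e0; rewrite add0r.
  have [N hN] := geometric_small (2 * C * expR (lam * t)) (divr_gt0 e0 (ltr0Sn _ 1)).
  have h1 : `|Phi u t - s N.+1 t| <= 2 * C * expR (lam * t) * 2^-1 ^+ N / 2.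
    have -> : 2 * C * expR (lam * t) * 2^-1 ^+ N / 2 =
      2 * C * 2^-1 ^+ N / 2 * expR (lam * t) by ring.
    apply: (contr u (s N)) => // r r0; apply: le_trans (us N r r0) _.
    by rewrite mulrAC.
  have := us N.+1 t t0; have := hN N (leqnn _); have := hN N.+1 (leqnSn _).
  have := ler_distD (s N.+1 t) (Phi u t) (u t); rewrite (distrC (s N.+1 t) (u t)).
  have : 0 <= 2 * C * expR (lam * t) * 2^-1 ^+ N.
    by rewrite !mulr_ge0 ?exprn_ge0 ?invr_ge0 ?expR_ge0//.
  lra.
exists u; split => //; first by rewrite -fixu.
move=> t t0 e e0; have [d d0 hd] := mPu t t0 e e0.
exists d => // h h0 hd'.
by have := hd h h0 hd'; rewrite !fixu// addr_ge0// ltW.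
Qed.

End Semigroup.

(** * Absolute continuity *)

Section AbsoluteContinuity.
Context {R : realType}.
Implicit Types (a b c d e h s t x y : R).
Let mu := (@lebesgue_measure R).

(** Continuous induction by a supremum. The local hypothesis carries [P] across [s], from a point on
    its left to one on its right, so no closedness of [P] under limits is involved. *)
Lemma creeping_induction (P : R -> Prop) a b : a <= b -> P a ->
  (forall s, a <= s -> s <= b -> exists2 d, 0 < d &
    forall x y, a <= x -> x <= s -> s <= y -> y <= b -> s - d < x -> y < s + d ->
      P x -> P y) -> P b.
Proof.
move=> ab Pa H.
pose E := [set x : R | a <= x <= b /\ P x].
have Ea : E a by split; rewrite ?lexx.
have supE : has_sup E by split; [exists a|exists b => t [/andP[_ ?] _]].
pose s := sup E.
have as_ : a <= s by apply: ub_le_sup => //; case: supE.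
have sb : s <= b by apply: ge_sup; [exists a|move=> t [/andP[_ ?] _]].
have [d d0 hd] := H s as_ sb.
have [x Ex xs] := sup_adherent d0 supE; rewrite -/s in xs.
have xs' : x <= s by apply: ub_le_sup => //; case: supE.
case: Ex => /andP[ax xb] Px.
pose y := Num.min b (s + d / 2).
have sy : s <= y by rewrite le_min sb; lra.
have Py : P y.
  apply: (hd x) => //; first by rewrite ge_min lexx.
  by rewrite gt_min; apply/orP; right; lra.
have [yb|] := eqVneq y b; first by rewrite -yb.
have : E y by split => //; rewrite ge_min lexx andbT; lra.
move=> /(ub_le_sup (proj2 supE)); rewrite -/s /y.
by case: (leP b (s + d / 2)); rewrite ?eqxx//; lra.
Qed.

(** Cover the null set [N] of bad times by an open [U] of measure less than the [dl] that absolute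
    continuity provides for [e]. On the way from [a] to [b], increments of [F] around times of [N]
    are collected, to be bounded together by [e]; elsewhere the derivative gives slope [c + e]. *)
Lemma ac_mean_value (F g : R -> R) a b c : 0 < a -> a <= b ->
  absolutely_continuous 0 b F ->
  {ae mu, forall t, 0 < t -> is_derive t 1 F (g t)} ->
  (forall t, a <= t -> t <= b -> `|g t| <= c) ->
  `|F b - F a| <= c * (b - a).
Proof.
move=> a0 ab acF [N [mN muN NN]] gc.
apply/ler_addgt0Pr => e' e'0.
pose e := e' / (b - a + 1).
have ba1 : 0 < b - a + 1 by lra.
have e0 : 0 < e by rewrite divr_gt0.
have ee : e' = e * (b - a + 1) by rewrite /e mulfVK// gt_eqF.
have [dl dl0 hdl] := acF e e0.
have [|U [oU NU muU]] := lebesgue_regularity_outer mN _ dl0; first by rewrite [ltLHS]muN.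
have mU : measurable (U : set (measurableTypeR R)) by exact: open_measurable.
have muUd : (mu U < dl%:E)%E.
  apply: le_lt_trans muU; rewrite -[leLHS](_ : (mu (U `\` N) + mu N = _)%E).
    by rewrite [X in (_ + X)%E]muN adde0.
  rewrite /mu -measureU//=; first by rewrite setUC setDUK.
    exact: measurableD.
  by apply/seteqP; split => // z [[]].
pose UI x := mu (U `&` `]a, x]).
have mUI x : measurable (U `&` `]a, x] : set (measurableTypeR R)) by exact: measurableI.
(* [u] and [v] list the collected intervals in order; their total length is at most the measure of
   [U] in []a, x]], hence below [dl]. *)
pose P x := exists n (u v : nat -> R),
  [/\ forall i, (i < n)%N -> [/\ a <= u i, u i <= v i & v i <= x],
      forall i, (i.+1 < n)%N -> v i <= u i.+1,
      ((\sum_(i < n) (v i - u i))%:E <= UI x)%E &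
      `|F x - F a| <= (c + e) * (x - a) + \sum_(i < n) `|F (v i) - F (u i)|].
suff [n [u [v [h1 h2 h3 h4]]]] : P b.
  have h5 : \sum_(i < n) `|F (v i) - F (u i)| < e.
    apply: hdl => [i /h1[? ? ?]||]; [split => //; lra|exact: h2|].
    rewrite -lte_fin; apply: le_lt_trans h3 _; apply: le_lt_trans muUd.
    by apply: le_measure; rewrite ?inE//; exact: subIsetl.
  by apply: le_trans h4 _; rewrite ee; lra.
apply: (creeping_induction ab).
  exists 0%N, (fun=> 0), (fun=> 0); split => //; first by rewrite big_ord0 measure_ge0.
  by rewrite big_ord0 !subrr normr0 mulr0 addr0.
move=> s as_ sb; have [Ns|nNs] := pselect (N s).
  have /nbhs_ballP[d /= d0 hd] : nbhs s U by move: oU; rewrite openE => /(_ s (NU s Ns)).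
  exists d => // x y ax xs sy yb sx yd [n [u [v [h1 h2 h3 h4]]]].
  have xy : x <= y by exact: le_trans xs sy.
  have xyU z : x < z -> z <= y -> U z.
    by move=> xz zy; apply: hd; rewrite /ball/= ltr_norml; apply/andP; split; lra.
  (* Around a time of [N] the interval []x, y]] lies in [U] and is appended to the list. *)
  exists n.+1, (fun i => if (i < n)%N then u i else x), (fun i => if (i < n)%N then v i else y).
  split.
  - move=> i; rewrite ltnS leq_eqVlt => /orP[/eqP->|lin]; first by rewrite ltnn.
    by rewrite lin; have [? ? ?] := h1 i lin; split => //; lra.
  - move=> i; rewrite ltnS => lin; rewrite lin.
    case: ifP => [|_]; first exact: h2.
    by case: (h1 i lin).
  - rewrite big_ord_recr/= ltnn.
    under eq_bigr => i _ do rewrite ltn_ord.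
    rewrite EFinD; apply: (@le_trans _ _ (UI x + mu `]x, y]%classic)%E).
      rewrite leeD//; rewrite /mu lebesgue_measure_itv/= lte_fin.
      by case: ltP => // yx; rewrite lee_fin; lra.
    rewrite /UI /mu -measureU//=.
      apply: le_measure; rewrite ?inE//; first exact: measurableU.
      move=> z [[Uz]|]; rewrite /= !in_itv/= => /andP[z1 z2].
        by split => //; rewrite z1/= (le_trans z2 xy).
      by split; [exact: xyU|rewrite z2 andbT (le_lt_trans ax z1)].
    apply/seteqP; split => // z [[_]]; rewrite /= !in_itv/= => /andP[_ zx] /andP[xz _].
    by have := lt_le_trans xz zx; rewrite ltxx.
  - rewrite big_ord_recr/= ltnn.
    under eq_bigr => i _ do rewrite ltn_ord.
    have := ler_distD (F x) (F y) (F a).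
    have : (c + e) * (x - a) <= (c + e) * (y - a).
      rewrite ler_wpM2l//; last lra.
      by have := le_trans (normr_ge0 _) (gc a (lexx _) ab); lra.
    lra.
(* Outside [N] the list is kept, and the increments from [x] to [s] and from [s] to [y] are both
   estimated at [s]. *)
have Fs : is_derive s 1 F (g s).
  by apply: contrapT => nF; apply: nNs; apply: NN => /=; apply/not_implyP; split => //; lra.
have /is_deriveP /(_ e e0)[d d0 hd] := Fs.
exists d => // x y ax xs sy yb sx yd [n [u [v [h1 h2 h3 h4]]]].
exists n, u, v; split => //.
- by move=> i /h1[? ? ?]; split => //; lra.
- apply: le_trans h3 _; rewrite /UI; apply: le_measure; rewrite ?inE//.
  apply: setIS => z; rewrite /= !in_itv/= => /andP[-> /= zx].
  exact: le_trans zx (le_trans xs sy).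
- have gs := gc s as_ sb.
  have q z : `|z - s| < d -> `|F z - F s| <= (c + e) * `|z - s|.
    move=> /hd; rewrite (addrC s) subrK => k1.
    have := ler_normD (F z - F s - (z - s) * g s) ((z - s) * g s).
    rewrite subrK normrM => k2.
    have : `|z - s| * `|g s| <= `|z - s| * c by rewrite ler_wpM2l.
    lra.
  have := q y; have := q x.
  rewrite (ger0_norm (_ : 0 <= y - s)); last lra.
  rewrite (distrC x s) (ger0_norm (_ : 0 <= s - x)); last lra.
  move=> /(_ ltac:(lra)) q1 /(_ ltac:(lra)) q2.
  have := ler_distD (F s) (F y) (F x); rewrite (distrC (F s) (F x)).
  have := ler_distD (F x) (F y) (F a).
  lra.
Qed.

Lemma lipschitz_ac (F : R -> R) b c : 0 <= c ->
  (forall s t, 0 <= s -> s <= t -> t <= b -> `|F t - F s| <= c * (t - s)) ->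
  absolutely_continuous 0 b F.
Proof.
move=> c0 H e e0; exists (e / (c + 1)); first by rewrite divr_gt0// ltr_wpDl.
move=> n u v h1 h2; rewrite ltr_pdivlMr ?ltr_wpDl//; apply: le_lt_trans.
rewrite mulr_suml; apply: ler_sum => i _; have [? ? ?] := h1 i (ltn_ord i).
by apply: le_trans (H _ _ _ _ _) _ => //; lra.
Qed.

End AbsoluteContinuity.

(** * Exponentially stable semigroups *)

Section StableGenerator.
Context {R : realType} {X : completeNormedModType R}.
Variables (S : R -> X -> X) (A : operator X X) (k nu : R).
Implicit Types (a b c d e h s t : R) (x y : X).
Hypothesis hS : C0_semigroup S.
Hypothesis hA : generator S A.
Hypothesis k1 : 1 <= k.
Hypothesis nu0 : 0 < nu.
Hypothesis hexp : forall x t, 0 <= t -> `|S t x| <= k * expR (- nu * t) * `|x|.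

Let k0 : 0 < k. Proof. exact: lt_le_trans ltr01 k1. Qed.

Lemma sg_lin t : 0 <= t -> linear (S t).
Proof. by case: hS => H _ _ _ /H[]. Qed.

Lemma sg0 x : S 0 x = x. Proof. by case: hS. Qed.

Lemma sgD s t x : 0 <= s -> 0 <= t -> S (s + t) x = S s (S t x).
Proof. by case: hS => _ _ H _; exact: H. Qed.

Lemma sg_bd t x : 0 <= t -> `|S t x| <= k * `|x|.
Proof.
move=> t0; apply: le_trans (hexp x t0) _; rewrite ler_wpM2r// ler_piMr ?(ltW k0)//.
by rewrite -expR0 ler_expR mulNr oppr_le0 mulr_ge0// ltW.
Qed.

Lemma sg_cont x e : 0 < e -> exists2 d, 0 < d &
  forall h, 0 <= h -> h < d -> `|S h x - x| <= e.
Proof.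
case: hS => _ _ _ /(_ x) /cvgrPdist_le H e0; have /nbhs_ballP[d /= d0 hd] := H e e0.
exists d => // h h0 hhd; have [->|hN0] := eqVneq h 0.
  by rewrite sg0 subrr normr0 ltW.
rewrite distrC; apply: hd; last by rewrite lt_def hN0.
by rewrite /ball/= sub0r normrN ger0_norm.
Qed.

Lemma generatorP x y : (dom A x /\ A x = y) <-> forall e, 0 < e -> exists2 d, 0 < d &
  forall h, 0 < h -> h < d -> `|S h x - x - h *: y| <= e * h.
Proof.
have eqn h : 0 < h -> `|S h x - x - h *: y| = `|y - h^-1 *: (S h x - x)| * h.
  move=> h0; rewrite -[X in _ * X](gtr0_norm h0) mulrC -normrZ distrC scalerBr.
  by rewrite scalerA mulfV ?gt_eqF// scale1r.
split=> [/hA /cvgrPdist_le H e e0|H]; last apply/hA/cvgrPdist_le => e e0.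
- have /nbhs_ballP[d /= d0 hd] := H e e0; exists d => // h h0 hhd.
  rewrite eqn// ler_pM2r//; apply: hd => //.
  by rewrite /ball/= sub0r normrN gtr0_norm.
- have [d d0 hd] := H e e0; apply/nbhs_ballP; exists d => // h /=.
  rewrite /ball/= sub0r normrN => hhd h0; rewrite -(ler_pM2r h0) -eqn//.
  by apply: hd => //; rewrite -(gtr0_norm h0).
Qed.

Lemma gen_lin a x y : dom A x -> dom A y ->
  dom A (a *: x + y) /\ A (a *: x + y) = a *: A x + A y.
Proof.
move=> dx dy; apply/generatorP => e e0.
have a1 : 0 < `|a| + 1 by rewrite ltr_wpDl.
have /generatorP /(_ (e / 2 / (`|a| + 1)) ltac:(by rewrite !divr_gt0))[d1 d10 h1] := conj dx (erefl (A x)).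
have /generatorP /(_ (e / 2) ltac:(by rewrite divr_gt0))[d2 d20 h2] := conj dy (erefl (A y)).
exists (Num.min d1 d2); first by rewrite lt_min d10.
move=> h h0; rewrite lt_min => /andP[/(h1 h h0) q1 /(h2 h h0) q2].
have -> : S h (a *: x + y) - (a *: x + y) - h *: (a *: A x + A y) =
  a *: (S h x - x - h *: A x) + (S h y - y - h *: A y).
  rewrite (sg_lin (ltW h0)) !scalerBr scalerDr !opprD (scalerA h a) (mulrC h a) -scalerA.
  by rewrite (addrACA (a *: S h x)) (addrACA (a *: S h x - _)).
apply: le_trans (ler_normD _ _) _; rewrite normrZ.
set u := `|S h x - _ - _| in q1 *; have u0 : 0 <= u by exact: normr_ge0.
move: q1; rewrite mulrAC ler_pdivlMr// => q1.
have : `|a| * u <= u * (`|a| + 1) by lra.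
lra.
Qed.

Lemma sg_gen t x : 0 <= t -> dom A x -> dom A (S t x) /\ A (S t x) = S t (A x).
Proof.
move=> t0 dx; apply/generatorP => e e0.
have /generatorP /(_ (e / k) ltac:(by rewrite divr_gt0))[d d0 hd] := conj dx (erefl (A x)).
exists d => // h h0 /(hd h h0) q.
rewrite -sgD ?(ltW h0)// (addrC h) sgD ?(ltW h0)//.
rewrite -(linpZ (sg_lin t0)) -!(linpB (sg_lin t0)); apply: le_trans (sg_bd _ t0) _.
by move: q; rewrite mulrAC ler_pdivlMr// mulrC.
Qed.

Lemma sg_orbit_cont0 x : cont0 (fun t => S t x).
Proof. exact: (orbit_cont0 k1 sg_lin sgD sg_bd sg_cont). Qed.

Hypothesis primX : has_primitives X.

(** In the last property both sides vanish at [t = 0] and have derivative [S (t + h) x]. It yields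
    both the density of the domain and the surjectivity of [A]. *)
Lemma orbit_primitive x : exists F : R -> X,
  [/\ cont0 F, forall t, 0 <= t -> rder F t (S t x), F 0 = 0 &
     forall h t, 0 <= h -> 0 <= t -> S h (F t) = F (t + h) - F h].
Proof.
have [F [F0 cF rF]] := primX (sg_orbit_cont0 x); exists F; split => // h t h0 t0.
apply/eqP; rewrite -subr_eq0.
have -> : 0 = S h (F 0) - (F (0 + h) - F h).
  by rewrite F0 (linp0 (sg_lin h0)) !add0r subrr oppr0.
apply/eqP; apply: (@rder_eq0 R X (fun s => S h (F s) - (F (s + h) - F h))) => //.
  apply: cont0B; first exact: (cont0_lin (sg_lin h0) (fun y => sg_bd y h0)).
  apply: cont0B; last exact: cont0_cst.
  move=> s s0 e e0; have [d d0 hd] := cF (s + h) (addr_ge0 s0 h0) e e0.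
  exists d => // r r0 rs; apply: hd; first exact: addr_ge0.
  by have -> : r + h - (s + h) = r - s by lra.
move=> s s0 _; have -> : 0 = S h (S s x) - (S (s + h) x - 0).
  by rewrite subr0 (addrC s) sgD// subrr.
apply: rderB; first by apply: (rder_lin (sg_lin h0) (fun y => sg_bd y h0)); exact: rF.
apply: rderB; last exact: rder_cst.
move=> e e0; have [d d0 hd] := rF (s + h) (addr_ge0 s0 h0) e e0; exists d => // r r0 rd.
by rewrite (addrAC s); exact: hd.
Qed.

(** The averages [h^-1 *: F h] of the orbit tend to [x] and lie in the domain: [S r (F h) - F h] is
    a difference of two integrals of length [r], so [A (F h) = S h x - x]. *)
Lemma gen_dense x e : 0 < e -> exists2 y, dom A y & `|y - x| <= e.
Proof.
move=> e0; have [F [cF rF F0 SF]] := orbit_primitive x.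
have [d d0 hd] := rF 0 (lexx _) e e0.
pose h := d / 2; have h0 : 0 < h by rewrite divr_gt0.
have hhd : h < d by rewrite /h; lra.
have dF : dom A (F h).
  suff /generatorP[] : forall e, 0 < e -> exists2 d, 0 < d &
    forall r, 0 < r -> r < d -> `|S r (F h) - F h - r *: (S h x - x)| <= e * r by [].
  move=> e' e'0; have e2 : 0 < e' / 2 by rewrite divr_gt0.
  have [d1 d10 h1] := rF h (ltW h0) _ e2; have [d2 d20 h2] := rF 0 (lexx _) _ e2.
  exists (Num.min d1 d2); first by rewrite lt_min d10.
  move=> r r0; rewrite lt_min => /andP[/(h1 r r0) q1 /(h2 r r0)].
  rewrite add0r F0 subr0 sg0 => q2; rewrite SF ?(ltW r0) ?(ltW h0)//.
  have -> : F (h + r) - F r - F h - r *: (S h x - x) =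
    (F (h + r) - F h - r *: S h x) - (F r - r *: x).
    rewrite scalerBr !opprB (addrAC _ (- F r)) -!addrA; congr (_ + (_ + _)).
    by rewrite addrCA [RHS]addrCA; congr (_ + _); exact: addrC.
  by apply: le_trans (ler_normB _ _) _; lra.
exists (h^-1 *: F h).
  have [] // := @gen_lin h^-1 (F h) 0 dF _; last by rewrite addr0.
  have /generatorP[] // : forall e, 0 < e -> exists2 d, 0 < d &
    forall r, 0 < r -> r < d -> `|S r 0 - 0 - r *: (0 : X)| <= e * r.
  move=> e' e'0; exists 1 => // r r0 _.
  by rewrite (linp0 (sg_lin (ltW r0))) scaler0 !subr0 normr0 mulr_ge0// ltW.
have := hd h h0 hhd; rewrite add0r F0 subr0 sg0.
have -> : h^-1 *: F h - x = h^-1 *: (F h - h *: x).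
  by rewrite scalerBr scalerA mulVf ?gt_eqF// scale1r.
by rewrite normrZ gtr0_norm ?invr_gt0// ler_pdivrMl// mulrC.
Qed.

Lemma exp_decay_small (c e : R) : 0 < e ->
  exists2 t0, 0 <= t0 & forall t, t0 <= t -> c * expR (- nu * t) <= e.
Proof.
move=> e0; have c1 : 0 < `|c| + 1 by rewrite ltr_wpDl.
exists ((`|c| + 1) / e / nu); first by rewrite !divr_ge0 ?ltW.
move=> t; rewrite !ler_pdivrMr// => h.
have nt : 0 <= nu * t by rewrite -(pmulr_rge0 _ e0); lra.
have h1 : expR (- nu * t) * (1 + nu * t) <= 1.
  by rewrite mulNr expRN ler_pdivrMl ?expR_gt0// mulr1 expR_ge1Dx.
have x0 := expR_ge0 (- nu * t).
apply: (@le_trans _ _ ((`|c| + 1) * expR (- nu * t))).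
  by rewrite ler_wpM2r//; have := ler_norm c; lra.
apply: le_trans (ler_wpM2r x0 h) _.
have -> : t * nu * e * expR (- nu * t) = e * (expR (- nu * t) * (nu * t)) by ring.
by rewrite ler_piMr ?(ltW e0)//; lra.
Qed.

(** [y] is minus the integral of the orbit of [x] over the half-line; integrating the majorant
    [k * expR (- nu * s) * |x|] gives the constant [k / nu]. *)
Lemma gen_surj x : exists y, [/\ dom A y, A y = x & `|y| <= k / nu * `|x|].
Proof.
have [F [cF rF F0 SF]] := orbit_primitive x.
pose c := k / nu * `|x|; have c0 : 0 <= c by rewrite mulr_ge0// divr_ge0// ltW.
have tail s t : 0 <= s -> s <= t -> `|F t - F s| <= c * expR (- nu * s) - c * expR (- nu * t).
  move=> s0 st; have -> : c * expR (- nu * s) - c * expR (- nu * t) =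
    - c * expR (- nu * t) - - c * expR (- nu * s) by ring.
  apply: (@mvi R X F (fun r => - c * expR (- nu * r))) => //; first exact: exp_cont0.
  move=> r sr rt e e0; have e2 : 0 < e / 2 by rewrite divr_gt0.
  have r0 : 0 <= r by lra.
  have [d1 d10 h1] := rF r r0 _ e2; have [d2 d20 h2] := exp_rder (- c) (- nu) r e2.
  exists (Num.min d1 d2); first by rewrite lt_min d10.
  move=> h h0; rewrite lt_min => /andP[/(h1 h h0) q1 /(h2 h h0)].
  rewrite ler_norml => /andP[q2 _].
  have := ler_normD (F (r + h) - F r - h *: S r x) (h *: S r x).
  rewrite subrK normrZ gtr0_norm// => q3.
  have : h * `|S r x| <= h * (k * expR (- nu * r) * `|x|) by rewrite ler_pM2l// hexp.
  have e1 : - c * - nu * expR (- nu * r) = k * expR (- nu * r) * `|x|.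
    by rewrite /c; field; rewrite gt_eqF.
  rewrite e1 /GRing.scale/= in q2; lra.
have [l lP] : exists l, forall e : R, 0 < e -> exists N, forall i, (N <= i)%N -> `|F i%:R - l| <= e.
  apply: complete_seq_complete => e e0.
  have [t0 t00 ht0] := exp_decay_small c (divr_gt0 e0 (ltr0Sn _ 1)).
  have tl t : t0 <= t -> `|F t - F t0| <= e / 2.
    move=> t0t; apply: le_trans (tail _ _ t00 t0t) _.
    by have := ht0 t0 (lexx _); have := mulr_ge0 c0 (expR_ge0 (- nu * t)); lra.
  exists (Num.truncn t0).+1 => i j Ni Nj.
  have big n : (Num.truncn t0 < n)%N -> t0 <= n%:R.
    by move=> hn; apply/ltW/(lt_le_trans (Num.Theory.truncnS_gt t0)); rewrite ler_nat.
  apply: le_trans (ler_distD (F t0) _ _) _; rewrite (distrC (F t0)).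
  by have := tl _ (big i Ni); have := tl _ (big j Nj); lra.
have Fl t : 0 <= t -> `|F t - l| <= c * expR (- nu * t).
  move=> t0; apply/ler_addgt0Pr => e e0; have [N hN] := lP e e0.
  pose n := maxn N (Num.truncn t).+1.
  have tn : t <= n%:R.
    by apply/ltW/(lt_le_trans (Num.Theory.truncnS_gt t)); rewrite ler_nat leq_maxr.
  apply: le_trans (ler_distD (F n%:R) _ _) _; rewrite (distrC (F t)).
  have := tail _ _ t0 tn; have := hN n (leq_maxl _ _).
  by have := mulr_ge0 c0 (expR_ge0 (- nu * n%:R)); lra.
(* The limit as [t] tends to infinity of [S h (F t) = F (t + h) - F h]. *)
have Sl h : 0 <= h -> S h l - l = - F h.
  move=> h0; apply/eqP; rewrite -subr_eq0 opprK -normr_le0; apply/ler_addgt0Pr => e e0.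
  rewrite add0r; have ke : 0 < e / (k + 1) by rewrite divr_gt0// addr_gt0.
  have [t t0 ht] := exp_decay_small c ke.
  have -> : S h l - l + F h = S h (l - F t) + (F (t + h) - l).
    by rewrite (linpB (sg_lin h0)) SF// opprB -!addrA addKr (addrC (- l)).
  apply: le_trans (ler_normD _ _) _.
  have q1 := le_trans (Fl t t0) (ht t (lexx _)).
  have q2 : `|F (t + h) - l| <= e / (k + 1).
    by apply: le_trans (Fl _ _) (ht _ _); lra.
  have q3 := sg_bd (l - F t) h0; rewrite (distrC l) in q3.
  have q4 : k * `|F t - l| <= k * (e / (k + 1)) by rewrite ler_pM2l.
  have ee : e = (k + 1) * (e / (k + 1)) by rewrite mulrC mulfVK// gt_eqF// addr_gt0.
  by rewrite [leRHS]ee; lra.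
have [dl Al] : dom A (- l) /\ A (- l) = x.
  apply/generatorP => e e0; have [d d0 hd] := rF 0 (lexx _) e e0; exists d => // h h0 /(hd h h0).
  rewrite add0r F0 subr0 sg0 (linpN (sg_lin (ltW h0))) opprK.
  by rewrite (_ : - S h l + l = F h)// -[RHS]opprK -Sl ?(ltW h0)// opprB addrC.
exists (- l); split => //; rewrite normrN.
by have := Fl 0 (lexx _); rewrite F0 sub0r normrN mulr0 expR0 mulr1.
Qed.

(** A vector killed by [A] has a constant orbit, which the exponential bound forces to be 0. *)
Lemma gen_inj x : dom A x -> A x = 0 -> x = 0.
Proof.
move=> dx Ax.
have cst t : 0 <= t -> S t x = x.
  move=> t0; rewrite -[RHS]sg0.
  apply: (@rder_eq0 R X (fun t => S t x)) => //; first exact: sg_orbit_cont0.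
  move=> s s0 _ e e0; have [ds As] := sg_gen s0 dx.
  have /generatorP /(_ e e0)[d d0 hd] := conj ds As.
  exists d => // h h0 /(hd h h0).
  by rewrite Ax (linp0 (sg_lin s0)) (addrC s) sgD// ltW.
apply/eqP; rewrite -normr_le0; apply/ler_addgt0Pr => e e0; rewrite add0r.
have [t t0 ht] := exp_decay_small (k * `|x|) e0.
by rewrite -{1}(cst t t0); apply: le_trans (hexp _ t0) _; rewrite mulrAC ht.
Qed.

Notation invA := (inv_app A).

Lemma inv_genP x : dom A (invA x) /\ A (invA x) = x.
Proof.
have [y [dy Ay _]] := gen_surj x; rewrite /inv_app.
by have [] := @xgetPex _ 0 [set x0 | dom A x0 /\ A x0 = x] (ex_intro _ y (conj dy Ay)).
Qed.

Lemma gen_inj_eq x y : dom A x -> dom A y -> A x = A y -> x = y.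
Proof.
move=> dx dy e; apply/eqP; rewrite -subr_eq0; apply/eqP.
have [d1 e1] := gen_lin (-1) dy dx.
by apply: gen_inj; rewrite addrC -scaleN1r// e1 e scaleN1r addNr.
Qed.

Lemma inv_genK x : dom A x -> invA (A x) = x.
Proof. by move=> dx; have [d e] := inv_genP (A x); exact: gen_inj_eq. Qed.

Lemma inv_gen_bd x : `|invA x| <= k / nu * `|x|.
Proof.
have [y [dy Ay by_]] := gen_surj x; have [d e] := inv_genP x.
by rewrite (_ : invA x = y)//; apply: gen_inj_eq => //; rewrite e Ay.
Qed.

Lemma inv_gen_lin : linear invA.
Proof.
move=> a x y; have [dx ex] := inv_genP x; have [dy ey] := inv_genP y.
have [d e] := gen_lin a dx dy; have [d' e'] := inv_genP (a *: x + y).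
by apply: gen_inj_eq => //; rewrite e e' ex ey.
Qed.

Lemma inv_gen_sg t x : 0 <= t -> S t (invA x) = invA (S t x).
Proof.
move=> t0; have [dx ex] := inv_genP x; have [d e] := sg_gen t0 dx.
have [d' e'] := inv_genP (S t x).
by apply: gen_inj_eq => //; rewrite e e' ex.
Qed.

End StableGenerator.

(** * Euclidean norm, operator norms and rules for Dini derivatives *)

Section Euclidean.
Context {R : realType} {m : nat}.
Implicit Types (u v w : 'cV[R]_m) (a : R).

Lemma edotE u v : edot u v = \sum_i u i 0 * v i 0.
Proof. by rewrite /edot mxE; apply: eq_bigr => i _; rewrite mxE. Qed.

Lemma edotC u v : edot u v = edot v u.
Proof. by rewrite !edotE; apply: eq_bigr => i _; rewrite mulrC. Qed.

Lemma edot_lin a u v w : edot (a *: u + v) w = a * edot u w + edot v w.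
Proof.
rewrite !edotE mulr_sumr -big_split/=; apply: eq_bigr => i _.
by rewrite !mxE mulrDl mulrA.
Qed.

Lemma edot_ge0 u : 0 <= edot u u.
Proof. by rewrite edotE sumr_ge0// => i _; rewrite -expr2 sqr_ge0. Qed.

Lemma enorm_ge0 u : 0 <= enorm u. Proof. exact: sqrtr_ge0. Qed.

Lemma sqr_enorm u : enorm u ^+ 2 = edot u u.
Proof. by rewrite sqr_sqrtr// edot_ge0. Qed.

Lemma edot_le u v : `|edot u v| <= enorm u * enorm v.
Proof. exact: (cauchy_schwarz edotC edot_lin edot_ge0). Qed.

Lemma enormD u v : enorm (u + v) <= enorm u + enorm v.
Proof. exact: (ip_sqrtD edotC edot_lin edot_ge0). Qed.

Lemma enormZ a u : enorm (a *: u) = `|a| * enorm u.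
Proof. exact: (ip_sqrtZ edotC edot_lin). Qed.

Lemma enormN u : enorm (- u) = enorm u.
Proof. by rewrite -scaleN1r enormZ normrN1 mul1r. Qed.

Lemma enormB u v : enorm (u - v) <= enorm u + enorm v.
Proof. by rewrite -(enormN v) enormD. Qed.

Lemma enorm0 : enorm (0 : 'cV[R]_m) = 0.
Proof. by rewrite /enorm (ip0l edot_lin) sqrtr0. Qed.

Lemma le_coord_enorm u i : `|u i 0| <= enorm u.
Proof.
apply: sqr_le_le (enorm_ge0 u) _; rewrite sqr_enorm real_normK ?num_real// edotE (bigD1 i)//=.
by rewrite expr2 lerDl sumr_ge0// => j _; rewrite -expr2 sqr_ge0.
Qed.

Lemma mxnorm_le_enorm u : `|u| <= enorm u.
Proof. by apply: mxnorm_le (enorm_ge0 u) _ => i; exact: le_coord_enorm. Qed.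

Lemma enorm_le_mxnorm u : enorm u <= m%:R * `|u|.
Proof.
apply: sqr_le_le; first by rewrite mulr_ge0.
rewrite sqr_enorm edotE; apply: (@le_trans _ _ (\sum_(i < m) `|u| ^+ 2)).
  apply: ler_sum => i _; rewrite -expr2 -(real_normK (num_real (u i 0))).
  by rewrite ler_pXn2r ?nnegrE// le_mxnorm.
rewrite sumr_const card_ord -[leLHS]mulr_natl exprMn ler_wpM2r ?sqr_ge0//.
by rewrite -natrX ler_nat; case: (m) => // n; rewrite expnS expn1 leq_pmulr.
Qed.

Lemma enorm_eq0 u : enorm u = 0 -> u = 0.
Proof.
by move=> u0; apply/eqP; rewrite -normr_le0; have := mxnorm_le_enorm u; rewrite u0.
Qed.

Lemma enorm_dist u v : `|enorm u - enorm v| <= enorm (u - v).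
Proof.
have h1 := enormD (u - v) v; have h2 := enormD (v - u) u.
rewrite subrK in h1; rewrite subrK -(enormN (v - u)) opprB in h2.
by rewrite ler_norml; apply/andP; split; lra.
Qed.

Lemma cont0_enorm (f : R -> 'cV[R]_m) : cont0 f -> cont0 (fun t => enorm (f t)).
Proof.
move=> cf; apply: (cont0_lip (c := m%:R) cf) => s t _ _.
by apply: le_trans (enorm_dist _ _) (enorm_le_mxnorm _).
Qed.

Lemma mx_of_lin n (f : 'cV[R]_n -> 'cV[R]_m) : linear f ->
  forall v : 'cV[R]_n, mx_of f *m v = f v.
Proof.
move=> lf v; have lD := linpD lf; have lZ := linpZ lf; have l0 := linp0 lf.
have fsum (g : 'I_n -> 'cV[R]_n) : f (\sum_j g j) = \sum_j f (g j).
  by elim/big_rec2 : _ => // j y1 y2 _ <-; rewrite lD.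
have vE : v = \sum_j v j 0 *: delta_mx j 0.
  rewrite {1}[v]matrix_sum_delta; apply: eq_bigr => j _.
  by rewrite big_ord1; congr (_ *: _).
rewrite {2}vE fsum; apply/matrixP => i j; rewrite (ord1 j) mxE summxE.
by apply: eq_bigr => l _; rewrite lZ !mxE mulrC.
Qed.

End Euclidean.

Section OperatorNorm.
Context {R : realType} {U V : lmodType R} (nU : U -> R) (nV : V -> R) (f : U -> V) (c : R).
Hypothesis nU_ge0 : forall u, 0 <= nU u.
Hypothesis nV_ge0 : forall v, 0 <= nV v.
Hypothesis nUZ : forall a u, nU (a *: u) = `|a| * nU u.
Hypothesis nVZ : forall a v, nV (a *: v) = `|a| * nV v.
Hypothesis flin : linear f.
Hypothesis fc : forall u, nV (f u) <= c * nU u.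

Let E := [set nV (f u) | u in [set u | nU u <= 1]].

Let ubE : ubound E `|c|.
Proof.
move=> _ [u /= u1 <-]; apply: le_trans (fc u) _.
apply: le_trans (ler_wpM2r (nU_ge0 u) (ler_norm c)) _.
by rewrite ler_piMr.
Qed.

Lemma opnorm_ge0 : 0 <= opnorm nU nV f.
Proof.
apply: (@le_trans _ _ (nV (f 0))) => //; apply: ub_le_sup; first by exists `|c|.
exists 0 => //=; have := nUZ 0 0; rewrite scale0r normr0 mul0r => ->; exact: ler01.
Qed.

(** Normalise [u]; the hypothesis [fc] makes the supremum in [opnorm] a genuine one and settles the
    vectors with [nU u = 0]. *)
Lemma opnorm_bound u : nV (f u) <= opnorm nU nV f * nU u.
Proof.
have [u0|u0] := eqVneq (nU u) 0.
  by rewrite u0 mulr0; have := fc u; rewrite u0 mulr0.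
have up : 0 < nU u by rewrite lt_def u0 nU_ge0.
rewrite -ler_pdivrMr//; apply: (@le_trans _ _ (nV (f ((nU u)^-1 *: u)))).
  by rewrite (linpZ flin) nVZ gtr0_norm ?invr_gt0// mulrC.
apply: ub_le_sup; first by exists `|c|.
by exists ((nU u)^-1 *: u) => //=; rewrite nUZ gtr0_norm ?invr_gt0// mulVf.
Qed.

End OperatorNorm.

Section DiniRules.
Context {R : realType}.
Implicit Types (a b c e h t : R) (f g w : R -> R).

Lemma dini_le f t c c' : c <= c' -> dini f t c -> dini f t c'.
Proof.
move=> cc' H e e0; have [d d0 hd] := H e e0; exists d => // h h0 /(hd h h0).
by move=> /le_trans; apply; rewrite lerD2l ler_wpM2l ?lerD2r// ltW.
Qed.

Lemma diniD f g t c c' : dini f t c -> dini g t c' -> dini (fun s => f s + g s) t (c + c').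
Proof.
move=> H1 H2 e e0; have e2 : 0 < e / 2 by rewrite divr_gt0.
have [d1 d10 h1] := H1 _ e2; have [d2 d20 h2] := H2 _ e2.
exists (Num.min d1 d2); first by rewrite lt_min d10.
by move=> h h0; rewrite lt_min => /andP[/(h1 h h0) k1 /(h2 h h0) k2]; lra.
Qed.

Lemma diniZ f t a c : 0 <= a -> dini f t c -> dini (fun s => a * f s) t (a * c).
Proof.
move=> a0 H e e0; have a1 : 0 < a + 1 by lra.
have [d d0 hd] := H (e / (a + 1)) ltac:(by rewrite divr_gt0).
exists d => // h h0 /(hd h h0) q.
have := ler_wpM2l a0 q.
have : h * (a * (e / (a + 1))) <= h * e.
  by rewrite ler_pM2l// mulrCA ler_piMr ?(ltW e0)// ler_pdivrMr//; lra.
lra.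
Qed.

Lemma dini_sqr f t c : (forall s, 0 <= f s) -> dini f t c ->
  dini (fun s => f s ^+ 2) t (2 * f t * c).
Proof.
move=> f0 H e e0; have a0 := f0 t; have a1 : 0 < 4 * (f t + 1) by lra.
have [d d0 hd] := H (e / (4 * (f t + 1))) ltac:(by rewrite divr_gt0).
set e' := e / _ in hd; have e'0 : 0 < e' by rewrite divr_gt0.
have ee : e = 4 * (f t + 1) * e' by rewrite mulrC mulfVK// gt_eqF.
have C0 : 0 < 2 * ((c + e') ^+ 2 + 1) by have := sqr_ge0 (c + e'); lra.
exists (Num.min d (e / (2 * ((c + e') ^+ 2 + 1)))); first by rewrite lt_min d0 divr_gt0.
move=> h h0; rewrite lt_min ltr_pdivlMr// => /andP[/(hd h h0) q1 q2].
have q3 : f (t + h) ^+ 2 <= (f t + h * (c + e')) ^+ 2.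
  by rewrite ler_pXn2r ?nnegrE ?f0// (le_trans (f0 (t + h))).
apply: le_trans q3 _.
have q4 : h * (h * (c + e') ^+ 2) <= h * (e / 2) by rewrite ler_pM2l//; lra.
have q5 : h * (2 * f t * e') <= h * (e / 2).
  by rewrite ler_pM2l// [leRHS](_ : _ = 2 * (f t + 1) * e'); [lra|rewrite ee; field].
lra.
Qed.

Lemma cont0_sqr f : cont0 f -> cont0 (fun s => f s ^+ 2).
Proof.
move=> cf s s0 e e0; have [c c0 hc] := cont0_bounded (s + 1) cf.
have c1 : 0 < 2 * c + 1 by lra.
have [d d0 hd] := cf s s0 (e / (2 * c + 1)) ltac:(by rewrite divr_gt0).
exists (Num.min d 1); first by rewrite lt_min d0 ltr01.
move=> r r0; rewrite lt_min => /andP[/(hd r r0)]; rewrite ler_pdivlMr// => q1.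
rewrite ltr_norml => /andP[_ q2].
have h1 := hc r r0 ltac:(lra); have h2 := hc s s0 ltac:(lra).
rewrite subr_sqr normrM; apply: le_trans q1; rewrite ler_wpM2l//.
by apply: le_trans (ler_normD _ _) _; lra.
Qed.

(** [expR (c * s) * w s] is nonincreasing: over a step [h] the growth of the exponential is
    compensated by [expR (c * h) * (1 - c * h) <= 1]. *)
Lemma dini_exp_decay w c t : 0 <= c -> cont0 w -> (forall s, 0 <= w s) ->
  (forall s, 0 <= s -> dini w s (- c * w s)) -> 0 <= t -> w t <= expR (- c * t) * w 0.
Proof.
move=> c0 cw w0 dw t0.
have : 1 * expR (c * t) * w t <= 1 * expR (c * 0) * w 0.
  apply: (@dini_noninc R (fun s => 1 * expR (c * s) * w s)) => //.
    move=> s s0 e e0.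
    have [M M0 hM] := cont0_bounded (s + 1) cw.
    have E0 := expR_gt0 (c * (s + 1)).
    have d1 : 0 < e / 2 / (M + 1) by rewrite !divr_gt0// ltr_wpDl.
    have d2 : 0 < e / 2 / expR (c * (s + 1)) by rewrite !divr_gt0.
    have [r1 r10 hr1] := exp_cont0 1 c s0 d1; have [r2 r20 hr2] := cw s s0 _ d2.
    exists (Num.min (Num.min r1 r2) 1); first by rewrite !lt_min r10 r20 ltr01.
    move=> r r0; rewrite !lt_min => /andP[/andP[/(hr1 r r0) q1 /(hr2 r r0) q2] q3].
    have -> : 1 * expR (c * r) * w r - 1 * expR (c * s) * w s =
      (1 * expR (c * r) - 1 * expR (c * s)) * w s + expR (c * r) * (w r - w s) by ring.
    apply: le_trans (ler_normD _ _) _; rewrite !normrM.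
    move: q1; rewrite ler_pdivlMr ?ltr_wpDl// => q1.
    move: q2; rewrite ler_pdivlMr// => q2.
    have q4 : `|w s| <= M by apply: hM => //; lra.
    have q5 : `|expR (c * r)| <= expR (c * (s + 1)).
      rewrite ger0_norm ?expR_ge0// ler_expR ler_wpM2l//.
      by move: q3; rewrite ltr_norml => /andP[_]; lra.
    set x := `|1 * _ - _| in q1 *; set y := `|w r - w s| in q2 *.
    have := ler_wpM2l (normr_ge0 _ : 0 <= x) q4.
    have := ler_wpM2r (normr_ge0 _ : 0 <= y) q5.
    have := (normr_ge0 _ : 0 <= x).
    lra.
  move=> s s0 st e e0; have E0 := expR_gt0 (c * (s + 1)).
  have [d d0 hd] := dw s s0 (e / expR (c * (s + 1))) ltac:(by rewrite divr_gt0).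
  exists (Num.min d 1); first by rewrite lt_min d0 ltr01.
  move=> h h0; rewrite lt_min => /andP[/(hd h h0) q1 q2].
  have -> : 1 * expR (c * (s + h)) = expR (c * s) * expR (c * h).
    by rewrite mul1r mulrDr expRD.
  have q3 : expR (c * h) * (1 - c * h) <= 1.
    rewrite -ler_pdivlMl ?expR_gt0// mulr1 -expRN.
    by have := expR_ge1Dx (- (c * h)); lra.
  have E1 := expR_gt0 (c * s); have E2 := expR_gt0 (c * h).
  have q4 : expR (c * s) * expR (c * h) <= expR (c * (s + 1)).
    by rewrite -expRD ler_expR -mulrDr ler_wpM2l//; lra.
  have q5 : expR (c * s) * expR (c * h) * w (s + h) <=
      expR (c * s) * expR (c * h) * (w s + h * (- c * w s + e / expR (c * (s + 1)))).
    by rewrite ler_pM2l// mulr_gt0.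
  apply: le_trans q5 _.
  have q6 : expR (c * s) * w s * (expR (c * h) * (1 - c * h)) <= expR (c * s) * w s.
    by rewrite ler_piMr// mulr_ge0// ltW.
  have q7 : expR (c * s) * expR (c * h) * (e / expR (c * (s + 1))) <= e.
    by rewrite mulrCA ler_piMr ?(ltW e0)// ler_pdivrMr// mul1r.
  have := ler_wpM2l (ltW h0) q7.
  lra.
rewrite mulr0 expR0 !mul1r mulNr expRN => H.
by rewrite ler_pdivlMl ?expR_gt0.
Qed.

Lemma rder_dini_edot (m : nat) (f : R -> 'cV[R]_m) t l : rder f t l ->
  dini (fun s => edot (f s) (f s)) t (2 * edot (f t) l).
Proof.
move=> rf e e0.
pose N := enorm (f t) + enorm l; have N0 : 0 <= N by rewrite addr_ge0// enorm_ge0.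
have C0 : 0 < 4 * (N + 1) by lra.
pose e' := Num.min 1 (e / (4 * (N + 1))).
have e'0 : 0 < e' by rewrite lt_min ltr01 divr_gt0.
have m1 : 0 < m%:R + 1 :> R by rewrite ltr_wpDl.
have [d d0 hd] := rf (e' / (m%:R + 1)) ltac:(by rewrite divr_gt0).
have L0 : 0 < 4 * (edot l l + 1) by have := edot_ge0 l; lra.
exists (Num.min (Num.min d 1) (e / (4 * (edot l l + 1)))).
  by rewrite !lt_min d0 ltr01 divr_gt0.
move=> h h0; rewrite !lt_min ltr_pdivlMr// => /andP[/andP[/(hd h h0) q1 h1] q2].
pose r := f (t + h) - f t - h *: l.
have rle : enorm r <= e' * h.
  apply: le_trans (enorm_le_mxnorm _) _; move: q1; rewrite mulrAC ler_pdivlMr// mulrC.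
  by apply: le_trans; rewrite ler_wpM2r// lerDl.
have r0 := enorm_ge0 r.
have -> : f (t + h) = (f t + h *: l) + r 
  by rewrite [RHS]addrC /r -[f (t + h) - _ - _]addrA -opprD subrK.
rewrite (ipDD edotC edot_lin (f t + _)) (ipDD edotC edot_lin (f t)).
rewrite !(ipZr edotC edot_lin) (ipZl edot_lin).
have q3 : edot (f t + h *: l) r <= N * (e' * h).
  apply: le_trans (ler_norm _) _; apply: le_trans (edot_le _ _) _.
  apply: ler_pM => //; first exact: enorm_ge0.
  apply: le_trans (enormD _ _) _; rewrite lerD2l enormZ gtr0_norm//.
  by rewrite ler_piMl ?enorm_ge0// ltW.
have q4 : edot r r <= e' * h.
  rewrite -sqr_enorm; apply: (@le_trans _ _ ((e' * h) ^+ 2)).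
    by rewrite ler_pXn2r ?nnegrE// (le_trans r0).
  have e'1 : e' <= 1 by rewrite ge_min lexx.
  rewrite expr2 ler_piMr//; first by rewrite mulr_ge0 ?(ltW e'0) ?(ltW h0).
  by rewrite mulr_ile1 ?(ltW e'0) ?(ltW h0) ?(ltW h1).
have q5 : e' * (4 * (N + 1)) <= e by rewrite -ler_pdivlMr// ge_min lexx orbT.
have q6 := ler_wpM2l (ltW h0) q5.
have q7 : h * (h * edot l l) <= h * (e / 4).
  by rewrite ler_pM2l//; lra.
have q8 : 0 <= e' * h by rewrite mulr_ge0 ?(ltW e'0) ?(ltW h0).
have q9 : 0 <= h * e by rewrite mulr_ge0 ?(ltW e0) ?(ltW h0).
lra.
Qed.

End DiniRules.

(** * An equivalent norm in which the semigroup contracts *)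

Section AdaptedNorm.
Context {R : realType} {X : completeNormedModType R}.
Variables (S : R -> X -> X) (k nu : R).
Implicit Types (a b c d e h s t : R) (x y : X).
Hypothesis hS : C0_semigroup S.
Hypothesis k1 : 1 <= k.
Hypothesis nu0 : 0 < nu.
Hypothesis hexp : forall x t, 0 <= t -> `|S t x| <= k * expR (- nu * t) * `|x|.

(* Equivalent norm for which [S t] is a contraction of ratio [exp (- nu t)]. *)
Definition snorm x := sup [set expR (nu * t) * `|S t x| | t in [set t | 0 <= t]].

Let k0 : 0 < k. Proof. exact: lt_le_trans ltr01 k1. Qed.

Let snorm_ub x : ubound [set expR (nu * t) * `|S t x| | t in [set t | 0 <= t]] (k * `|x|).
Proof.
move=> _ [t /= t0 <-]; apply: le_trans (ler_wpM2l (expR_ge0 _) (hexp x t0)) _.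
by rewrite mulrA mulrCA -expRD mulNr subrr expR0 mulr1.
Qed.

Lemma le_snorm x t : 0 <= t -> expR (nu * t) * `|S t x| <= snorm x.
Proof. by move=> t0; apply: ub_le_sup; [exists (k * `|x|)|exists t]. Qed.

Lemma norm_le_snorm x : `|x| <= snorm x.
Proof. by have := le_snorm x (lexx 0); rewrite mulr0 expR0 mul1r (sg0 hS). Qed.

Lemma snorm_le c x : (forall t, 0 <= t -> expR (nu * t) * `|S t x| <= c) -> snorm x <= c.
Proof.
move=> H; apply: ge_sup; first by exists (expR (nu * 0) * `|S 0 x|), 0 => //=.
by move=> _ [t /= t0 <-]; exact: H.
Qed.

Lemma snorm_le_norm x : snorm x <= k * `|x|.
Proof. by apply: snorm_le => t t0; apply: snorm_ub; exists t. Qed.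

Lemma snorm_ge0 x : 0 <= snorm x.
Proof. exact: le_trans (normr_ge0 x) (norm_le_snorm x). Qed.

Lemma snormD x y : snorm (x + y) <= snorm x + snorm y.
Proof.
apply: snorm_le => t t0; rewrite (linpD (sg_lin hS t0)).
apply: le_trans (ler_wpM2l (expR_ge0 _) (ler_normD _ _)) _.
by rewrite mulrDr lerD// le_snorm.
Qed.

Lemma snorm_sg h x : 0 <= h -> snorm (S h x) <= expR (- nu * h) * snorm x.
Proof.
move=> h0; apply: snorm_le => t t0; rewrite -(sgD hS)//.
have -> : expR (nu * t) = expR (- nu * h) * expR (nu * (t + h)).
  by rewrite -expRD; congr expR; ring.
by rewrite -mulrA ler_wpM2l ?expR_ge0// le_snorm// addr_ge0.
Qed.

Lemma snorm_dist x y : `|snorm x - snorm y| <= k * `|x - y|.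
Proof.
have h1 := snormD (x - y) y; have h2 := snormD (y - x) x.
rewrite subrK in h1; rewrite subrK in h2.
have h3 := snorm_le_norm (x - y); have h4 := snorm_le_norm (y - x).
rewrite (distrC y) in h4.
by rewrite ler_norml; apply/andP; split; lra.
Qed.

Lemma cont0_snorm f : cont0 f -> cont0 (fun t => snorm (f t)).
Proof. by move=> cf; apply: (cont0_lip (c := k) cf) => s t _ _; exact: snorm_dist. Qed.

(** The free part contracts in [snorm]; the input is bounded in the original norm, and passing to
    [snorm] costs the factor [k] of the gain condition. *)
Lemma mild_der_dini_snorm (g q : R -> X) t c : `|g t| <= c -> mild_der S g q t ->
  dini (fun s => snorm (q s)) t (- nu * snorm (q t) + k * c).
Proof.
move=> gc mq e e0; pose a := snorm (q t); have a0 : 0 <= a := snorm_ge0 _.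
have [d1 d10 h1] := mq (e / 2 / k) ltac:(by rewrite !divr_gt0).
have a1 : 0 < a + 1 by lra.
have [d2 d20 h2] := exp_rder 1 (- nu) 0 (e := e / 2 / (a + 1)) ltac:(by rewrite !divr_gt0).
exists (Num.min d1 d2); first by rewrite lt_min d10.
move=> h h0; rewrite lt_min => /andP[/(h1 h h0) q1 /(h2 h h0)].
rewrite add0r mulr0 expR0 !mulr1 !mul1r ler_norml => /andP[_ q2].
have -> : q (t + h) = S h (q t) + (q (t + h) - S h (q t) - h *: g t + h *: g t).
  by rewrite subrK [RHS]addrC subrK.
apply: le_trans (snormD _ _) _.
have q3 := le_trans (snorm_sg (q t) (ltW h0)) (lexx _).
have q4 := le_trans (snorm_le_norm _) (ler_wpM2l (ltW k0) (ler_normD (q (t + h) - S h (q t) - h *: g t) (h *: g t))).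
rewrite normrZ gtr0_norm// in q4.
move: q1; rewrite mulrAC ler_pdivlMr// => q1.
have q5 : h * `|g t| * k <= h * c * k by rewrite ler_pM2r// ler_pM2l.
have q6 : expR (- nu * h) * a <= (1 - nu * h + e / 2 / (a + 1) * h) * a.
  by rewrite ler_wpM2r//; rewrite /GRing.scale/= in q2; lra.
have q7 : e / 2 / (a + 1) * h * a <= e / 2 * h.
  have -> : e / 2 / (a + 1) * h * a = e / 2 * h * (a / (a + 1)) by ring.
  rewrite ler_piMr//; first by rewrite mulr_ge0 ?divr_ge0 ?(ltW e0) ?(ltW h0).
  by rewrite ler_pdivrMr// mul1r lerDl.
rewrite -/a in q3 *.
lra.
Qed.

End AdaptedNorm.

(* With [p := k beta mu], [zt := Z / mu], the left-hand side is
   [- 2 (nu - ki p) a^2 - 2 ki p (a - zt)^2]. *)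
Lemma lyapunov_ineq (R : realType) (a Z E k bet mu ki nu dl : R) :
  0 < mu -> 0 < bet -> 0 < k -> 0 < ki -> 0 <= a -> 0 <= Z -> 0 <= E ->
  E <= Z + mu * a -> 0 < dl -> dl * (1 + 8 * (k * bet * mu)) <= nu - ki * (k * bet * mu) ->
  2 * dl <= ki ->
  2 * a * (- nu * a + k * (ki * bet * Z)) +
    k * bet / mu * (2 * (- ki * Z ^+ 2 + ki * (mu * a * Z))) <=
  - (2 * dl) * (a ^+ 2 + k * bet / mu * E ^+ 2).
Proof.
move=> mu0 bet0 k0 ki0 a0 Z0 E0 EZ dl0 h1 h2.
pose p := k * bet * mu; pose zt := Z / mu.
have p0 : 0 < p by rewrite !mulr_gt0.
have -> : k * bet / mu = p / mu ^+ 2 by rewrite /p; field; rewrite gt_eqF.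
have q1 : p / mu ^+ 2 * E ^+ 2 <= p * (zt + a) ^+ 2.
  have -> : p * (zt + a) ^+ 2 = p / mu ^+ 2 * (Z + mu * a) ^+ 2.
    by rewrite /zt; field; rewrite gt_eqF.
  rewrite ler_wpM2l ?divr_ge0 ?sqr_ge0 ?(ltW p0)// ler_pXn2r ?nnegrE//.
  exact: le_trans E0 EZ.
have -> : 2 * a * (- nu * a + k * (ki * bet * Z)) +
    p / mu ^+ 2 * (2 * (- ki * Z ^+ 2 + ki * (mu * a * Z))) =
    - (2 * (nu - ki * p)) * a ^+ 2 - 2 * ki * p * (a - zt) ^+ 2.
  by rewrite /zt /p; field; rewrite gt_eqF.
(* The two sides differ by [p * (zt - 3 * a) ^+ 2]; this is the origin of the 8 in the hypothesis on
   [dl]. *)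
have q2 : p * (zt + a) ^+ 2 <= p * (2 * (a - zt) ^+ 2 + 8 * a ^+ 2).
  by rewrite ler_pM2l//; have := sqr_ge0 (zt - 3 * a); lra.
have q3 := ler_wpM2r (sqr_ge0 a) h1.
have q4 := ler_wpM2r (mulr_ge0 (ltW p0) (sqr_ge0 (a - zt))) h2.
have q5 := ler_wpM2l (ltW dl0) (le_trans q1 q2).
rewrite -/p in q3; lra.
Qed.

(** * The homogeneous closed loop in mild form *)

Section ClosedLoop.
Context {R : realType} {X : completeNormedModType R} {dot : {dot X for idfun}} {m : nat}.
Context {S : R -> X -> X} {A : operator X X}.
Context {B : {linear 'cV[R]_m -> X}} {C : operator X 'cV[R]_m} {k nu ki : R}.
Implicit Types (a b c d e h s t : R) (v z : 'cV[R]_m) (p : R -> X * 'cV[R]_m).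
Hypothesis hX : norm_of_dot dot.
Hypothesis hS : C0_semigroup S.
Hypothesis hA : generator S A.
Hypothesis k0 : 0 < k.
Hypothesis nu0 : 0 < nu.
Hypothesis hexp : forall (x : X) t, 0 <= t -> `|S t x| <= k * expR (- nu * t) * `|x|.
Hypothesis hB : exists b : R, forall v, `|B v| <= b * enorm v.
Hypothesis hC : linear_operator C.
Hypothesis hAC : dom A `<=` dom C.
Hypothesis hadm : admissible S A C.
Hypothesis hrank : \rank (dc_gain A B C) = m.
Hypothesis ki0 : 0 < ki.
Hypothesis hki : ki < ki_star A B C k nu.

Local Notation invA := (inv_app A).
Definition obs_inv x := C (invA x).
Local Notation M := obs_inv.
Definition feedback v := ki *: B (Ki A B C *m v).
Local Notation F := feedback.
Let mu := opnorm (fun x : X => `|x|) (@enorm R m) M.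
Let bet := opnorm (@enorm R m) (fun x : X => `|x|) (fun v => B (Ki A B C *m v)).

Let BKlin : linear (fun v => B (Ki A B C *m v)).
Proof. by move=> a u v; rewrite mulmxDr -scalemxAr linearD linearZ. Qed.

Let BKbd : exists c, forall v, `|B (Ki A B C *m v)| <= c * enorm v.
Proof.
have [b hb] := hB; pose G := Ki A B C.
have Glin : linear (fun v => G *m v) by move=> a u v; rewrite mulmxDr -scalemxAr.
pose g := \sum_i \sum_j `|G i j|.
have g0 : 0 <= g by do 2![apply: sumr_ge0 => ? _].
exists (`|b| * (m%:R * g)) => v; apply: le_trans (hb _) _.
apply: le_trans (ler_wpM2r (enorm_ge0 _) (ler_norm b)) _.
rewrite -mulrA ler_wpM2l//; apply: le_trans (enorm_le_mxnorm _) _.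
rewrite -mulrA ler_wpM2l//; apply: mxnorm_le => [|i]; first by rewrite mulr_ge0 ?enorm_ge0.
rewrite mxE; apply: le_trans (ler_norm_sum _ _ _) _.
have gi : \sum_j `|G i j| <= g.
  by rewrite /g [leRHS](bigD1 i)//= lerDl sumr_ge0// => l _; rewrite sumr_ge0.
apply: le_trans (ler_wpM2r (enorm_ge0 v) gi).
rewrite mulr_suml; apply: ler_sum => j _.
by rewrite normrM ler_wpM2l// le_coord_enorm.
Qed.

Let ks_gt0 : 0 < ki_star A B C k nu. Proof. exact: lt_trans ki0 hki. Qed.

(** If [X] were trivial, [bet] would be 0 and, division by 0 giving 0, so would [ki_star], against
    [0 < ki < ki_star]. *)
Lemma ex_neq0 : exists x : X, x != 0.
Proof.
apply: contrapT => H.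
have X0 (x : X) : x = 0 by apply/eqP/negPn/negP => x0; apply: H; exists x.
have bet0 : bet = 0.
  apply/eqP; rewrite eq_le; apply/andP; split; last first.
    have [c hc] := BKbd.
    by apply: (opnorm_ge0 _ _ _ hc); [exact: enorm_ge0|move=> u; exact: normr_ge0|exact: enormZ].
  apply: ge_sup => [|_ [v /= _ <-]]; last by rewrite (X0 (B _)) normr0.
  by exists `|B (Ki A B C *m 0)|, 0 => //=; rewrite enorm0.
by have := ks_gt0; rewrite /ki_star -/(Ki A B C) -/bet bet0 mulr0 invr0 mulr0 ltxx.
Qed.

Lemma growth_ge1 : 1 <= k.
Proof.
have [x x0] := ex_neq0; have xp : 0 < `|x| by rewrite normr_gt0.
by have := hexp x (lexx 0); rewrite (sg0 hS) mulr0 expR0 mulr1 ler_pMl.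
Qed.
Let k1 := growth_ge1.

Let primX : has_primitives X. Proof. exact: hilbert_primitives hX. Qed.

Lemma invA_P x : dom A (invA x) /\ A (invA x) = x.
Proof. exact: (inv_genP hS hA k1 nu0 hexp primX). Qed.

Lemma invA_K x : dom A x -> invA (A x) = x.
Proof. exact: (inv_genK hS hA k1 nu0 hexp primX). Qed.

Lemma invA_bd x : `|invA x| <= k / nu * `|x|.
Proof. exact: (inv_gen_bd hS hA k1 nu0 hexp primX). Qed.

Lemma invA_lin : linear invA.
Proof. exact: (inv_gen_lin hS hA k1 nu0 hexp primX). Qed.

Lemma invA_sg t x : 0 <= t -> S t (invA x) = invA (S t x).
Proof. exact: (inv_gen_sg hS hA k1 nu0 hexp primX). Qed.

Lemma M_lin : linear M.
Proof.
move=> a x y; rewrite /M invA_lin; have [_ H] := hC.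
by have [] := H a (invA x) (invA y) (hAC (invA_P x).1) (hAC (invA_P y).1).
Qed.

Lemma obs_domA x : dom A x -> C x = M (A x).
Proof. by move=> dx; rewrite /M invA_K. Qed.

Let Mbd0 : exists c, forall x : X, enorm (M x) <= c * `|x|.
Proof.
have [[c c0 hc] _] := hadm; exists (c * (k / nu + 1)) => x.
have [d e] := invA_P x; apply: le_trans (hc _ d) _.
by rewrite e -mulrA ler_pM2l// mulrDl mul1r lerD2r invA_bd.
Qed.

Lemma M_bd x : enorm (M x) <= mu * `|x|.
Proof.
have [c hc] := Mbd0; apply: (opnorm_bound _ _ _ M_lin hc) => //.
- by move=> a y; rewrite normrZ.
- exact: enormZ.
Qed.

Lemma F_lin : linear F.
Proof. by move=> a u v; rewrite /F BKlin scalerDr !scalerA mulrC. Qed.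

Lemma F_bd v : `|F v| <= ki * bet * enorm v.
Proof.
rewrite /F normrZ gtr0_norm// -mulrA ler_pM2l//.
have [c hc] := BKbd; apply: (opnorm_bound _ _ _ BKlin hc) => //.
- exact: enorm_ge0.
- exact: enormZ.
- by move=> a y; rewrite normrZ.
Qed.

(** [Ki] is the inverse of the matrix of [v |-> M (B v)], which is a unit by the rank condition. *)
Lemma M_F v : M (F v) = ki *: v.
Proof.
rewrite /F (linpZ M_lin); congr (_ *: _).
have lin : linear (fun w => M (B w)) by move=> a u w; rewrite linearD linearZ M_lin.
have U : dc_gain A B C \in unitmx by rewrite -row_free_unit /row_free hrank.
by rewrite -(mx_of_lin lin) -/(dc_gain A B C) /Ki mulmxA mulmxV// mul1mx.
Qed.

(** [ki_star] is positive, so its denominator is too, division by 0 giving 0; then [1 <= k] replaces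
    [k ^+ 2] by [k] in the bound on [ki]. *)
Let mubet : [/\ 0 < mu, 0 < bet & ki * (k * bet * mu) < nu].
Proof.
have [c hc] := BKbd; have [c' hc'] := Mbd0.
have bet0 : 0 <= bet.
  by apply: (opnorm_ge0 _ _ _ hc); [exact: enorm_ge0|move=> u; exact: normr_ge0|exact: enormZ].
have mu0 : 0 <= mu.
  apply: (opnorm_ge0 _ _ _ hc'); [by move=> u; exact: normr_ge0|exact: enorm_ge0|].
  by move=> a u; rewrite normrZ.
have D0 : 0 < mu * k ^+ 2 * bet.
  have := ks_gt0; rewrite /ki_star -/(Ki A B C) -/bet -/mu pmulr_rgt0// invr_gt0.
  by [].
have k20 : 0 < k ^+ 2 by rewrite exprn_gt0.
have mup : 0 < mu by rewrite lt_def mu0 andbT; apply: contraTneq D0 => ->; rewrite !mul0r ltxx.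
have betp : 0 < bet by rewrite lt_def bet0 andbT; apply: contraTneq D0 => ->; rewrite mulr0 ltxx.
split => //; have := hki; rewrite /ki_star -/(Ki A B C) -/bet -/mu ltr_pdivlMr//.
apply: le_lt_trans; rewrite ler_pM2l//.
have -> : mu * k ^+ 2 * bet = k * (k * bet * mu) by ring.
by rewrite ler_peMl// !mulr_ge0// ltW.
Qed.

(** The case [w = 0], [yref = 0], to which a shift by the equilibrium reduces. Formally [(z - M
    phi)' = C phi - M (A phi + F z) = - ki z], so that neither [C] nor [dom A] has to be
    mentioned. *)
Definition cl_sol p := [/\ cont0 (fun t => (p t).1), cont0 (fun t => (p t).2),
  forall t, 0 <= t -> mild_der S (fun s => F (p s).2) (fun s => (p s).1) t &
  forall t, 0 <= t -> rder (fun s => (p s).2 - M (p s).1) t (- (ki *: (p t).2))].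

Lemma M_bd_mx x : `|M x| <= mu * `|x|.
Proof. exact: le_trans (mxnorm_le_enorm _) (M_bd x). Qed.

Lemma F_bd_mx v : `|F v| <= ki * bet * m%:R * `|v|.
Proof.
apply: le_trans (F_bd v) _; rewrite -!mulrA ler_pM2l//.
by case: mubet => _ b0 _; rewrite ler_pM2l// enorm_le_mxnorm.
Qed.

Lemma cont0_M f : cont0 f -> cont0 (fun t => M (f t)).
Proof. exact: (cont0_lin M_lin M_bd_mx). Qed.

Lemma cl_exists (p0 : X * 'cV[R]_m) : exists p, p 0 = p0 /\ cl_sol p.
Proof.
case: mubet => mu0 bet0 _.
(* In the variables [(phi, eta)] the free evolution is [S t] on [phi] and the identity on [eta]; the
   rest is the bounded map [K], with [z] written as [eta + M phi]. *)
pose T t (x : X * 'cV[R]_m) := (S t x.1, x.2).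
pose K (x : X * 'cV[R]_m) := (F (x.2 + M x.1), - (ki *: (x.2 + M x.1))).
have n1 (x : X * 'cV[R]_m) : `|x.1| <= `|x|.
  by have := lexx `|x|; rewrite {1}prod_norm_le => /andP[].
have n2 (x : X * 'cV[R]_m) : `|x.2| <= `|x|.
  by have := lexx `|x|; rewrite {1}prod_norm_le => /andP[].
pose c := 1 + mu.
have c0 : 0 < c by rewrite /c; lra.
have zbd (x : X * 'cV[R]_m) : `|x.2 + M x.1| <= c * `|x|.
  apply: le_trans (ler_normD _ _) _; rewrite mulrDl mul1r; apply: lerD => //.
  by apply: le_trans (M_bd_mx _) _; rewrite ler_pM2l.
pose kap := (ki * bet * m%:R + ki) * c.
have bm : 0 <= ki * bet * m%:R by rewrite !mulr_ge0// ltW.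
have kap0 : 0 < kap by rewrite mulr_gt0// ltr_wpDl.
have Tlin t : 0 <= t -> linear (T t).
  by move=> t0 a x y; rewrite /T /= (sg_lin hS t0).
have T00 (x : X * 'cV[R]_m) : T 0 x = x by rewrite /T (sg0 hS); case: x.
have TD s t (x : X * 'cV[R]_m) : 0 <= s -> 0 <= t -> T (s + t) x = T s (T t x).
  by move=> s0 t0; rewrite /T /= (sgD hS).
have Tbd t (x : X * 'cV[R]_m) : 0 <= t -> `|T t x| <= k * `|x|.
  move=> t0; rewrite prod_norm_le /=; apply/andP; split.
    by apply: le_trans (sg_bd k1 nu0 hexp _ t0) _; rewrite ler_pM2l.
  by apply: le_trans (n2 x) _; rewrite ler_peMl.
have Tc (x : X * 'cV[R]_m) e : 0 < e -> exists2 d, 0 < d & forall h, 0 <= h -> h < d -> `|T h x - x| <= e.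
  move=> e0; have [d d0 hd] := sg_cont hS x.1 e0; exists d => // h h0 hhd.
  by rewrite prod_norm_le /= subrr normr0 (ltW e0) andbT hd.
have Klin : linear K.
  move=> a x y; rewrite /K /= M_lin.
  have -> : a *: x.2 + y.2 + (a *: M x.1 + M y.1) = a *: (x.2 + M x.1) + (y.2 + M y.1).
    by rewrite addrACA scalerDr.
  by rewrite F_lin; congr (_, _) => /=; rewrite scalerDr opprD !scalerA scalerN scalerA (mulrC ki).
have Kbd (x : X * 'cV[R]_m) : `|K x| <= kap * `|x|.
  rewrite prod_norm_le /= /kap -mulrA.
  have z0 := zbd x; have cx : 0 <= c * `|x| by rewrite mulr_ge0// ltW.
  apply/andP; split.
    apply: le_trans (F_bd_mx _) _; apply: le_trans (ler_wpM2l bm z0) _.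
    by rewrite ler_wpM2r// lerDl ltW.
  rewrite normrN normrZ (gtr0_norm ki0).
  by apply: le_trans (ler_wpM2l (ltW ki0) z0) _; rewrite ler_wpM2r// lerDr.
have [u [u0 cu mu_]] := @perturbed_exists R _ T k k1 Tlin T00 TD Tbd Tc
  (prod_primitives primX (mx_primitives (m := m)))
  (prod_seq_complete (@complete_seq_complete R X) (mx_seq_complete (m := m)))
  K kap kap0 Klin Kbd (p0.1, p0.2 - M p0.1).
have c1 := cont0_fst cu; have c2 := cont0_snd cu.
exists (fun t => ((u t).1, (u t).2 + M (u t).1)); split.
  by rewrite u0 /= subrK -surjective_pairing.
split => /=.
- exact: c1.
- by apply: cont0D => //; exact: cont0_M.
- move=> t t0 e e0; have [d d0 hd] := mu_ t t0 e e0; exists d => // h h0 /(hd h h0).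
  by rewrite prod_norm_le => /andP[].
- move=> t t0 e e0; have [d d0 hd] := mu_ t t0 e e0; exists d => // h h0 /(hd h h0).
  by rewrite prod_norm_le => /andP[_ /=]; rewrite !addrK.
Qed.

Lemma cl_solD c p q : cl_sol p -> cl_sol q -> cl_sol (fun t => c *: p t + q t).
Proof.
move=> [p1 p2 p3 p4] [q1 q2 q3 q4]; split => /=.
- by apply: cont0D => //; exact: cont0Z.
- by apply: cont0D => //; exact: cont0Z.
- move=> t t0; have := mild_der_lin (sg_lin hS) c t0 (p3 t t0) (q3 t t0).
  by congr mild_der; apply: funext => s; rewrite F_lin.
- move=> t t0; have := rderD (rderZ c (p4 t t0)) (q4 t t0).
  have -> : c *: - (ki *: (p t).2) - ki *: (q t).2 = - (ki *: (c *: (p t).2 + (q t).2)).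
    by rewrite scalerN scalerDr opprD !scalerA (mulrC c).
  suff -> : (fun s => c *: (p s).2 + (q s).2 - M (c *: (p s).1 + (q s).1)) =
    (fun s => c *: ((p s).2 - M (p s).1) + ((q s).2 - M (q s).1)) by [].
  by apply: funext => s; rewrite M_lin scalerBr opprD addrACA.
Qed.

Lemma cl_shift c p : 0 <= c -> cl_sol p -> cl_sol (fun t => p (t + c)).
Proof.
move=> c0 [p1 p2 p3 p4].
have csh (V : normedModType R) (f : R -> V) : cont0 f -> cont0 (fun t => f (t + c)).
  move=> cf t t0 e e0; have [d d0 hd] := cf (t + c) (addr_ge0 t0 c0) e e0.
  exists d => // s s0 sd; apply: hd; first exact: addr_ge0.
  by have -> : s + c - (t + c) = s - t by ring.
split => [||t t0 e e0|t t0 e e0]; [exact: (csh _ (fun t => (p t).1))|exact: (csh _ (fun t => (p t).2))| |].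
- have [d d0 hd] := p3 (t + c) (addr_ge0 t0 c0) e e0; exists d => // h h0 /(hd h h0).
  by rewrite (addrAC t).
- have [d d0 hd] := p4 (t + c) (addr_ge0 t0 c0) e e0; exists d => // h h0 /(hd h h0).
  by rewrite (addrAC t).
Qed.

Definition lyap (x : X * 'cV[R]_m) :=
  snorm S nu x.1 ^+ 2 + k * bet / mu * edot (x.2 - M x.1) (x.2 - M x.1).

Let qq0 : 0 < k * bet / mu.
Proof. by case: mubet => ? ? _; rewrite divr_gt0// mulr_gt0. Qed.

Lemma lyap_ge0 (x : X * 'cV[R]_m) : 0 <= lyap x.
Proof. by rewrite addr_ge0 ?sqr_ge0// mulr_ge0 ?edot_ge0// ltW. Qed.

(** The largest [dl] allowed by the two conditions of [lyapunov_ineq]; [lyap], being quadratic,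
    decays at twice this rate. *)
Definition rate := Num.min ((nu - ki * (k * bet * mu)) / (1 + 8 * (k * bet * mu))) (ki / 2).

Lemma rate_gt0 : 0 < rate.
Proof.
case: mubet => m0 b0 lt; have p0 : 0 < k * bet * mu by rewrite !mulr_gt0.
by rewrite lt_min !divr_gt0 ?subr_gt0//; lra.
Qed.

Lemma lyap_decay p t : cl_sol p -> 0 <= t -> lyap (p t) <= expR (- (2 * rate) * t) * lyap (p 0).
Proof.
move=> [p1 p2 p3 p4] t0; case: mubet => mu0 bet0 lt.
have r0 := rate_gt0.
apply: (dini_exp_decay (w := fun t => lyap (p t))) => //; first by rewrite mulr_ge0// ltW.
- apply: cont0D; first exact/cont0_sqr/(cont0_snorm hS hexp).
  apply: cont0Z; under eq_fun do rewrite -sqr_enorm.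
  by apply/cont0_sqr/cont0_enorm/cont0B => //; exact: cont0_M.
- by move=> s; exact: lyap_ge0.
- move=> s s0.
  set a := snorm S nu (p s).1; set Z := enorm (p s).2; set eta := (p s).2 - M (p s).1.
  have d1 : dini (fun s => snorm S nu (p s).1 ^+ 2) s (2 * a * (- nu * a + k * (ki * bet * Z))).
    apply: dini_sqr => [r|]; first exact: (snorm_ge0 hS hexp).
    by apply: (mild_der_dini_snorm hS k1 hexp (F_bd _)); exact: p3.
  have d2 := diniZ (ltW qq0) (rder_dini_edot (p4 s s0)).
  apply: dini_le (diniD d1 d2).
  have Mphi : enorm (M (p s).1) <= mu * a.
    by apply: le_trans (M_bd _) _; rewrite ler_pM2l// (norm_le_snorm hS hexp).
  (* Substitute [eta = z - M phi] and bound the term [ki * edot (M phi) z] by Cauchy-Schwarz. *)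
  have q1 : edot eta (- (ki *: (p s).2)) <= - ki * Z ^+ 2 + ki * (mu * a * Z).
    rewrite (ipNr edotC edot_lin) (ipZr edotC edot_lin) /eta (ipBl edot_lin) sqr_enorm.
    have q2 : edot (M (p s).1) (p s).2 <= mu * a * Z.
      apply: le_trans (ler_norm _) _; apply: le_trans (edot_le _ _) _.
      by rewrite ler_wpM2r ?enorm_ge0.
    have := ler_wpM2l (ltW ki0) q2; lra.
  rewrite /lyap -/eta -/a -(sqr_enorm eta).
  apply: (@le_trans _ _ (2 * a * (- nu * a + k * (ki * bet * Z)) +
    k * bet / mu * (2 * (- ki * Z ^+ 2 + ki * (mu * a * Z))))).
    by rewrite lerD2l ler_pM2l// ler_pM2l.
  have p0 : 0 < k * bet * mu by rewrite !mulr_gt0.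
  apply: lyapunov_ineq => //; try exact: enorm_ge0.
  - exact: (snorm_ge0 hS hexp).
  - by apply: le_trans (enormB _ _) _; rewrite lerD2l.
  - by rewrite -ler_pdivlMr; [rewrite ge_min lexx|lra].
  - by rewrite mulrC -ler_pdivlMr// ge_min lexx orbT.
Qed.

(** * The inverse of the closed-loop operator *)

Local Notation Ae := (closed_loop A B C ki).
Local Notation V := (X * 'cV[R]_m)%type.

(** To solve [A phi + F z = x.1], [C phi = x.2], apply [M] to the first equation: since
    [M (F z) = ki *: z] it reads [x.2 + ki *: z = M x.1], which gives [z], then [phi]. *)
Definition cl_inv (x : V) : V :=
  let z := ki^-1 *: (M x.1 - x.2) in (invA (x.1 - F z), z).
Local Notation Re := cl_inv.

Lemma cl_invP (x : V) : dom A (Re x).1 /\ Ae (Re x) = x.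
Proof.
rewrite /closed_loop /= /Re /=; set z := ki^-1 *: _.
have [d e] := invA_P (x.1 - F z); split => //.
rewrite -/(F z) e subrK (obs_domA d) e (linpB M_lin) M_F /z scalerA mulfV ?gt_eqF//.
by rewrite scale1r opprB addrC subrK -surjective_pairing.
Qed.

Lemma cl_invK (x : V) : dom A x.1 -> Re (Ae x) = x.
Proof.
move=> d; rewrite /closed_loop /= /Re /= -/(F x.2) (obs_domA d) (linpD M_lin) M_F.
rewrite (addrC (M (A x.1))) addrK scalerA mulVf ?gt_eqF// scale1r addrK invA_K//.
by rewrite -surjective_pairing.
Qed.

Lemma cl_inv_lin : linear Re.
Proof.
move=> a x y; rewrite /Re /= M_lin.
set zx := ki^-1 *: (M x.1 - x.2); set zy := ki^-1 *: (M y.1 - y.2).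
have -> : ki^-1 *: (a *: M x.1 + M y.1 - (a *: x.2 + y.2)) = a *: zx + zy.
  rewrite /zx /zy scalerA mulrC -scalerA -scalerDr; congr (_ *: _).
  by rewrite opprD addrACA -scalerBr.
congr (_, _); rewrite F_lin -invA_lin; congr (invA _).
by rewrite opprD addrACA -scalerBr.
Qed.

Lemma cl_inv_bd : exists c, forall x : V, `|Re x| <= c * `|x|.
Proof.
case: mubet => mu0 bet0 _.
pose c1 := ki^-1 * (mu + 1); have c10 : 0 <= c1.
  by rewrite mulr_ge0 ?invr_ge0 ?(ltW ki0)//; lra.
pose c2 := k / nu * (1 + ki * bet * m%:R * c1).
have bm : 0 <= ki * bet * m%:R by rewrite !mulr_ge0// ltW.
have kn : 0 <= k / nu by rewrite divr_ge0// ltW.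
have c20 : 0 <= c2 by rewrite mulr_ge0// addr_ge0// mulr_ge0.
exists (c1 + c2) => x.
have [n1 n2] : `|x.1| <= `|x| /\ `|x.2| <= `|x|.
  by apply/andP; have := lexx `|x|; rewrite {1}prod_norm_le.
rewrite /Re /=; set z := ki^-1 *: _.
have hz : `|z| <= c1 * `|x|.
  rewrite normrZ gtr0_norm ?invr_gt0// -mulrA ler_pM2l ?invr_gt0//.
  apply: le_trans (ler_normB _ _) _; rewrite mulrDl mul1r lerD//.
  by apply: le_trans (M_bd_mx _) _; rewrite ler_pM2l.
rewrite prod_norm_le /=; apply/andP; split; last first.
  by apply: le_trans hz _; rewrite ler_wpM2r// lerDl.
apply: le_trans (invA_bd _) _; apply: (@le_trans _ _ (c2 * `|x|)); last first.
  by rewrite ler_wpM2r// lerDr.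
rewrite /c2 -[leRHS]mulrA ler_wpM2l// mulrDl mul1r; apply: le_trans (ler_normB _ _) _.
apply: lerD => //; apply: le_trans (F_bd_mx _) _.
by rewrite -[leRHS]mulrA ler_wpM2l.
Qed.

(** The second component of [Re p] is [- eta / ki], whose derivative is [z]; in the first one [A^-1]
    moves the state into [dom A], where the semigroup is differentiable and the mild equation
    becomes a derivative. *)
Lemma cl_sol_rder_inv p t : cl_sol p -> 0 <= t -> rder (fun s => Re (p s)) t (p t).
Proof.
move=> [p1 p2 p3 p4] t0.
have r2 : rder (fun s => (Re (p s)).2) t (p t).2.
  have := rderZ (- ki^-1) (p4 t t0).
  rewrite scaleNr scalerN opprK scalerA mulVf ?gt_eqF// scale1r.
  suff -> : (fun s => (Re (p s)).2) = (fun s => - ki^-1 *: ((p s).2 - M (p s).1)) by [].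
  by apply: funext => s; rewrite /Re /= scaleNr -scalerN opprB.
have r1 : rder (fun s => (Re (p s)).1) t (p t).1; last first.
  by have := rder_pair r1 r2; rewrite -surjective_pairing.
have invA_ler x : `|invA x| <= k / nu * `|x| := invA_bd x.
have ra : rder (fun s => invA (p s).1) t ((p t).1 + invA (F (p t).2)).
  move=> e e0; have kn : 0 < k / nu by rewrite divr_gt0.
  have [d1 d10 h1] := p3 t t0 (e / 2 / (k / nu)) ltac:(by rewrite !divr_gt0).
  have /(generatorP hA) /(_ (e / 2) ltac:(by rewrite divr_gt0))[d2 d20 h2] := invA_P (p t).1.
  exists (Num.min d1 d2); first by rewrite lt_min d10.
  move=> h h0; rewrite lt_min => /andP[/(h1 h h0) q1 /(h2 h h0)].
  rewrite (invA_sg _ (ltW h0)) => q2.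
  have -> : invA (p (t + h)).1 - invA (p t).1 - h *: ((p t).1 + invA (F (p t).2)) =
    invA ((p (t + h)).1 - S h (p t).1 - h *: F (p t).2) +
    (invA (S h (p t).1) - invA (p t).1 - h *: (p t).1).
    rewrite !(linpB invA_lin) (linpZ invA_lin h) scalerDr opprD.
    rewrite (addrC (- (h *: (p t).1))) !addrA; congr (_ - _).
    by rewrite -!addrA; congr (_ + _); rewrite [RHS]addrCA addKr addrC.
  apply: le_trans (ler_normD _ _) _.
  have := invA_ler ((p (t + h)).1 - S h (p t).1 - h *: F (p t).2).
  by move: q1; rewrite mulrAC ler_pdivlMr// => q1; lra.
have rb : rder (fun s => invA (F (Re (p s)).2)) t (invA (F (p t).2)).
  apply: (rder_lin invA_lin invA_bd (f := fun s => F (Re (p s)).2)).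
  exact: (rder_lin F_lin F_bd_mx (f := fun s => (Re (p s)).2)).
have := rderB ra rb; rewrite addrK.
suff -> : (fun s => (Re (p s)).1) = (fun s => invA (p s).1 - invA (F (Re (p s)).2)) by [].
by apply: funext => s; rewrite /Re /= (linpB invA_lin).
Qed.

(** On the domain [S h phi - phi] and [h *: A phi] agree to first order, which gives the mild
    equation; applying [M], with [C = M A] there, gives the one for [eta]. *)
Lemma classical_cl_sol p : cont0 p -> (forall t, 0 <= t -> dom A (p t).1) ->
  (forall t, 0 <= t -> rder p t (Ae (p t))) -> cl_sol p.
Proof.
move=> cp dp rp; have rp12 t : 0 <= t ->
    rder (fun s => (p s).1) t (Ae (p t)).1 /\ rder (fun s => (p s).2) t (Ae (p t)).2.
  move=> t0; split=> e e0; have [d d0 hd] := rp t t0 e e0;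
    by exists d => // h h0 /(hd h h0); rewrite prod_norm_le => /andP[].
split; [exact: cont0_fst|exact: cont0_snd| |].
- move=> t t0 e e0; have e2 : 0 < e / 2 by rewrite divr_gt0.
  have [/(_ _ e2) [d1 d10 h1] _] := rp12 t t0.
  have /(generatorP hA) /(_ _ e2)[d2 d20 h2] := conj (dp t t0) (erefl (A (p t).1)).
  exists (Num.min d1 d2); first by rewrite lt_min d10.
  move=> h h0; rewrite lt_min => /andP[/(h1 h h0) q1 /(h2 h h0) q2].
  have -> : (p (t + h)).1 - S h (p t).1 - h *: F (p t).2 =
    ((p (t + h)).1 - (p t).1 - h *: (Ae (p t)).1) - (S h (p t).1 - (p t).1 - h *: A (p t).1).
    rewrite /closed_loop /= -/(F (p t).2) scalerDr opprD addrA.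
    rewrite -(addrA (p (t + h)).1 (- (p t).1)) -(addrA (S h _)) -!opprD.
    by rewrite opprB addrACA subrK addrA addrAC.
  by apply: le_trans (ler_normB _ _) _; lra.
- move=> t t0; have [r1 r2] := rp12 t t0.
  have := rderB r2 (rder_lin M_lin M_bd_mx r1).
  rewrite /closed_loop /= -/(F (p t).2) (linpD M_lin) M_F (obs_domA (dp t t0)).
  by rewrite opprD addrA subrr add0r.
Qed.

Lemma lyap_eq0 (x : V) : lyap x <= 0 -> x = 0.
Proof.
move=> l0; have h1 := sqr_ge0 (snorm S nu x.1).
have h2 : 0 <= k * bet / mu * edot (x.2 - M x.1) (x.2 - M x.1).
  by rewrite mulr_ge0 ?edot_ge0// ltW.
rewrite /lyap in l0.
have /eqP : snorm S nu x.1 ^+ 2 = 0 by lra.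
rewrite sqrf_eq0 => /eqP s0.
have x1 : x.1 = 0 by apply/eqP; rewrite -normr_le0 -s0 (norm_le_snorm hS hexp).
have /eqP : k * bet / mu * edot (x.2 - M x.1) (x.2 - M x.1) = 0 by lra.
rewrite mulf_eq0 gt_eqF//= -sqr_enorm sqrf_eq0 => /eqP/enorm_eq0.
rewrite x1 (linp0 M_lin) subr0 => x2.
by rewrite [x]surjective_pairing x1 x2.
Qed.

(** [p] is not known to be a mild solution, so the decay is applied to [Re (p - q)], a classical
    solution starting from 0; the closed-loop operator then recovers [p - q = 0]. *)
Lemma cl_unique p q : cont0 p -> (forall t, 0 <= t -> rder (fun s => Re (p s)) t (p t)) ->
  cl_sol q -> p 0 = q 0 -> forall t, 0 <= t -> p t = q t.
Proof.
move=> cp rp sq pq t t0; have [cbd hc] := cl_inv_bd.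
have cq : cont0 q by case: sq => q1 q2 _ _; exact: cont0_pair.
pose d s := p s - q s.
have cd : cont0 d by exact: cont0B.
have rd s : 0 <= s -> rder (fun s => Re (d s)) s (d s).
  move=> s0; have := rderB (rp s s0) (cl_sol_rder_inv sq s0).
  suff -> : (fun s => Re (d s)) = (fun s => Re (p s) - Re (q s)) by [].
  by apply: funext => r; rewrite -(linpB cl_inv_lin).
have sd : cl_sol (fun s => Re (d s)).
  apply: classical_cl_sol.
  - exact: (cont0_lin cl_inv_lin hc).
  - by move=> s _; case: (cl_invP (d s)).
  - by move=> s s0; have [_ ->] := cl_invP (d s); exact: rd.
have d0 : Re (d 0) = 0 by rewrite /d pq subrr (linp0 cl_inv_lin).
have lyap0 : lyap 0 = 0.
  rewrite /lyap /= (linp0 M_lin) subr0 -sqr_enorm enorm0 expr0n mulr0 addr0.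
  suff -> : snorm S nu (0 : X) = 0 by rewrite expr0n.
  apply/eqP; rewrite eq_le (snorm_ge0 hS hexp) andbT.
  by have := snorm_le_norm hexp (0 : X); rewrite normr0 mulr0.
have Rd : Re (d t) = 0.
  by apply: lyap_eq0; have := lyap_decay sd t0; rewrite d0 lyap0 mulr0.
apply/eqP; rewrite -subr_eq0 -/(d t); apply/eqP.
have [_ <-] := cl_invP (d t); rewrite Rd /closed_loop /=.
have [dA0 A0] := cl_invP 0; rewrite (linp0 cl_inv_lin) in dA0 A0.
exact: A0.
Qed.

Lemma dotE_ge0 (x : V) : 0 <= dotE dot x x.
Proof. by rewrite /dotE -hX addr_ge0 ?sqr_ge0 ?edot_ge0. Qed.

Lemma sqr_normE (x : V) : normE dot x ^+ 2 = `|x.1| ^+ 2 + edot x.2 x.2.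
Proof. by rewrite /normE sqr_sqrtr ?dotE_ge0// /dotE hX. Qed.

Lemma normE_ge0 (x : V) : 0 <= normE dot x. Proof. exact: sqrtr_ge0. Qed.

(** With [normE_lyap], an equivalence: [snorm] is equivalent to the norm, and
    [(phi, z) |-> (phi, z - M phi)] is bounded with bounded inverse. *)
Lemma lyap_normE : exists2 c, 0 < c & forall x : V, lyap x <= c * normE dot x ^+ 2.
Proof.
case: mubet => mu0 bet0 _.
pose q := k * bet / mu.
exists (k ^+ 2 + 2 * q + 2 * q * mu ^+ 2).
  have := exprn_gt0 2 k0; have := exprn_gt0 2 mu0; have : 0 < q by [].
  by move=> q0 m0; have := mulr_gt0 q0 m0; lra.
move=> x; rewrite sqr_normE /lyap -/q.
have h1 : snorm S nu x.1 ^+ 2 <= k ^+ 2 * `|x.1| ^+ 2.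
  rewrite -exprMn ler_pXn2r ?nnegrE ?(snorm_ge0 hS hexp) ?mulr_ge0 ?(ltW k0)//.
  exact: (snorm_le_norm hexp).
have h2 : edot (x.2 - M x.1) (x.2 - M x.1) <= 2 * edot x.2 x.2 + 2 * (mu ^+ 2 * `|x.1| ^+ 2).
  rewrite -!sqr_enorm.
  have e1 : enorm (x.2 - M x.1) <= enorm x.2 + mu * `|x.1|.
    by apply: le_trans (enormB _ _) _; rewrite lerD2l M_bd.
  apply: (@le_trans _ _ ((enorm x.2 + mu * `|x.1|) ^+ 2)).
    by rewrite ler_pXn2r ?nnegrE ?enorm_ge0// (le_trans (enorm_ge0 _) e1).
  by have := sqr_ge0 (enorm x.2 - mu * `|x.1|); lra.
have h3 := ler_wpM2l (ltW qq0) h2; rewrite -/q in h3.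
have z0 := edot_ge0 x.2; have x0 := sqr_ge0 `|x.1|.
have g1 := mulr_ge0 (sqr_ge0 k) z0; have g2 := mulr_ge0 (ltW qq0) x0.
have g3 := mulr_ge0 (mulr_ge0 (ltW qq0) (sqr_ge0 mu)) z0; rewrite -/q in g2 g3.
lra.
Qed.

Lemma normE_lyap : exists2 c, 0 < c & forall x : V, normE dot x ^+ 2 <= c * lyap x.
Proof.
case: mubet => mu0 bet0 _.
pose q := k * bet / mu; have q0 : 0 < q by exact: qq0.
exists (1 + 2 * q^-1 + 2 * mu ^+ 2).
  have : 0 < q^-1 by rewrite invr_gt0.
  by have := exprn_gt0 2 mu0; lra.
move=> x; rewrite sqr_normE /lyap -/q.
set s := snorm S nu x.1; set E := edot (_ - _) _.
have s0 : 0 <= s by exact: (snorm_ge0 hS hexp).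
have h1 : `|x.1| ^+ 2 <= s ^+ 2 by rewrite ler_pXn2r ?nnegrE// (norm_le_snorm hS hexp).
have E0 : 0 <= E by exact: edot_ge0.
have h2 : edot x.2 x.2 <= 2 * E + 2 * (mu ^+ 2 * `|x.1| ^+ 2).
  rewrite /E -!sqr_enorm.
  have e1 : enorm x.2 <= enorm (x.2 - M x.1) + mu * `|x.1|.
    by rewrite -{1}(subrK (M x.1) x.2); apply: le_trans (enormD _ _) _; rewrite lerD2l M_bd.
  apply: (@le_trans _ _ ((enorm (x.2 - M x.1) + mu * `|x.1|) ^+ 2)).
    by rewrite ler_pXn2r ?nnegrE ?enorm_ge0// (le_trans (enorm_ge0 _) e1).
  by have := sqr_ge0 (enorm (x.2 - M x.1) - mu * `|x.1|); lra.
have h3 : 2 * q^-1 * (q * E) = 2 * E by field; rewrite gt_eqF.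
have h4 := ler_wpM2l (sqr_ge0 mu) h1.
have g1 := mulr_ge0 (ltW q0) E0.
have qi : 0 <= q^-1 by rewrite invr_ge0 ltW.
have g2 := mulr_ge0 qi (sqr_ge0 s).
have g3 := mulr_ge0 (sqr_ge0 mu) g1.
move: h3; move: (q^-1) g2 => qi' g2 h3.
lra.
Qed.

Lemma cl_normE_decay : exists2 ke, 0 < ke & forall p t, cl_sol p -> 0 <= t ->
  normE dot (p t) <= ke * expR (- rate * t) * normE dot (p 0).
Proof.
have [c1 c10 h1] := lyap_normE; have [c2 c20 h2] := normE_lyap.
exists (Num.sqrt (c1 * c2)); first by rewrite sqrtr_gt0 mulr_gt0.
move=> p t sp t0; apply: sqr_le_le.
  by rewrite !mulr_ge0 ?sqrtr_ge0 ?expR_ge0 ?normE_ge0.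
rewrite !exprMn (sqr_sqrtr (mulr_ge0 (ltW c10) (ltW c20))).
apply: le_trans (h2 _) _; have := lyap_decay sp t0.
have -> : expR (- (2 * rate) * t) = expR (- rate * t) ^+ 2.
  by rewrite expr2 -expRD; congr expR; ring.
move=> h3; apply: le_trans (ler_wpM2l (ltW c20) h3) _.
have := ler_wpM2l (sqr_ge0 (expR (- rate * t))) (h1 (p 0)).
move=> h4; have := ler_wpM2l (ltW c20) h4; lra.
Qed.

(** * Weak solutions *)

Lemma dotEC (x y : V) : dotE dot x y = dotE dot y x.
Proof. by rewrite /dotE dotC edotC. Qed.

Lemma dotE_lin c (x y u : V) : dotE dot (c *: x + y) u = c * dotE dot x u + dotE dot y u.
Proof. by rewrite /dotE /= dot_lin edot_lin; ring. Qed.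

Lemma norm_le_normE (x : V) : `|x| <= normE dot x.
Proof.
rewrite prod_norm_le; apply/andP; split; apply: sqr_le_le (normE_ge0 x) _; rewrite sqr_normE.
  by rewrite lerDl edot_ge0.
rewrite -sqr_enorm; apply: (@le_trans _ _ (enorm x.2 ^+ 2)).
  by rewrite ler_pXn2r ?nnegrE ?enorm_ge0// mxnorm_le_enorm.
by rewrite lerDr sqr_ge0.
Qed.

Lemma normE_le_norm (x : V) : normE dot x <= (1 + m%:R) * `|x|.
Proof.
have [n1 n2] : `|x.1| <= `|x| /\ `|x.2| <= `|x|.
  by apply/andP; have := lexx `|x|; rewrite {1}prod_norm_le.
have e2 : enorm x.2 <= m%:R * `|x|.
  by apply: le_trans (enorm_le_mxnorm _) _; rewrite ler_wpM2l.
have e0 := enorm_ge0 x.2; have x0 := normr_ge0 x.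
apply: sqr_le_le; first by rewrite mulr_ge0// addr_ge0.
rewrite sqr_normE -sqr_enorm.
apply: (@le_trans _ _ (`|x| ^+ 2 + (m%:R * `|x|) ^+ 2)).
  by rewrite lerD// ler_pXn2r ?nnegrE// (le_trans e0).
have mx : 0 <= m%:R * `|x| by rewrite mulr_ge0.
rewrite mulrDl mul1r; have := mulr_ge0 mx x0; move: (m%:R * `|x|) => w; lra.
Qed.

Lemma dotE_le (x y : V) : `|dotE dot x y| <= normE dot x * normE dot y.
Proof. exact: (cauchy_schwarz dotEC dotE_lin dotE_ge0). Qed.

Lemma dotE_linear (u : V) : linear_for *%R (fun x => dotE dot x u).
Proof. by move=> c x y; exact: dotE_lin. Qed.

Lemma dotE_bd (u x : V) : `|dotE dot x u| <= ((1 + m%:R) * normE dot u) * `|x|.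
Proof.
apply: le_trans (dotE_le _ _) _; rewrite mulrAC ler_wpM2r ?normE_ge0//.
exact: normE_le_norm.
Qed.

(** Riesz on [X], coordinates on the columns. The vectors [psi] obtained are the test vectors whose
    image under the adjoint of the closed loop is any prescribed [chi]. *)
Lemma cl_inv_adjoint (chi : V) : exists psi, forall x, dotE dot (Re x) chi = dotE dot x psi.
Proof.
have [c hc] := cl_inv_bd.
pose L x := dotE dot (Re x) chi.
have Llin a (x y : V) : L (a *: x + y) = a * L x + L y.
  by rewrite /L cl_inv_lin dotE_lin.
have [||psi1 P1] := @riesz R X dot hX (fun g => L (g, 0)) ((1 + m%:R) * normE dot chi * `|c|).
- move=> a x y; rewrite -Llin; congr L.
  by apply: injective_projections => //=; rewrite scaler0 addr0.
- move=> g; apply: le_trans (dotE_bd _ _) _; rewrite -[leRHS]mulrA ler_wpM2l//.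
    by rewrite mulr_ge0 ?normE_ge0// addr_ge0.
  apply: le_trans (hc _) _; apply: le_trans (ler_wpM2r (normr_ge0 _) (ler_norm c)) _.
  by rewrite ler_wpM2l// prod_norm_le /= lexx normr0 normr_ge0.
pose psi2 := \col_i L (0, delta_mx i 0).
have P2 (y : 'cV[R]_m) : L (0, y) = edot psi2 y.
  pose f v : 'cV[R]_1 := const_mx (L (0, v)).
  have flin : linear f.
    move=> a u v; apply/matrixP => i j; rewrite !mxE -Llin; congr L.
    by apply: injective_projections => //=; rewrite scaler0 addr0.
  have := congr1 (fun M : 'cV[R]_1 => M 0 0) (mx_of_lin flin y).
  by rewrite /f !mxE => <-; rewrite edotE; apply: eq_bigr => i _; rewrite !mxE.
exists (psi1, psi2) => x.
have -> : dotE dot (Re x) chi = L (1 *: (x.1, 0) + (0, x.2)).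
  rewrite /L; congr (dotE dot (Re _) _).
  by apply: injective_projections => /=; rewrite scale1r ?addr0 ?add0r.
by rewrite Llin mul1r P1 P2 /dotE /= dotC edotC.
Qed.

(** By density of [dom A] the adjoint is single-valued, which identifies the representative selected
    in [adjointE]. *)
Lemma dom_cl_dense (chi chi' : V) :
  (forall x, dom A x.1 -> dotE dot x chi = dotE dot x chi') -> chi = chi'.
Proof.
move=> H; pose u := chi - chi'.
have u0 x : dom A x.1 -> dotE dot x u = 0.
  by move=> dx; rewrite (ipBr dotEC dotE_lin) H// subrr.
suff u_small : normE dot u <= 0.
  apply/eqP; rewrite -subr_eq0 -/u -normr_le0.
  exact: le_trans (norm_le_normE u) u_small.
apply/ler_addgt0Pr => e e0; rewrite add0r.
have [y dy yu] := gen_dense hS hA k1 nu0 hexp primX u.1 e0.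
have h : normE dot u ^+ 2 = dotE dot (u - (y, u.2)) u.
  by rewrite (ipBl dotE_lin) (u0 (y, u.2))// subr0 /normE sqr_sqrtr ?dotE_ge0.
have n : normE dot (u - (y, u.2)) <= e.
  apply: sqr_le_le (ltW e0) _; rewrite sqr_normE /= subrr -sqr_enorm enorm0 expr0n addr0.
  by rewrite ler_pXn2r ?nnegrE ?(ltW e0)// distrC.
have [->|nu_] := eqVneq (normE dot u) 0; first exact: ltW.
have np : 0 < normE dot u by rewrite lt_def nu_ normE_ge0.
rewrite -(ler_pM2r np) -expr2 h; apply: le_trans (ler_norm _) _.
by apply: le_trans (dotE_le _ _) _; rewrite ler_pM2r.
Qed.

Variables (w : X) (yref : 'cV[R]_m).
Let f := (w, - yref) : V.
Definition cl_eq : V := - Re f.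

Lemma cl_eqP : dom A cl_eq.1 /\ Ae cl_eq = - f.
Proof.
have [d e] := cl_invP (- f); rewrite /cl_eq -(linpN cl_inv_lin); split => //.
Qed.

Lemma cl_equilibrium : equilibrium Ae f cl_eq.
Proof. by have [d e] := cl_eqP; split => //; rewrite e addNr. Qed.

(** Write [p = Ae (Re p)] and move [Ae] to the test vector: up to a constant, the pairing with [psi]
    is that of [Re p] with [chi], continuously differentiable with derivative the pairing of [p]
    with [chi]. The equilibrium cancels [f]. *)
Lemma weak_of_cl p : cl_sol p -> weak_solution dot Ae f (fun t => p t + cl_eq).
Proof.
move=> sp; have cp : cont0 p by case: sp => ? ? _ _; exact: cont0_pair.
split; first by apply: cont0_within; apply: cont0D => //; exact: cont0_cst.
move=> psi [chi0 hchi0]; set chi := adjointE dot Ae psi.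
have hchi x : dom A x.1 -> dotE dot (Ae x) psi = dotE dot x chi.
  rewrite /chi /=; case: xgetP => [_ -> H dx|]; first exact: (H x dx).
  by move=> /(_ chi0) /(_ hchi0).
pose g t := dotE dot (Re (p t)) chi + dotE dot cl_eq psi.
have gE t : dotE dot (p t + cl_eq) psi = g t.
  rewrite (ipDl dotE_lin) /g; have [d e] := cl_invP (p t).
  by rewrite -{1}e hchi.
have [c hc] := cl_inv_bd.
have cg : cont0 g.
  apply: cont0D; last exact: cont0_cst.
  apply: (cont0_lin (dotE_linear chi) (dotE_bd chi) (f := fun t => Re (p t))).
  exact: (cont0_lin cl_inv_lin hc).
have rg t : 0 <= t -> rder g t (dotE dot (p t) chi).
  move=> t0; rewrite -[dotE dot (p t) chi]addr0; apply: rderD; last exact: rder_cst.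
  apply: (rder_lin (dotE_linear chi) (dotE_bd chi) (f := fun t => Re (p t))).
  exact: cl_sol_rder_inv.
have cdg : cont0 (fun t => dotE dot (p t) chi).
  exact: (cont0_lin (dotE_linear chi) (dotE_bd chi)).
have -> : (fun t => dotE dot (p t + cl_eq) psi) = g by apply: funext.
split=> [b b0|].
  have [l l0 hl] := cont0_bounded b cdg.
  apply: (lipschitz_ac l0) => s t s0 st tb.
  apply: (mvi_rder (f := fun t => dotE dot (p t) chi)) => // r sr rt.
    by apply: rg; exact: le_trans s0 sr.
  by apply: hl; lra.
have dg (t : R) (t0 : 0 < t) := rder_is_derive cg cdg rg t0.
apply: aeW => t t0.
have -> : dotE dot (p t + cl_eq) chi + dotE dot f psi = dotE dot (p t) chi.
  rewrite (ipDl dotE_lin); have [d e] := cl_eqP.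
  by rewrite -(hchi _ d) e (ipNl dotE_lin) subrK.
exact: dg.
Qed.

Lemma ac_sub_linear (F0 : R -> R) b c : absolutely_continuous 0 b F0 ->
  absolutely_continuous 0 b (fun s => F0 s - c * s).
Proof.
move=> aF e e0; have e2 : 0 < e / 2 by rewrite divr_gt0.
have [d d0 hd] := aF _ e2; have c1 : 0 < `|c| + 1 by rewrite ltr_wpDl.
exists (Num.min d (e / 2 / (`|c| + 1))); first by rewrite lt_min d0 !divr_gt0.
move=> n u v h1 h2; rewrite lt_min => /andP[/(hd n u v h1 h2) q1].
rewrite ltr_pdivlMr// => q2.
apply: (@le_lt_trans _ _ (\sum_(i < n) (`|F0 (v i) - F0 (u i)| + `|c| * (v i - u i)))).
  apply: ler_sum => i _; have [_ uv _] := h1 i (ltn_ord i).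
  have -> : F0 (v i) - c * v i - (F0 (u i) - c * u i) =
    (F0 (v i) - F0 (u i)) - c * (v i - u i) by ring.
  apply: le_trans (ler_normB _ _) _.
  by rewrite normrM (ger0_norm (_ : 0 <= v i - u i)) ?subr_ge0.
rewrite big_split/= -mulr_sumr.
have : 0 <= \sum_(i < n) (v i - u i).
  by apply: sumr_ge0 => i _; have [_ uv _] := h1 i (ltn_ord i); rewrite subr_ge0.
move: q1 q2; move: (\sum_(i < n) (v i - u i)) => W q1 q2 W0.
have : `|c| * W <= W * (`|c| + 1) by rewrite mulrC ler_wpM2l// lerDl.
lra.
Qed.

(** The increments of the pairings with [Re p] are controlled by [ac_mean_value], uniformly in the
    direction of [chi]; testing against the remainder itself gives a derivative in norm. *)
Lemma weak_rder phi : weak_solution dot Ae f phi ->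
  cont0 (fun t => phi t - cl_eq) /\
  forall t, 0 <= t -> rder (fun s => Re (phi s - cl_eq)) t (phi t - cl_eq).
Proof.
move=> [cphi wphi]; have cp : cont0 (fun t => phi t - cl_eq).
  by apply: cont0B; [exact: continuous_cont0|exact: cont0_cst].
split => // t t0; pose p s := phi s - cl_eq; rewrite -/(p t).
have [cb hcb] := cl_inv_bd.
have cRp : cont0 (fun s => Re (p s)) by exact: (cont0_lin cl_inv_lin hcb).
(* weak form of [(Re p)' = p], tested against an arbitrary [chi] *)
have test chi e b : 0 <= e -> t < b ->
    (forall s, t <= s -> s <= b -> normE dot (p s - p t) <= e) ->
    `|dotE dot (Re (p b) - Re (p t) - (b - t) *: p t) chi| <= e * normE dot chi * (b - t).
  move=> e0 tb H; have [psi hpsi] := cl_inv_adjoint chi.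
  have chiP x : dom A x.1 -> dotE dot (Ae x) psi = dotE dot x chi.
    by move=> dx; rewrite -hpsi cl_invK.
  have dpsi : dom (adjointE dot Ae) psi by exists chi => x /= dx; exact: chiP.
  have chiE : adjointE dot Ae psi = chi.
    apply: dom_cl_dense => x dx; rewrite -chiP//=; case: xgetP => [u -> Hu|].
      by rewrite -(Hu x dx).
    by move=> /(_ chi) H'; exfalso; apply: H' => y /= dy; exact: chiP.
  have [ac ae_] := wphi psi dpsi; rewrite chiE in ae_.
  pose l := dotE dot (p t) chi.
  pose G s := dotE dot (phi s) psi - l * s.
  (* Restricted to [a > 0], the weak equation giving derivatives at positive times only. *)
  have main a : 0 < a -> t <= a -> a < b -> `|G b - G a| <= e * normE dot chi * (b - a).
    move=> a0 ta ab.
    apply: (@ac_mean_value R G (fun s => dotE dot (p s - p t) chi)) => //; first exact: ltW.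
    - by apply: ac_sub_linear; apply: ac; lra.
    - have pt (s : R) : is_derive s 1 (fun s : R => dotE dot (phi s) psi)
          (dotE dot (phi s) chi + dotE dot f psi) ->
          is_derive s 1 G (dotE dot (p s - p t) chi).
        move=> H1; have H2 : is_derive s 1 (fun s : R => l * s) l.
          apply/is_deriveP => e' e'0; exists 1 => // h _.
          by rewrite mulrDr (addrC (l * s)) addrK mulrC subrr normr0 mulr_ge0// ltW.
        have -> : dotE dot (p s - p t) chi = dotE dot (phi s) chi + dotE dot f psi - l.
          rewrite (ipBl dotE_lin) -/l /p (ipBl dotE_lin) -hpsi; congr (_ + _ - _).
          by rewrite /cl_eq (ipNl dotE_lin) opprK.
        exact: is_deriveB.
      by apply: negligibleS ae_ => s /=; apply: contra_not => Hs s0; exact/pt/Hs.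
    - move=> s sa sb; apply: le_trans (dotE_le _ _) _.
      by rewrite ler_wpM2r ?normE_ge0// H//; lra.
  have GE s r : G s - G r = dotE dot (Re (p s) - Re (p r) - (s - r) *: p t) chi.
    rewrite (ipBl dotE_lin) (ipZl dotE_lin) -(linpB cl_inv_lin) hpsi -/l.
    have -> : p s - p r = phi s - phi r by rewrite /p opprB addrA subrK.
    by rewrite /G (ipBl dotE_lin); ring.
  rewrite -GE; apply/ler_addgt0Pr => e' e'0.
  have cG : cont0 G.
    apply: cont0B; last by have := @cont0Z R R id l; apply => r r0 e1 e10; exists e1 => // s _ /ltW.
    by apply: (cont0_lin (dotE_linear psi) (dotE_bd psi)); exact: continuous_cont0.
  have [d d0 hd] := cG t t0 _ e'0.
  (* A point just to the right of [t], within the continuity radius of [G]: it carries the estimate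
     down to [t], which may be 0. *)
  pose a := t + Num.min (d / 2) ((b - t) / 2).
  have m0 : 0 < Num.min (d / 2) ((b - t) / 2) by rewrite lt_min !divr_gt0// subr_gt0.
  have ma : Num.min (d / 2) ((b - t) / 2) <= d / 2 by rewrite ge_min lexx.
  have mb : Num.min (d / 2) ((b - t) / 2) <= (b - t) / 2 by rewrite ge_min lexx orbT.
  have h1 := main a ltac:(rewrite /a; lra) ltac:(rewrite /a; lra) ltac:(rewrite /a; lra).
  have h2 : `|G a - G t| <= e'.
    by apply: hd; [rewrite /a; lra|rewrite ger0_norm /a; lra].
  apply: le_trans (ler_distD (G a) _ _) _; apply: lerD => //; apply: le_trans h1 _.
  by rewrite ler_wpM2l ?mulr_ge0 ?normE_ge0//; rewrite /a; lra.
move=> e e0; have m1 : 0 < 1 + m%:R :> R by rewrite ltr_pwDl.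
have [d d0 hd] := cp t t0 (e / (1 + m%:R)) ltac:(by rewrite divr_gt0).
exists d => // h h0 hhd; apply: le_trans (norm_le_normE _) _.
set u := Re (p (t + h)) - Re (p t) - h *: p t.
rewrite -/(p (t + h)) -/(p t) -/u.
(* The test vector is the remainder [u]; one factor [normE dot u] is then divided out. *)
have := test u e (t + h) (ltW e0) ltac:(lra).
have -> : t + h - t = h by ring.
rewrite -/u => /(_ _) H.
have {H} : `|dotE dot u u| <= e * normE dot u * h.
  apply: H => s ts sth; apply: le_trans (normE_le_norm _) _.
  rewrite mulrC -ler_pdivlMr//; have := hd s ltac:(lra).
  by apply; rewrite ger0_norm; lra.
rewrite ger0_norm ?dotE_ge0// => H.
have [->|nu_] := eqVneq (normE dot u) 0; first by rewrite mulr_ge0// ltW.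
have np : 0 < normE dot u by rewrite lt_def nu_ normE_ge0.
rewrite -(ler_pM2r np) -expr2 /normE sqr_sqrtr ?dotE_ge0//.
by rewrite mulrAC; exact: H.
Qed.

Lemma weak_is_cl phi q : weak_solution dot Ae f phi -> cl_sol q -> q 0 = phi 0 - cl_eq ->
  forall t, 0 <= t -> phi t = q t + cl_eq.
Proof.
move=> wphi sq q0 t t0; have [cp rp] := weak_rder wphi.
by rewrite -(cl_unique cp rp sq (esym q0) t0) subrK.
Qed.

Lemma weak_well_posed (p0 : V) : exists phi, (weak_solution dot Ae f phi /\ phi 0 = p0) /\
  forall phi', weak_solution dot Ae f phi' -> phi' 0 = p0 -> forall t, 0 <= t -> phi' t = phi t.
Proof.
have [p [p_0 sp]] := cl_exists (p0 - cl_eq).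
exists (fun t => p t + cl_eq); split.
  by split; [exact: weak_of_cl|rewrite p_0 subrK].
by move=> phi' wphi' phi0 t t0; apply: weak_is_cl => //; rewrite p_0 phi0.
Qed.

Lemma weak_exp_stable : exists nue ke : R, [/\ 0 < nue, 0 < ke &
  forall phi, weak_solution dot Ae f phi -> forall t, 0 <= t ->
    normE dot (phi t - cl_eq) <= ke * expR (- nue * t) * normE dot (phi 0 - cl_eq)].
Proof.
have [ke ke0 H] := cl_normE_decay; exists rate, ke; split => //; first exact: rate_gt0.
move=> phi wphi t t0; have [p [p_0 sp]] := cl_exists (phi 0 - cl_eq).
by rewrite (weak_is_cl wphi sp p_0 t0) addrK -p_0; exact: H.
Qed.

(** * Regulation of the output *)

Lemma cl_sol_inv u : cl_sol u -> cl_sol (fun t => Re (u t)).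
Proof.
move=> su; have [c hc] := cl_inv_bd.
have cu : cont0 u by case: su => ? ? _ _; exact: cont0_pair.
apply: classical_cl_sol.
- exact: (cont0_lin cl_inv_lin hc).
- by move=> t _; case: (cl_invP (u t)).
- by move=> t t0; have [_ ->] := cl_invP (u t); exact: cl_sol_rder_inv.
Qed.

Lemma lyap_mono p t : cl_sol p -> 0 <= t -> lyap (p t) <= lyap (p 0).
Proof.
move=> sp t0; apply: le_trans (lyap_decay sp t0) _.
rewrite ler_piMl ?lyap_ge0// -expR0 ler_expR mulNr oppr_le0 mulr_ge0//.
by rewrite mulr_ge0// ltW// rate_gt0.
Qed.

(** The solution starting from [x] will be [Re u], with time derivative [u]. *)
Lemma cl_classical (x : V) : dom A x.1 -> exists u,
  [/\ cl_sol u, u 0 = Ae x & Re (u 0) = x].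
Proof.
move=> dx; have [u [u0 su]] := cl_exists (Ae x).
by exists u; split => //; rewrite u0 cl_invK.
Qed.

Lemma obs_add (x y : X) : dom A x -> dom A y -> dom A (x + y) /\ C (x + y) = C x + C y.
Proof.
move=> dx dy; have [d e] := gen_lin hS hA 1 dx dy; rewrite !scale1r in d e.
by rewrite !obs_domA// e (linpD M_lin).
Qed.

Lemma cl_eq_obs : C cl_eq.1 = yref.
Proof. by have [d e] := cl_eqP; have := congr1 snd e; rewrite /= opprK. Qed.

(** Uniqueness identifies the shifted solution with [Re u]. Hence a solution that reaches the domain
    stays in it, and its derivative [u] is again a solution. *)
Lemma cl_restart q t0 : cl_sol q -> 0 <= t0 -> dom A (q t0).1 -> exists u,
  [/\ cl_sol u, u 0 = Ae (q t0) & forall t, 0 <= t -> q (t + t0) = Re (u t)].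
Proof.
move=> sq t00 dq; have [u [su u0 Ru0]] := cl_classical dq.
exists u; split => // t t0'; have sv := cl_sol_inv su; have sh := cl_shift t00 sq.
have csh : cont0 (fun t => q (t + t0)) by case: sh => ? ? _ _; exact: cont0_pair.
have E0 : q (0 + t0) = Re (u 0) by rewrite add0r Ru0.
have rsh s (s0 : 0 <= s) := cl_sol_rder_inv sh s0.
exact: (@cl_unique (fun t => q (t + t0)) (fun t => Re (u t)) csh rsh sv E0 t t0').
Qed.

Lemma regulated_dom phi t0 : weak_solution dot Ae f phi -> 0 <= t0 -> dom A (phi t0).1 ->
  (forall t, t0 <= t -> dom A (phi t).1) /\ enorm (C (phi t).1 - yref) @[t --> +oo] --> 0.
Proof.
move=> wphi t00 d0; have [q [q0 sq]] := cl_exists (phi 0 - cl_eq).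
have phiE := weak_is_cl wphi sq q0.
have dq : dom A (q t0).1.
  have [de _] := cl_eqP.
  have [] // := gen_lin hS hA (-1) de d0; rewrite phiE//= scaleN1r addrCA addNr addr0.
  by [].
have [u [su _ qv]] := cl_restart sq t00 dq.
(* Since [Ae (Re u) = u], the observation of [Re u] is the second component of [u]; the equilibrium
   contributes [yref]. *)
have all t : t0 <= t -> dom A (phi t).1 /\ C (phi t).1 - yref = (u (t - t0)).2.
  move=> tt; have tt0 : 0 <= t - t0 by rewrite subr_ge0.
  have -> : phi t = Re (u (t - t0)) + cl_eq.
    by rewrite -qv// subrK; apply: phiE; exact: le_trans t00 tt.
  have [dv ev] := cl_invP (u (t - t0)); have [de _] := cl_eqP.
  have [d e] := obs_add dv de; split => //.
  by rewrite [(_ + _).1]/= e cl_eq_obs addrK -[in RHS]ev.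
split=> [t /all[]//|].
have [ke ke0 H] := cl_normE_decay.
apply/cvgrPdist_le => e e0.
have [T T0 hT] := exp_decay_small rate_gt0 (ke * normE dot (u 0)) e0.
near=> t; rewrite sub0r normrN ger0_norm ?enorm_ge0//.
have tt : T + t0 <= t by near: t; apply: nbhs_pinfty_ge; rewrite num_real.
have [_ ->] : dom A (phi t).1 /\ C (phi t).1 - yref = (u (t - t0)).2.
  by apply: all; apply: le_trans tt; rewrite lerDr.
have tT : T <= t - t0 by rewrite lerBrDr.
apply: (@le_trans _ _ (normE dot (u (t - t0)))).
  apply: sqr_le_le (normE_ge0 _) _; rewrite sqr_normE sqr_enorm lerDr; exact: sqr_ge0.
apply: le_trans (H _ _ su (le_trans T0 tT)) _.
by rewrite mulrAC; exact: hT.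
Unshelve. all: by end_near. Qed.

(* Variation of constants bound for [q' = A q + F y] with [q 0 = 0]. *)
Lemma mild_energy (y : R -> 'cV[R]_m) (q : R -> X) (Y : R -> R) t : cont0 q -> q 0 = 0 ->
  (forall s, 0 <= s -> mild_der S (fun r => F (y r)) q s) ->
  cont0 Y -> (forall s, 0 <= s -> rder Y s (enorm (y s) ^+ 2)) -> 0 <= t ->
  `|q t| ^+ 2 <= (k * (ki * bet)) ^+ 2 / (2 * nu) * (Y t - Y 0).
Proof.
(* [K] makes [2 * a * (- nu * a + c * Z) - K * Z ^+ 2] a negative multiple of a square. *)
move=> cq q0 mq cY rY t0; set c := k * (ki * bet); set K := c ^+ 2 / (2 * nu).
have K0 : 0 <= K by rewrite divr_ge0 ?sqr_ge0// mulr_ge0// ltW.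
have sn0 : snorm S nu (q 0) = 0.
  apply/eqP; rewrite q0 eq_le (snorm_ge0 hS hexp) andbT.
  by have := snorm_le_norm hexp (0 : X); rewrite normr0 mulr0.
suff : snorm S nu (q t) ^+ 2 + K * - Y t <= snorm S nu (q 0) ^+ 2 + K * - Y 0.
  rewrite sn0 expr0n add0r => h.
  have : `|q t| ^+ 2 <= snorm S nu (q t) ^+ 2.
    by rewrite ler_pXn2r ?nnegrE ?(snorm_ge0 hS hexp)// (norm_le_snorm hS hexp).
  lra.
apply: (@dini_noninc R (fun s => snorm S nu (q s) ^+ 2 + K * - Y s)) => //.
  apply: cont0D; first exact/cont0_sqr/(cont0_snorm hS hexp).
  by apply: cont0Z; exact: cont0N.
move=> s s0 _; set a := snorm S nu (q s); set Z := enorm (y s).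
have d1 : dini (fun s => snorm S nu (q s) ^+ 2) s (2 * a * (- nu * a + k * (ki * bet * Z))).
  apply: dini_sqr => [r|]; first exact: (snorm_ge0 hS hexp).
  by apply: (mild_der_dini_snorm hS k1 hexp (F_bd _)); exact: mq.
have d2 : dini (fun s => - Y s) s (- Z ^+ 2).
  move=> e e0; have [d d0 hd] := rY s s0 e e0; exists d => // h h0 /(hd h h0).
  rewrite ler_norml => /andP[+ _]; rewrite -/Z /GRing.scale/=; lra.
apply: dini_le (diniD d1 (diniZ K0 d2)).
have -> : 2 * a * (- nu * a + k * (ki * bet * Z)) + K * - Z ^+ 2 =
  - (2 * nu) * (a - c * Z / (2 * nu)) ^+ 2.
  by rewrite /K /c; field; rewrite gt_eqF.
by rewrite mulNr oppr_le0 mulr_ge0 ?sqr_ge0// mulr_ge0// ltW.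
Qed.

(** Admissibility at the point [A^-1 x], where [C (S s (A^-1 x)) = M (S s x)]. The bound by
    [|A^-1 x|] rather than [|x|] matters when [x] is a time derivative. *)
Lemma obs_energy : exists T cT : R, [/\ 0 < T, 0 < cT & forall (x : X) (P : R -> R),
  cont0 P -> (forall s, 0 <= s -> rder P s (enorm (M (S s x)) ^+ 2)) ->
  forall t, 0 <= t -> t <= T -> P t - P 0 <= cT * `|invA x| ^+ 2].
Proof.
have [_ [T [cT [T0 cT0 H]]]] := hadm.
exists T, (cT ^+ 2); split => //; first exact: exprn_gt0.
move=> x P cP rP t t0 tT.
have cS : cont0 (fun s => M (S s x)) by apply: cont0_M; exact: (sg_orbit_cont0 hS k1 nu0 hexp).
have ce : cont0 (fun s => enorm (M (S s x)) ^+ 2) by exact/cont0_sqr/cont0_enorm.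
have mono : P t <= P T by apply: (primitive_mono cP rP) => // s; exact: sqr_ge0.
apply: (@le_trans _ _ (P T - P 0)); first lra.
have [dx ex] := invA_P x.
have := H _ dx.
have -> : (\int[lebesgue_measure]_(s in `[0%R, T]) (enorm (C (S s (invA x))) ^+ 2)%:E =
  \int[lebesgue_measure]_(s in `[0%R, T]) (enorm (M (S s x)) ^+ 2)%:E)%E.
  apply: eq_integral => s; rewrite inE/= in_itv/= => /andP[s0 _].
  have [ds es] := sg_gen hS hA k1 nu0 hexp s0 dx.
  by rewrite (obs_domA ds) es ex.
by rewrite (integral_primitive cP ce rP (lexx 0) (ltW T0)) lee_fin.
Qed.

(** Admissibility carried over to the closed loop: the energy of [(u s).2], the output of [Re u], is
    bounded by the state [Re u]. Split [(u s).2] as [M (S s x) + M (q s) - ki *: (Re (u s)).2]: free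
    evolution, effect of the feedback, state of [Re u]. The middle term is bounded by the energy
    being estimated. *)
Lemma window_bound : exists2 c, 0 < c & forall u Y, cl_sol u -> cont0 Y ->
  (forall s, 0 <= s -> rder Y s (enorm (u s).2 ^+ 2)) ->
  forall t, 0 <= t -> Y (t + 1) - Y t <= c * lyap (Re (u t)).
Proof.
case: mubet => mu0 bet0 _.
have [T [cT [T0 cT0 hT]]] := obs_energy.
have [c2 c20 h2] := normE_lyap.
pose K := (k * (ki * bet)) ^+ 2 / (2 * nu).
have K0 : 0 <= K by rewrite divr_ge0 ?sqr_ge0// mulr_ge0// ltW.
have L0 : 0 <= 6 * (mu ^+ 2 * K) by rewrite mulr_ge0// mulr_ge0 ?sqr_ge0.
(* [tau = 1 / N] is short enough for the feedback term to be absorbed *)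
have [N [hN1 hN2]] : exists N : nat, N.+1%:R^-1 <= T /\ N.+1%:R^-1 * (6 * (mu ^+ 2 * K)) <= 1.
  have [N1 h1] := inv_nat_small T0.
  have L1 : 0 < (6 * (mu ^+ 2 * K) + 1)^-1 by rewrite invr_gt0; lra.
  have [N3 h3] := inv_nat_small L1.
  exists (maxn N1 N3); split; first exact/h1/leq_maxl.
  have := h3 _ (leq_maxr N1 N3); set i := _^-1; move=> hi.
  apply: le_trans (ler_wpM2r L0 hi) _.
  by rewrite ler_pdivrMl; lra.
pose tau : R := N.+1%:R^-1; have tau0 : 0 < tau by rewrite invr_gt0.
rewrite -/tau in hN1 hN2.
pose c3 := 1 + k / nu * (ki * bet).
have c30 : 0 <= c3 by rewrite addr_ge0// !mulr_ge0 ?invr_ge0// ltW.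
(* The 6 is 3, from squaring a sum of three terms, times 2, from absorbing half of [Y tau - Y 0]
   into the left-hand side. *)
pose c0 := 6 * (cT * c3 ^+ 2 * 4 * c2 + tau * (ki ^+ 2 * c2)).
have c00 : 0 <= c0.
  rewrite mulr_ge0// addr_ge0//; first by rewrite !mulr_ge0 ?sqr_ge0// ltW.
  by rewrite mulr_ge0 ?(ltW tau0)// mulr_ge0 ?sqr_ge0// ltW.
have short u Y : cl_sol u -> cont0 Y -> (forall s, 0 <= s -> rder Y s (enorm (u s).2 ^+ 2)) ->
    Y tau - Y 0 <= c0 * lyap (Re (u 0)).
  move=> su cY rY; have sv := cl_sol_inv su; case: (su) => u1 u2 u3 u4.
  set L := lyap (Re (u 0)); have LL : 0 <= L := lyap_ge0 _.
  pose x := (u 0).1.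
  have zt t : 0 <= t -> enorm (Re (u t)).2 ^+ 2 <= c2 * L.
    move=> t0; apply: (@le_trans _ _ (normE dot (Re (u t)) ^+ 2)).
      by rewrite sqr_normE sqr_enorm lerDr sqr_ge0.
    have D : lyap (Re (u t)) <= L := lyap_mono sv t0.
    by apply: le_trans (h2 _) _; rewrite ler_pM2l.
  have xi : `|invA x| ^+ 2 <= c3 ^+ 2 * 4 * c2 * L.
    pose n := normE dot (Re (u 0)).
    have n0 : 0 <= n := normE_ge0 _.
    have hn : n ^+ 2 <= c2 * L by exact: h2.
    have a1 : `|(Re (u 0)).1| <= n.
      by apply: sqr_le_le n0 _; rewrite /n sqr_normE lerDl edot_ge0.
    have a2 : enorm (Re (u 0)).2 <= n.
      by apply: sqr_le_le n0 _; rewrite /n sqr_normE sqr_enorm lerDr sqr_ge0.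
    have e1 : invA x = (Re (u 0)).1 + invA (F (Re (u 0)).2).
      by rewrite /Re /= (linpB invA_lin) subrK.
    have e2 : `|invA x| <= c3 * n.
      rewrite e1; apply: le_trans (ler_normD _ _) _; rewrite mulrDl mul1r lerD//.
      apply: le_trans (invA_bd _) _; rewrite -[leRHS]mulrA ler_wpM2l ?divr_ge0 ?(ltW k0) ?(ltW nu0)//.
      by apply: le_trans (F_bd _) _; rewrite (ler_wpM2l (mulr_ge0 (ltW ki0) (ltW bet0))).
    have e3 : `|invA x| ^+ 2 <= c3 ^+ 2 * n ^+ 2.
      by rewrite -exprMn ler_pXn2r ?nnegrE// (le_trans _ e2).
    apply: le_trans e3 _; have := ler_wpM2l (sqr_ge0 c3) hn.
    have := mulr_ge0 (sqr_ge0 c3) (mulr_ge0 (ltW c20) LL); lra.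
  pose q s := (u s).1 - S s x.
  have cSx : cont0 (fun s => S s x) by exact: (sg_orbit_cont0 hS k1 nu0 hexp).
  have hq t : 0 <= t -> `|q t| ^+ 2 <= K * (Y t - Y 0).
    move=> t0; apply: (mild_energy (y := fun s => (u s).2)) => //.
    - exact: cont0B.
    - by rewrite /q /x (sg0 hS) subrr.
    - move=> s s0.
      have := mild_der_lin (sg_lin hS) (-1) s0 (mild_der_orbit (sgD hS) x s0) (u3 s s0).
      suff [-> ->] : (fun s => -1 *: (0 : X) + F (u s).2) = (fun s => F (u s).2) /\
          (fun s => -1 *: S s x + (u s).1) = q by [].
      by split; apply: funext => r; rewrite ?scaler0 ?add0r// scaleN1r addrC.
  have cM : cont0 (fun s => M (S s x)) by exact: cont0_M.
  have [P [P0 cP rP]] := scalar_primitive (cont0_sqr (cont0_enorm cM)).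
  have hP : P tau - P 0 <= cT * `|invA x| ^+ 2 by apply: hT => //; exact: ltW.
  have Ymono t : 0 <= t -> t <= tau -> Y t <= Y tau.
    by move=> t0 tt; apply: (primitive_mono cY rY) => // s; exact: sqr_ge0.
  have pw t : 0 <= t -> t <= tau -> enorm (u t).2 ^+ 2 <=
      3 * enorm (M (S t x)) ^+ 2 + (3 * (mu ^+ 2 * (K * (Y tau - Y 0))) + 3 * (ki ^+ 2 * (c2 * L))).
    move=> t0 tt.
    have e1 : (u t).2 = M (S t x) + M (q t) - ki *: (Re (u t)).2.
      rewrite -(linpD M_lin) /q (addrC (S t x)) subrK /Re /= scalerA mulfV ?gt_eqF//.
      by rewrite scale1r opprB addrC subrK.
    set a1 := enorm (M (S t x)); set a2 := mu * `|q t|; set a3 := ki * enorm (Re (u t)).2.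
    have e2 : enorm (u t).2 <= a1 + a2 + a3.
      rewrite {1}e1; apply: le_trans (enormB _ _) _; rewrite enormZ (gtr0_norm ki0) lerD2r.
      by apply: le_trans (enormD _ _) _; rewrite lerD2l M_bd.
    have e3 : enorm (u t).2 ^+ 2 <= (a1 + a2 + a3) ^+ 2.
      by rewrite ler_pXn2r ?nnegrE ?enorm_ge0// (le_trans (enorm_ge0 _) e2).
    have e4 : a2 ^+ 2 <= mu ^+ 2 * (K * (Y tau - Y 0)).
      rewrite exprMn ler_wpM2l ?sqr_ge0//; apply: le_trans (hq t t0) _.
      by rewrite ler_wpM2l// lerD2r Ymono.
    have e5 : a3 ^+ 2 <= ki ^+ 2 * (c2 * L) by rewrite exprMn ler_wpM2l ?sqr_ge0// zt.
    have := sqr_ge0 (a1 - a2); have := sqr_ge0 (a1 - a3); have := sqr_ge0 (a2 - a3).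
    lra.
  set D := 3 * (mu ^+ 2 * (K * (Y tau - Y 0))) + 3 * (ki ^+ 2 * (c2 * L)) in pw.
  have main : Y tau - Y 0 <= 3 * (P tau - P 0) + D * tau.
    suff : Y tau - 3 * P tau - tau * D <= Y 0 - 3 * P 0 - 0 * D by lra.
    apply: (@dini_noninc R (fun s => Y s - 3 * P s - s * D)) => //; first exact: ltW.
      apply: cont0B; last exact: cont0Zt.
      by apply: cont0B => //; exact: cont0Z.
    move=> s s0 st e e0.
    have [d d0 hd] := rderB (rderB (rY s s0) (rderZ 3 (rP s s0))) (rderZt D s) e0.
    exists d => // h h0 /(hd h h0); rewrite ler_norml => /andP[_].
    rewrite /GRing.scale/=.
    have := ler_wpM2l (ltW h0) (pw s s0 (ltW st)); lra.
  have W0 : 0 <= Y tau - Y 0 by rewrite subr_ge0 Ymono// ltW.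
  have := ler_wpM2r W0 hN2; have := ler_wpM2l (ltW cT0) xi.
  rewrite /D in main; rewrite /c0; lra.
exists (N.+1%:R * c0 + 1).
  by rewrite ltr_wpDl// mulr_ge0.
move=> u Y su cY rY t t0.
have sv := cl_sol_inv su.
set L := lyap (Re (u t)).
(* A unit window is cut into [N.+1] windows of length [tau], the solution being restarted at the
   left end of each. *)
have step j : Y (t + j%:R * tau + tau) - Y (t + j%:R * tau) <= c0 * L.
  have a0 : 0 <= t + j%:R * tau by rewrite addr_ge0// mulr_ge0// ltW.
  have jt0 : 0 <= j%:R * tau by rewrite mulr_ge0// ltW.
  have := short (fun s => u (s + (t + j%:R * tau))) (fun s => Y (s + (t + j%:R * tau))).
  rewrite add0r (addrC tau) => H; apply: le_trans (H _ _ _) _.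
  - exact: cl_shift.
  - move=> s s0 e e0; have [d d0 hd] := cY _ (addr_ge0 s0 a0) e e0; exists d => // r r0 rs.
    apply: hd; first exact: addr_ge0.
    by have -> : r + (t + j%:R * tau) - (s + (t + j%:R * tau)) = r - s by ring.
  - move=> s s0 e e0; have [d d0 hd] := rY _ (addr_ge0 s0 a0) e e0; exists d => // h h0 /(hd h h0).
    by rewrite (addrAC s).
  apply: (ler_wpM2l c00).
  have := lyap_mono (cl_shift t0 sv) jt0.
  by rewrite add0r (addrC (j%:R * tau)).
have sum j : Y (t + j%:R * tau) - Y t <= j%:R * (c0 * L).
  elim: j => [|j IHj]; first by rewrite !mul0r addr0 subrr.
  have := step j; rewrite -natr1 !mulrDl !mul1r addrA; lra.
have := sum N.+1; rewrite mulfV ?pnatr_eq0//.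
move=> /le_trans; apply.
have -> : (N.+1%:R * c0 + 1) * L = N.+1%:R * (c0 * L) + L by ring.
rewrite lerDl.
exact: lyap_ge0.
Qed.

(** The domain of the closed loop restricts the first component only, so the second is kept exact
    and the error falls under [lyap_fst]. *)
Lemma cl_dense (x : V) e : 0 < e -> exists u,
  [/\ cl_sol u, `|(Re (u 0)).1 - x.1| <= e & (Re (u 0)).2 = x.2].
Proof.
move=> e0; have [y dy hy] := gen_dense hS hA k1 nu0 hexp primX x.1 e0.
by have [|u [su _ Ru]] := @cl_classical (y, x.2); [|exists u; split => //; rewrite Ru].
Qed.

(** A sum of [N] unit windows, using the decay of [lyap] up to time [a] and its monotonicity
    afterwards. *)
Lemma obs_bound : exists2 c, 0 < c & forall u (a : R) (N : nat), cl_sol u -> 0 <= a ->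
  exists Y : R -> R, [/\ cont0 Y, forall s : R, 0 <= s -> rder Y s (enorm (u s).2 ^+ 2) &
    Y (a + N%:R) - Y a <= c * N%:R * (expR (- (2 * rate) * a) * lyap (Re (u 0)))].
Proof.
have [c c0 hc] := window_bound; exists c => // u a N su a0.
have [_ cu2 _ _] := su.
have [Y [_ cY rY]] := scalar_primitive (cont0_sqr (cont0_enorm cu2)).
exists Y; split => //; elim: N => [|N IHN]; first by rewrite addr0 subrr mulr0 mul0r.
have aN : 0 <= a + N%:R by rewrite addr_ge0.
have := hc u Y su cY rY (a + N%:R) aN.
have sv := cl_sol_inv su.
have m1 := lyap_mono (cl_shift a0 sv) (ler0n R N).
have m2 := lyap_decay sv a0.
rewrite /= add0r addrC in m1.
rewrite -addrA natr1 => h.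
have h' := le_trans h (ler_wpM2l (ltW c0) (le_trans m1 m2)).
have := lerD h' IHN; rewrite addrA subrK => /le_trans; apply.
by rewrite -[N.+1%:R]natr1 [c * (_ + 1)]mulrDr mulr1 mulrDl addrC.
Qed.

Lemma coord_lin i : linear (fun x : V => x.2 i 0 : R).
Proof. by move=> a x y; rewrite !mxE. Qed.

Lemma coord_bd i (x : V) : `|x.2 i 0| <= 1 * `|x|.
Proof.
rewrite mul1r; apply: le_trans (le_mxnorm _ _) _.
by have := lexx `|x|; rewrite {1}prod_norm_le => /andP[].
Qed.

Lemma lyap_fst : exists2 c, 0 < c & forall (p : V) d, p.2 = 0 -> `|p.1| <= d ->
  lyap p <= c * d ^+ 2.
Proof.
have [c c0 h] := lyap_normE; exists c => // p d p2 pd; apply: le_trans (h p) _.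
apply: (ler_wpM2l (ltW c0)); rewrite sqr_normE p2 -sqr_enorm enorm0 expr0n addr0.
by rewrite !expr2; apply: ler_pM => //; exact: normr_ge0.
Qed.

Lemma normE_coord (x : V) i : `|x.2 i 0| <= normE dot x.
Proof.
apply: le_trans (le_coord_enorm _ _) _; apply: sqr_le_le (normE_ge0 _) _.
by rewrite sqr_normE sqr_enorm lerDr sqr_ge0.
Qed.

Lemma cl_sol_rder_dom q t : cl_sol q -> 0 <= t -> dom A (q t).1 -> rder q t (Ae (q t)).
Proof.
move=> sq t0 dq e e0; have [u [su <- qu]] := cl_restart sq t0 dq.
have [d d0 hd] := cl_sol_rder_inv su (lexx 0) e0.
exists d => // h h0 hhd; have := hd h h0 hhd.
by rewrite add0r -!qu ?(ltW h0)// add0r (addrC h).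
Qed.

(** * The output of a mild solution as a square-integrable function *)

Section OutputOf.
Variable q : R -> V.
Hypothesis sq : cl_sol q.

(** The rate asked for by [L1_fast_limit]. Initial errors are taken of size [x n ^+ 2], so that
    dividing their energy by [x n] later still leaves this rate. *)
Let x (n : nat) : R := 2^-1 ^+ n.

Let x_gt0 n : 0 < x n. Proof. by rewrite exprn_gt0// invr_gt0. Qed.

Let x_le1 n : x n <= 1.
Proof. by rewrite exprn_ile1// ?invr_ge0// invf_le1 ?ler1n. Qed.

Let xS n : x n.+1 <= x n. Proof. by rewrite /x exprS ler_piMl ?ltW// invf_lt1// ltr1n. Qed.

(* Classical solutions converging fast to [q]: each [u n] is the derivative of
   one, whose second component is the value of [C] along it. *)
Let approx : exists u : nat -> R -> V, forall n, [/\ cl_sol (u n),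
  `|(Re (u n 0)).1 - (q 0).1| <= x n ^+ 2 & (Re (u n 0)).2 = (q 0).2].
Proof.
have h n := cl_dense (q 0) (exprn_gt0 2 (x_gt0 n)).
by have [u hu] := choice h; exists u.
Qed.

Let coord_sol i u (t : R) : cl_sol u -> 0 <= t ->
  rder (fun s => (Re (u s)).2 i 0) t ((u t).2 i 0).
Proof.
by move=> su t0; apply: (rder_lin (coord_lin i) (coord_bd i)); exact: cl_sol_rder_inv.
Qed.

Let coord_cont0 i u : cl_sol u -> cont0 (fun s => (u s).2 i 0).
Proof. by case=> _ cu _ _; exact: (cont0_mx _).1. Qed.

Let integral_coord i u t : cl_sol u -> 0 <= t ->
  \int[lebesgue_measure]_(s in `[0, t]) (u `|s|).2 i 0 = (Re (u t)).2 i 0 - (Re (u 0)).2 i 0.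
Proof.
move=> su t0; have rs s (s0 : 0 <= s) := coord_sol i su s0.
have cR := coord_cont0 i (cl_sol_inv su).
rewrite /Rintegral -[RHS]/(fine ((Re (u t)).2 i 0 - (Re (u 0)).2 i 0)%:E).
rewrite -(integral_primitive cR (coord_cont0 i su) rs (lexx 0) t0); congr fine.
by apply: eq_integral => s; rewrite inE/= in_itv/= => /andP[s0 _]; rewrite ger0_norm.
Qed.

(** The difference [D] of two approximants is a solution, and [Re D] starts with zero second
    component and first component at most [2 * x n ^+ 2]; its energy is then of order [x n ^+ 4]. *)
Let approx_L1 (u : nat -> R -> V) (N : nat) : (forall n, [/\ cl_sol (u n),
  `|(Re (u n 0)).1 - (q 0).1| <= x n ^+ 2 & (Re (u n 0)).2 = (q 0).2]) ->
  exists c : R, forall n i,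
  (\int[lebesgue_measure]_(t in `[0%R, N%:R]) `|(u n.+1 `|t|).2 i 0 - (u n `|t|).2 i 0|%:E
    <= (c * x n)%:E)%E.
Proof.
move=> hu; have [c1 c10 h1] := lyap_fst; have [c c0 hc] := obs_bound.
exists (N%:R / 2 + 2 * c * N%:R * c1) => n i.
have [su pu pu2] := hu n; have [su' pu' pu2'] := hu n.+1.
have sD := cl_solD (-1) su su'; set D := fun t => _ in sD.
have [Y [cY rY]] := hc D 0 N sD (lexx 0).
have L0 : lyap (Re (D 0)) <= c1 * (2 * x n ^+ 2) ^+ 2.
  have : Re (D 0) = -1 *: Re (u n 0) + Re (u n.+1 0) := cl_inv_lin _ _ _.
  move: (Re (u n 0)) (Re (u n.+1 0)) pu pu2 pu' pu2' => a b pu pu2 pu' pu2' ->.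
  apply: h1; first by rewrite /= pu2 pu2' scaleN1r addNr.
  have -> : (-1 *: a + b).1 = (b.1 - (q 0).1) - (a.1 - (q 0).1).
    by rewrite /= scaleN1r opprB addrA subrK addrC.
  have xx : x n.+1 ^+ 2 <= x n ^+ 2 by rewrite !expr2; apply: ler_pM => //; exact/ltW/x_gt0.
  apply: le_trans (ler_normB _ _) _; rewrite mulr_natl mulr2n.
  by apply: lerD => //; exact: le_trans xx.
rewrite mulr0 expR0 mul1r add0r => hY.
have {}hY := le_trans hY (ler_wpM2l (mulr_ge0 (ltW c0) (ler0n _ N)) L0).
(* AM-GM: [|d| <= x / 2 + d ^ 2 / (2 x)] *)
pose g t := x n / 2 + (2 * x n)^-1 * enorm (D t).2 ^+ 2.
pose G t := t *: (x n / 2) + (2 * x n)^-1 *: Y t.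
have cD : cont0 (fun t => enorm (D t).2 ^+ 2).
  by case: sD => _ cD _ _; exact/cont0_sqr/cont0_enorm.
have cg : cont0 g by apply: cont0D; [exact: cont0_cst|exact: cont0Z].
have cG : cont0 G by apply: cont0D; [exact: cont0Zt|exact: cont0Z].
have rG t : 0 <= t -> rder G t (g t).
  by move=> t0; apply: rderD; [exact: rderZt|apply: rderZ; exact: rY].
apply: (@le_trans _ _ (\int[lebesgue_measure]_(t in `[0%R, N%:R]) (g `|t|)%:E)%E).
  apply: ge0_le_integral.
  - exact: measurable_itv.
  - by move=> t _; rewrite lee_fin.
  - apply: continuous_EFin_measurable => t; apply: cvg_norm; apply: cvgB.
    + exact: (cont0_continuous_abs (coord_cont0 i su')).
    + exact: (cont0_continuous_abs (coord_cont0 i su)).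
  - by apply: continuous_EFin_measurable; exact: cont0_continuous_abs.
  - move=> t _; rewrite lee_fin.
    have hd : `|(u n.+1 `|t|).2 i 0 - (u n `|t|).2 i 0| <= enorm (D `|t|).2.
      have := le_coord_enorm (D `|t|).2 i.
      by rewrite /D /= !mxE mulN1r addrC.
    apply: le_trans hd _; rewrite /g; set E := enorm _.
    have x0 := x_gt0 n.
    rewrite -subr_ge0.
    have -> : x n / 2 + (2 * x n)^-1 * E ^+ 2 - E = (2 * x n)^-1 * (x n - E) ^+ 2.
      by field; rewrite gt_eqF.
    by rewrite mulr_ge0 ?sqr_ge0// invr_ge0 mulr_ge0// ltW.
have -> : (\int[lebesgue_measure]_(t in `[0%R, N%:R]) (g `|t|)%:E =
    \int[lebesgue_measure]_(t in `[0%R, N%:R]) (g t)%:E)%E.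
  by apply: eq_integral => s; rewrite inE/= in_itv/= => /andP[s0 _]; rewrite ger0_norm.
rewrite (integral_primitive cG cg rG (lexx 0) (ler0n _ N)) lee_fin /G scale0r add0r.
rewrite -addrA -scalerBr /GRing.scale/=.
have x0 := x_gt0 n.
apply: (@le_trans _ _ (N%:R * (x n / 2) + (2 * x n)^-1 * (c * N%:R * (c1 * (2 * x n ^+ 2) ^+ 2)))).
  by rewrite lerD2l; apply: ler_wpM2l => //; rewrite invr_ge0 mulr_ge0// ltW.
have -> : (2 * x n)^-1 * (c * N%:R * (c1 * (2 * x n ^+ 2) ^+ 2)) = (2 * c * N%:R * c1 * x n) * x n ^+ 2.
  by field; rewrite gt_eqF.
have -> : (N%:R / 2 + 2 * c * N%:R * c1) * x n = N%:R * (x n / 2) + 2 * c * N%:R * c1 * x n.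
  by field.
rewrite lerD2l ler_piMr//; last by rewrite exprn_ile1// ltW.
by rewrite !mulr_ge0// ltW.
Qed.

Let zq i (t : R) := (q `|t|).2 i 0.

Let zq_cont i : continuous (zq i).
Proof. exact: (cont0_continuous_abs (coord_cont0 i sq)). Qed.

Let approx_coord (u : nat -> R -> V) i t : (forall n, [/\ cl_sol (u n),
  `|(Re (u n 0)).1 - (q 0).1| <= x n ^+ 2 & (Re (u n 0)).2 = (q 0).2]) -> 0 <= t ->
  (fun n => (Re (u n t)).2 i 0) @ \oo --> (q t).2 i 0.
Proof.
move=> hu t0; have [c1 c10 h1] := lyap_fst; have [c2 c20 h2] := normE_lyap.
pose K := 1 + c2 * c1.
have K0 : 1 <= K by rewrite lerDl mulr_ge0// ltW.
apply/cvgrPdist_le => e e0; have [N hN] := geometric_small K e0.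
exists N => // n Nn; apply: le_trans (hN n Nn); rewrite -/(x n).
have [su pu pu2] := hu n.
have sD := cl_solD (-1) sq (cl_sol_inv su).
have := lyap_mono sD t0.
move: (Re (u n t)) (Re (u n 0)) pu pu2 => a b pu pu2.
have L0 : lyap (-1 *: q 0 + b) <= c1 * (x n ^+ 2) ^+ 2.
  by apply: h1; [rewrite /= pu2 scaleN1r addNr|rewrite /= scaleN1r addrC].
move=> /le_trans /(_ L0) L1; rewrite distrC.
have -> : a.2 i 0 - (q t).2 i 0 = (-1 *: q t + a).2 i 0.
  by rewrite /= !mxE mulN1r addrC.
apply: le_trans (normE_coord _ i) _; have x0 := x_gt0 n; have x1 := x_le1 n.
apply: sqr_le_le; first by rewrite mulr_ge0// ltW// (lt_le_trans ltr01).
apply: le_trans (h2 _) _.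
apply: le_trans (ler_wpM2l (ltW c20) L1) _.
have -> : c2 * (c1 * (x n ^+ 2) ^+ 2) = (c2 * c1 * x n ^+ 2) * x n ^+ 2 by ring.
rewrite exprMn; apply: ler_wpM2r; first exact: sqr_ge0.
apply: (@le_trans _ _ K); last by rewrite expr2 ler_peMl// (le_trans ler01).
apply: (@le_trans _ _ (c2 * c1)); last by rewrite lerDr.
apply: ler_piMr; first by rewrite mulr_ge0// ltW.
by apply: exprn_ile1 => //; exact: ltW.
Qed.

Let approx_lyap (u : nat -> R -> V) : (forall n, [/\ cl_sol (u n),
  `|(Re (u n 0)).1 - (q 0).1| <= x n ^+ 2 & (Re (u n 0)).2 = (q 0).2]) ->
  exists2 L, 0 <= L & forall n, lyap (Re (u n 0)) <= L.
Proof.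
move=> hu; have [c c0 hc] := lyap_normE.
exists (c * ((`|(q 0).1| + 1) ^+ 2 + edot (q 0).2 (q 0).2)) => [|n].
  by rewrite mulr_ge0 ?addr_ge0 ?sqr_ge0 ?edot_ge0// ltW.
have [_ pu pu2] := hu n; apply: le_trans (hc _) _.
apply: (ler_wpM2l (ltW c0)); rewrite sqr_normE pu2 lerD2r.
rewrite !expr2; set b := (Re (u n 0)).1 in pu *.
have hb : `|b| <= `|(q 0).1| + 1.
  have -> : b = (q 0).1 + (b - (q 0).1) by rewrite addrC subrK.
  apply: le_trans (ler_normD _ _) _; rewrite lerD2l; apply: le_trans pu _.
  by apply: exprn_ile1 => //; exact: ltW.
by apply: ler_pM.
Qed.

(** The output has to agree with [C] at every time in the domain, not just almost everywhere: the
    pointwise-defined [rderivative] of the integrator does so, and almost everywhere it is also the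
    limit of the approximate outputs. *)
Lemma cl_output : exists (r : R -> 'cV[R]_m) (c : R), [/\
  forall i (D : set (measurableTypeR R)), measurable_fun D (fun t => r t i 0),
  forall (t : R) i, 0 <= t ->
    (q t).2 i 0 = (q 0).2 i 0 + \int[lebesgue_measure]_(s in `[0, t]) r s i 0,
  forall t : R, 0 <= t -> dom A (q t).1 -> r t = C (q t).1 &
  forall (a : R) (N : nat), 0 <= a ->
    (\int[lebesgue_measure]_(s in `[a, (a + N%:R)%R]) (enorm (r s) ^+ 2)%:E
      <= (c * N%:R * expR (- (2 * rate) * a))%:E)%E].
Proof.
have [u hu] := approx; have [L L0 hL] := approx_lyap hu; have [c c0 hc] := obs_bound.
pose r t : 'cV[R]_m := \col_i rderivative (zq i) t.
pose g (i : 'I_m) (n : nat) (t : R) := (u n `|t|).2 i 0.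
have su n : cl_sol (u n) by case: (hu n).
have fc i n : continuous (g i n) by exact: (cont0_continuous_abs (coord_cont0 i (su n))).
have fast i (N : nat) :
    {ae lebesgue_measure, forall t : R, `[0, N.+1%:R]%classic t -> g i ^~ t @ \oo --> r t i 0} /\
    forall t : R, 0 <= t -> t <= N.+1%:R ->
      zq i t = zq i 0 + \int[lebesgue_measure]_(s in `[0, t]) r s i 0.
  have [cN hN] := approx_L1 N.+1 hu.
  have -> : (fun t => r t i 0) = rderivative (zq i) by apply: funext => t; rewrite mxE.
  have hz t : 0 <= t -> t <= N.+1%:R ->
      (fun n => \int[lebesgue_measure]_(s in `[0, t]) g i n s) @ \oo --> zq i t - zq i 0.
    move=> t0 _; rewrite /g; under eq_fun => n do rewrite (integral_coord i (su n) t0).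
    rewrite /zq normr0 (ger0_norm t0); apply: cvgB; first exact: approx_coord.
    by apply: approx_coord.
  have [H1 H2] := L1_fast_limit (ltr0Sn R N) (fc i) (@zq_cont i) (fun n => hN n i) hz.
  split; last exact: H2.
  by apply: negligibleS H1 => t /=; apply: contra_not => H Dt; rewrite mxE; exact: H.
have mr i (D : set (measurableTypeR R)) : measurable_fun D (fun t => r t i 0).
  have -> : (fun t => r t i 0) = rderivative (zq i) by apply: funext => t; rewrite mxE.
  exact: rderivative_measurable.
exists r, (c * L); split.
- exact: mr.
- move=> t i t0; have [_] := fast i (Num.bound t).
  move=> /(_ t t0); rewrite /zq normr0 (ger0_norm t0); apply.
  by apply: ltW (lt_le_trans (archi_boundP t0) _); rewrite ler_nat.
- move=> t t0 dq; apply/matrixP => i j; rewrite ord1 mxE.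
  apply: rderivativeE => e e0.
  have := rder_lin (coord_lin i) (coord_bd i) (cl_sol_rder_dom sq t0 dq).
  move=> /(_ e e0)[d d0 hd]; exists d => // h h0 hhd.
  by rewrite /zq (ger0_norm t0) (ger0_norm (addr_ge0 t0 (ltW h0))); exact: hd.
move=> a N a0.
have ce n : cont0 (fun t => enorm (u n t).2 ^+ 2).
  by case: (su n) => _ cu _ _; exact/cont0_sqr/cont0_enorm.
(* Along the approximants the window energies are bounded uniformly in [n], by [obs_bound] and the
   common bound [L]. *)
apply: (@fatou_bound R (fun n t => enorm (u n `|t|).2 ^+ 2)).
- exact: measurable_itv.
- by move=> n; exact: (cont0_continuous_abs (ce n)).
- by move=> n t; exact: sqr_ge0.
- have -> : (fun t => enorm (r t) ^+ 2) = (fun t => \sum_i r t i 0 ^+ 2).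
    by apply: funext => t; rewrite sqr_enorm edotE.
  by apply: measurable_sum => i; apply: measurable_funX; exact: mr.
- by move=> t; exact: sqr_ge0.
- pose M0 := Num.bound (a + N%:R).
  have aM : a + N%:R <= M0.+1%:R.
    by apply: ltW (lt_le_trans (archi_boundP _) _); rewrite ?ler_nat// addr_ge0.
  have ae_all : {ae lebesgue_measure, forall t : R, forall i, `[0, M0.+1%:R]%classic t ->
      g i ^~ t @ \oo --> r t i 0}.
    by apply: filter_forall => i; case: (fast i M0).
  apply: negligibleS ae_all => t /=; apply: contra_not => H.
  rewrite in_itv/= => /andP[ta tb].
  have {}H i : g i ^~ t @ \oo --> r t i 0.
    by apply: H; rewrite in_itv/= (le_trans a0 ta) (le_trans tb aM).
  rewrite sqr_enorm edotE; under eq_fun => n do rewrite sqr_enorm edotE.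
  by apply: cvg_big => [|i _]; [exact: add_continuous|apply: cvgM; exact: H].
move=> n; have [Y [cY rY hY]] := hc _ a N (su n) a0.
have -> : (\int[lebesgue_measure]_(s in `[a, (a + N%:R)%R]) (enorm (u n `|s|).2 ^+ 2)%:E =
    \int[lebesgue_measure]_(s in `[a, (a + N%:R)%R]) (enorm (u n s).2 ^+ 2)%:E)%E.
  apply: eq_integral => s; rewrite inE/= in_itv/= => /andP[sa _].
  by rewrite ger0_norm// (le_trans a0 sa).
have aN : a <= a + N%:R by rewrite lerDl.
rewrite (integral_primitive cY (ce n) rY a0 aN) lee_fin; apply: le_trans hY _.
have -> : c * L * N%:R * expR (- (2 * rate) * a) = c * N%:R * (expR (- (2 * rate) * a) * L) by ring.
apply: ler_wpM2l; first by rewrite mulr_ge0// ltW.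
by apply: ler_wpM2l; [exact: expR_ge0|exact: hL].
Qed.

End OutputOf.

Lemma regulated_window phi : weak_solution dot Ae f phi -> exists2 y, output A C yref phi y &
  (\int[lebesgue_measure]_(s in `[t, (t + 1)%R]) (enorm (y s - yref) ^+ 2)%:E)%E
     @[t --> +oo] --> 0%E.
Proof.
move=> wphi; have [q [q0 sq]] := cl_exists (phi 0 - cl_eq).
have phiE := weak_is_cl wphi sq q0.
have [r [c [mr zr dr wr]]] := cl_output sq.
have [de _] := cl_eqP.
(* [r] is the output of the deviation from the equilibrium, where [C] takes the value [yref]. *)
exists (fun t => r t + yref).
  split.
  - move=> i; have h (D : set (measurableTypeR R)) : measurable_fun D (fun t => (r t + yref) i 0).
      have -> : (fun t => (r t + yref) i 0) = (fun t => r t i 0 + yref i 0).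
        by apply: funext => t; rewrite mxE.
      by apply: measurable_funD; [exact: mr|exact: measurable_cst].
    exact: h.
  - move=> b b0.
    have mE (D : set (measurableTypeR R)) : measurable_fun D (fun t => (enorm (r t) ^+ 2)%:E).
      apply/measurable_EFinP.
      have -> : (fun t => enorm (r t) ^+ 2) = (fun t => \sum_i r t i 0 ^+ 2).
        by apply: funext => t; rewrite sqr_enorm edotE.
      by apply: measurable_sum => i; apply: measurable_funX; exact: mr.
    have mE' (D : set (measurableTypeR R)) :
        measurable_fun D (fun t => (enorm (r t + yref) ^+ 2)%:E).
      apply/measurable_EFinP.
      have -> : (fun t => enorm (r t + yref) ^+ 2) = (fun t => \sum_i (r t i 0 + yref i 0) ^+ 2).
        by apply: funext => t; rewrite sqr_enorm edotE; apply: eq_bigr => i _; rewrite !mxE.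
      apply: measurable_sum => i; apply: measurable_funX.
      by apply: measurable_funD; [exact: mr|exact: measurable_cst].
    pose N := Num.bound b.
    have bN : b <= 0 + N%:R by rewrite add0r ltW// archi_boundP.
    have sub : (`[0, b]%classic : set R) `<=` `[0, 0 + N%:R].
      by move=> s /=; rewrite !in_itv/= => /andP[-> sb]; exact: le_trans sb bN.
    (* Enlarge [[0, b]] to integer length and use [|r + yref|^2 <= 2 |r|^2 + 2 |yref|^2]. *)
    apply: (@le_lt_trans _ _ (\int[lebesgue_measure]_(s in `[0%R, (0 + N%:R)%R])
      (2%:E * (enorm (r s) ^+ 2)%:E + (2 * enorm yref ^+ 2)%:E))%E).
      apply: (@le_trans _ _ (\int[lebesgue_measure]_(s in `[0%R, (0 + N%:R)%R])
          (enorm (r s + yref) ^+ 2)%:E)%E).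
        by apply: ge0_subset_integral => //; try exact: measurable_itv;
          move=> s _; rewrite lee_fin sqr_ge0.
      apply: ge0_le_integral => //.
      + by move=> s _; rewrite lee_fin sqr_ge0.
      + apply: emeasurable_funD; last exact: measurable_cst.
        by apply: emeasurable_funM => //; exact: measurable_cst.
      + move=> s _; rewrite -EFinM -EFinD lee_fin.
        have h := enormD (r s) yref.
        have h' : enorm (r s + yref) ^+ 2 <= (enorm (r s) + enorm yref) ^+ 2.
          by rewrite !expr2; apply: ler_pM => //; exact: enorm_ge0.
        apply: le_trans h' _; rewrite -subr_ge0.
        have -> : 2 * enorm (r s) ^+ 2 + 2 * enorm yref ^+ 2 - (enorm (r s) + enorm yref) ^+ 2
          = (enorm (r s) - enorm yref) ^+ 2 by ring.
        exact: sqr_ge0.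
    rewrite ge0_integralD//=; first last.
    + by move=> s _; rewrite lee_fin mulr_ge0// sqr_ge0.
    + by apply: emeasurable_funM => //; exact: measurable_cst.
    + by move=> s _; rewrite -EFinM lee_fin mulr_ge0// sqr_ge0.
    + rewrite ge0_integralZl//=; last by move=> s _; rewrite lee_fin sqr_ge0.
      rewrite integral_cst//; apply: lte_add_pinfty.
        apply: (@le_lt_trans _ _ (2%:E * (c * N%:R * expR (- (2 * rate) * 0))%:E)%E); last exact: ltry.
        by apply: lee_wpmul2l => //; exact: wr.
      have fin : (lebesgue_measure (`[0%R, (0 + N%:R)%R]%classic : set R) < +oo)%E.
        by rewrite lebesgue_measure_itv/=; case: ifP => _; rewrite -?EFinB ltry.
      apply: lte_mul_pinfty; [|by []|exact: fin].
      by rewrite lee_fin mulr_ge0// sqr_ge0.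
  - move=> t i t0; rewrite !phiE// !mxE (zr t i t0) addrAC; congr (_ + _).
    by apply: eq_Rintegral => s _; rewrite mxE addrK.
  - move=> t t0 dphi.
    have dq : dom A (q t).1.
      have [] // := gen_lin hS hA (-1) de dphi.
      by rewrite phiE//= scaleN1r addrCA addNr addr0.
    have [_ e] := obs_add dq de.
    by rewrite dr// phiE//= e cl_eq_obs.
have E : (fun t : R => (\int[lebesgue_measure]_(s in `[t, (t + 1)%R]) (enorm (r s + yref - yref) ^+ 2)%:E)%E)
    = (fun t => (\int[lebesgue_measure]_(s in `[t, (t + 1)%R]) (enorm (r s) ^+ 2)%:E)%E).
  by apply: funext => t; apply: eq_integral => s _; rewrite addrK.
(* The upper bound is the case [N = 1] of [wr]. *)
rewrite E; apply: (@squeeze_cvge _ _ _ _ (cst 0%E) _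
  (fun t => (c * expR (- (2 * rate) * t))%:E)).
- near=> t; have t0 : 0 <= t by near: t; apply: nbhs_pinfty_ge; rewrite num_real.
  rewrite integral_ge0 => [|s _]; last by rewrite lee_fin sqr_ge0.
  by have := wr t 1%N t0; rewrite mulr1.
- exact: cvg_cst.
- apply: cvg_EFin; first exact: nearW.
  have c0 : 0 <= c.
    have := wr 0 1%N (lexx 0); rewrite mulr0 expR0 !mulr1 => h.
    rewrite -lee_fin; apply: le_trans h; apply: integral_ge0 => s _; rewrite lee_fin; exact: sqr_ge0.
  apply/cvgrPdist_le => e e0.
  have [T T0 hT] := exp_decay_small (mulr_gt0 (ltr0n R 2) rate_gt0) c e0.
  near=> t; rewrite sub0r normrN ger0_norm; last by rewrite mulr_ge0// expR_ge0.
  by apply: hT; near: t; apply: nbhs_pinfty_ge; rewrite num_real.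
Unshelve. all: by end_near. Qed.

End ClosedLoop.

Unset Implicit Arguments.

Theorem corollary1 (R : realType) (X : completeNormedModType R)
  (dot : {dot X for idfun}) (m : nat)
  (S : R -> X -> X) (A : operator X X)
  (B : {linear 'cV[R]_m -> X}) (C : operator X 'cV[R]_m) (k nu : R)
  (hX : norm_of_dot dot) (hsep : separable X)
  (hS : C0_semigroup S) (hA : generator S A)
  (hk : 0 < k) (hnu : 0 < nu)
  (hexp : forall (x : X) (t : R), 0 <= t -> `|S t x| <= k * expR (- nu * t) * `|x|)
  (hB : exists b : R, forall v, `|B v| <= b * enorm v)
  (hC : linear_operator C) (hAC : dom A `<=` dom C)
  (hadm : admissible S A C)
  (hrank : \rank (dc_gain A B C) = m) :
  forall ki : R, 0 < ki -> ki < ki_star A B C k nu ->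
  forall (w : X) (yref : 'cV[R]_m),
  let Ae := closed_loop A B C ki in
  let f := (w, - yref) in
  [/\ forall p0 : X * 'cV[R]_m,
        exists phi : R -> X * 'cV[R]_m,
          (weak_solution dot Ae f phi /\ phi 0 = p0) /\
          forall phi', weak_solution dot Ae f phi' -> phi' 0 = p0 ->
            forall t, 0 <= t -> phi' t = phi t,
      exists pinf : X * 'cV[R]_m, equilibrium Ae f pinf /\
        exists nue ke : R, [/\ 0 < nue, 0 < ke &
          forall phi, weak_solution dot Ae f phi ->
            forall t, 0 <= t ->
              normE dot (phi t - pinf)
                <= ke * expR (- nue * t) * normE dot (phi 0 - pinf)] &
      forall phi, weak_solution dot Ae f phi -> regulated A C yref phi].
Proof.
move=> ki ki0 hki w yref Ae f; split.
- move=> p0; exact: (weak_well_posed hX hS hA hk hnu hexp hB hC hAC hadm hrank ki0 hki w yref p0).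
- eexists; split.
    exact: (cl_equilibrium hX hS hA hnu hexp hB hC hAC hrank ki0 hki w yref).
  exact: (weak_exp_stable hX hS hA hk hnu hexp hB hC hAC hadm hrank ki0 hki w yref).
- move=> phi hphi; split.
    exact: (regulated_window hX hS hA hk hnu hexp hB hC hAC hadm hrank ki0 hki hphi).
  by move=> t0; exact: (regulated_dom hX hS hA hk hnu hexp hB hC hAC hadm hrank ki0 hki hphi).
Qed.
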